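(* Let $(\mathfrak{G},\mathfrak{G}_{\mathrm{int}},\tilde L)$ be a cut-and-project scheme and let $W\subset\mathfrak{G}_{\mathrm{int}}$ be a window such that the model set $\Lambda(W)$ is repetitive, $\Lambda(W)-\Lambda(W)$ generates $L$, $W=\mathrm{Cl}(\mathrm{Int}(W))$, $W$ has no nontrivial translation invariance (i.e. $\{c\in\mathfrak{G}_{\mathrm{int}}: c+W=W\}=\{0\}$), and $\theta(\partial W)=0$ for the Haar measure $\theta$ of $\mathfrak{G}_{\mathrm{int}}$. Let $b:\mathfrak{G}_{\mathrm{int}}\to\mathbb{C}$ be continuous with compact support, with $\mathrm{supp}\, b\subset W$, and let $\omega=\sum_{s\in\Lambda(W)}b(s^\star)\delta_s$. Then the diffraction measure of $\omega$ is $$\widehat{\gamma_\omega}=\sum_{\chi\in\mathcal{L}}\frac{|\hat b(\chi^\star)|^2}{|\tilde L|^2}\,\delta_\chi .$$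
   Context: LCAG means locally compact, $\sigma$-compact Abelian Hausdorff group. $\mathfrak{G},\mathfrak{G}_{\mathrm{int}}$ are LCAGs with fixed Haar measures ($dx$ on $\mathfrak{G}$; $\theta$, also written $dy$, on $\mathfrak{G}_{\mathrm{int}}$); $|A|$ is the Haar measure of $A$. Cut-and-project scheme: a triple $(\mathfrak{G},\mathfrak{G}_{\mathrm{int}},\tilde L)$ where $\tilde L$ is a lattice (discrete cocompact subgroup) of $\mathfrak{G}\times\mathfrak{G}_{\mathrm{int}}$ such that the projection $\Pi:\mathfrak{G}\times\mathfrak{G}_{\mathrm{int}}\to\mathfrak{G}$ is injective on $\tilde L$ and $\Pi_{\mathrm{int}}(\tilde L)$ is dense in $\mathfrak{G}_{\mathrm{int}}$, $\Pi_{\mathrm{int}}$ being the other projection. $L:=\Pi(\tilde L)$; for $s\in L$, $s^\star:=\Pi_{\mathrm{int}}((\Pi|_{\tilde L})^{-1}(s))$. $|\tilde L|$ is the measure of a fundamental domain of $\tilde L$ for the product Haar measure. A window is a nonempty, measurable, relatively compact $W\subset\mathfrak{G}_{\mathrm{int}}$; the model set is $\Lambda(W)=\{s\in L:s^\star\in W\}$. Dual scheme: $\tilde{\mathcal{L}}\subset\widehat{\mathfrak{G}}\times\widehat{\mathfrak{G}_{\mathrm{int}}}$ is the annihilator of $\tilde L$, i.e. the set of $(\chi,\eta)$ with $\chi(s)\eta(s^\star)=1$ for all $(s,s^\star)\in\tilde L$. $(\widehat{\mathfrak{G}},\widehat{\mathfrak{G}_{\mathrm{int}}},\tilde{\mathcal{L}})$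 is a cut-and-project scheme; $\mathcal{L}$ is the projection of $\tilde{\mathcal{L}}$ to $\widehat{\mathfrak{G}}$ and for $\chi\in\mathcal{L}$, $\chi^\star$ is the unique element with $(\chi,\chi^\star)\in\tilde{\mathcal{L}}$. Dual groups are written additively, so $-\chi$ is the complex-conjugate character of $\chi$. A set $P\subset\mathfrak{G}$ has finite local complexity if it is countable and $P-P$ is closed and discrete. Such a $P$ is repetitive if for every compact $K\subset\mathfrak{G}$ there is a compact $K'\subset\mathfrak{G}$ such that for all $t_1,t_2\in\mathfrak{G}$ there is $s\in K'$ with $(t_1+P)\cap K=(s+t_2+P)\cap K$. Van Hove sequence: an increasing sequence $\{D_n\}$ of compact subsets of $\mathfrak{G}$ with $|D_n|>0$ and $\lim_n|\partial^K(D_n)|/|D_n|=0$ for every compact $K\subset\mathfrak{G}$, where $\partial^K(A):=((A+K)\setminus \mathrm{Int}(A))\cup((\mathrm{Cl}(\mathfrak{G}\setminus A)-K)\cap A)$. One is fixed. Diffraction: for a Dirac comb $\omega=\sum_{s\in S}w_s\delta_s$, the autocorrelation measure is the vague limit $\gamma_\omega$ of $|D_n|^{-1}\,\omega|_{D_n}*\widetilde{\omega|_{D_n}}$, where $\tilde\mu(B)=\overline{\mu(-B)}$. The diffraction measure is its Fourier transform $\widehat{\gamma_\omega}$. The Fourier transform of a function $f$ on an LCAG $H$ with Haar measure $h$ is $\hat f(\chi)=\int_H f(x)\overline{\chi(x)}\,dh(x)$; that of a measure $\lambda$ on $\mathfrak{G}$ (if it exists) is the unique measure $\widehat\lambda$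 on $\widehat{\mathfrak{G}}$ with $\int_{\mathfrak{G}}(\varphi*\tilde\varphi)\,d\lambda=\int_{\widehat{\mathfrak{G}}}|\widehat\varphi(-\chi)|^2\,d\widehat\lambda(\chi)$ for all continuous compactly supported $\varphi:\mathfrak{G}\to\mathbb{C}$, where $\tilde\varphi(x)=\overline{\varphi(-x)}$.
   Formalization: The weight proved is |b̂(−χ* )|²/|L̃|² in place of |b̂(χ* )|²/|L̃|²; with the stated conventions the printed sign fails for some complex-valued b, and the two agree whenever |b̂| is even, e.g. for real-valued b. *)

(* Defs.v *)
From HB Require Import structures.
From mathcomp Require Import all_boot all_order all_algebra.
From mathcomp Require Import all_classical all_reals all_analysis.
From mathcomp Require Import complex.

Set Implicit Arguments.
Unset Strict Implicit.
Unset Printing Implicit Defensive.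

Import Order.TTheory GRing.Theory Num.Theory.
Import numFieldNormedType.Exports.

Local Open Scope classical_set_scope.
Local Open Scope ring_scope.
Local Open Scope complex_scope.

(* R[i] carries the topology of its norm, as any other numFieldType does. *)
HB.instance Definition _ (R : rcfType) := GRing.ComAlgebra.copy R[i] R[i]^o.
HB.instance Definition _ (R : rcfType) := NormedModule.copy R[i] R[i]^o.

(* The library puts generated sigma-algebras on pointed types only; the point
   of a topological group is 0. *)
#[non_forgetful_inheritance]
HB.instance Definition _ (G : topologicalZmodType) := isPointed.Build G 0.

Notation borel X := (g_sigma_algebraType (@open X)).

Section TopologicalSpace.
Context (X : topologicalType).

Definition sigma_compact : Prop :=
  exists2 K : nat -> set X, (forall n, compact (K n)) & \bigcup_n K n = setT.

Definition discrete_subset (A : set X) : Prop := A `<=` isolated A.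

Definition topological_boundary (A : set X) : set X := closure A `\` interior A.

Definition tsupport (V : nmodType) (f : X -> V) : set X :=
  closure [set x | f x != 0].

Definition continuous_compact_support (R : realType) (f : X -> R[i]) : Prop :=
  continuous f /\ compact (tsupport f).

End TopologicalSpace.

Section Subgroups.
Context (A : zmodType).

Definition subgroup (L : set A) : Prop :=
  L 0 /\ forall x y, L x -> L y -> L (x - y).

Definition generated_subgroup (S : set A) : set A := smallest subgroup S.

Definition msum (P Q : set A) : set A := [set x + y | x in P & y in Q].

Definition mdiff (P Q : set A) : set A := [set x - y | x in P & y in Q].

Definition translate (t : A) (P : set A) : set A := [set t + x | x in P].

Section Cosets.
Context (L : set A) (subL : subgroup L).

Definition coset_rel : rel A := fun x y => `[< L (x - y) >].

Lemma coset_rel_refl : reflexive coset_rel.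
Proof. by move=> x; apply/asboolP; rewrite subrr; case: subL. Qed.

Lemma coset_rel_sym : symmetric coset_rel.
Proof.
case: subL => L0 LB.
have sub x y : coset_rel x y -> coset_rel y x.
  by move=> /asboolP Lxy; apply/asboolP; rewrite -opprB -sub0r; exact: LB.
by move=> x y; apply/idP/idP; exact: sub.
Qed.

Lemma coset_rel_trans : transitive coset_rel.
Proof.
case: subL => L0 LB y x z /asboolP Lxy; rewrite coset_rel_sym => /asboolP Lzy.
by apply/asboolP; rewrite -(subrKA y) -[y - z]opprB; exact: LB.
Qed.

Definition coset_equiv : equiv_rel A :=
  EquivRel coset_rel coset_rel_refl coset_rel_sym coset_rel_trans.

Definition quotient_group := {eq_quot coset_equiv}%qT.

End Cosets.
End Subgroups.

Definition lcag (G : topologicalZmodType) : Prop :=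
  [/\ hausdorff_space G, locally_compact [set: G] & sigma_compact G].

(* Complex-valued integrals are computed componentwise. *)
Definition cintegrable d (X : measurableType d) (R : realType)
    (m : {measure set X -> \bar R}) (f : X -> R[i]) : Prop :=
  m.-integrable setT (EFin \o (fun x => complex.Re (f x))) /\
  m.-integrable setT (EFin \o (fun x => complex.Im (f x))).

Definition cintegral d (X : measurableType d) (R : realType)
    (m : {measure set X -> \bar R}) (D : set X) (f : X -> R[i]) : R[i] :=
  (\int[m]_(x in D) complex.Re (f x)) +i* (\int[m]_(x in D) complex.Im (f x)).

Section RadonMeasures.
Context (R : realType) (X : ptopologicalType).

(* Inner regularity is required for every Borel set: this is the usual notion
   on a locally compact sigma-compact space, and remains the right one on a dual
   group, which need not be sigma-compact. *)
Definition radon (m : {measure set (borel X) -> \bar R}) : Prop :=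
  (forall K : set X, compact K -> (m K < +oo)%E) /\
  (forall A : set (borel X), measurable A ->
    m A = ereal_sup [set m K | K in [set K : set X | compact K /\ K `<=` A]]).

(* A complex, possibly unbounded, Radon measure, given by its polar
   decomposition: its total variation and a unimodular density. *)
Record cmeasure := CMeasure {
  tvar : {measure set (borel X) -> \bar R};
  phase : borel X -> R[i];
  tvar_radon : radon tvar;
  measurable_phase : measurable_fun setT (fun x => complex.Re (phase x)) /\
                     measurable_fun setT (fun x => complex.Im (phase x));
  norm_phase : forall x, `|phase x| = 1 }.

Definition cmintegral (nu : cmeasure) (f : X -> R[i]) : R[i] :=
  cintegral (tvar nu) setT (fun x => f x * phase nu x).

Definition cmeasure_of (nu : cmeasure) (A : set X) : R[i] :=
  cintegral (tvar nu) A (phase nu).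

Definition bounded_borel (A : set X) : Prop :=
  measurable (A : set (borel X)) /\ precompact A.

Definition cmeasure_eq (nu nu' : cmeasure) : Prop :=
  forall A, bounded_borel A -> cmeasure_of nu A = cmeasure_of nu' A.

(* nu = \sum_(x in S) c x delta_x, with nonnegative weights. *)
Definition is_weighted_comb (nu : cmeasure) (S : set X) (c : X -> R) : Prop :=
  forall A, bounded_borel A ->
    (\esum_(x in S `&` A) (c x)%:E < +oo)%E /\
    cmeasure_of nu A = (fine (\esum_(x in S `&` A) (c x)%:E)%E)%:C.

End RadonMeasures.

Section Dual.
Context (R : realType) (G : topologicalZmodType).

Record character := Character {
  char_fun :> G -> R[i];
  char_continuous : continuous char_fun;
  norm_char : forall x, `|char_fun x| = 1;
  charD : forall x y, char_fun (x + y) = char_fun x * char_fun y }.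

HB.instance Definition _ := gen_eqMixin character.
HB.instance Definition _ := gen_choiceMixin character.

Lemma characterP (chi eta : character) : chi =1 eta -> chi = eta.
Proof.
case: chi => f cf nf fD; case: eta => g cg ng gD /= /funext fg; subst g.
by congr Character; exact: Prop_irrelevance.
Qed.

Program Definition char0 := @Character (fun=> 1) _ _ _.
Next Obligation. by move=> x; exact: cvg_cst. Qed.
Next Obligation. by move=> x; rewrite normr1. Qed.
Next Obligation. by move=> x y; rewrite mulr1. Qed.

Program Definition char_opp (chi : character) :=
  @Character (fun x => (chi x)^*)%R _ _ _.
Next Obligation.
move=> chi x; apply/cvgrPdist_lt => e e0.
have /cvgrPdist_lt/(_ e e0) := @char_continuous chi x.
by apply: filterS => y; rewrite -rmorphB norm_conjC.
Qed.
Next Obligation. by move=> chi x; rewrite norm_conjC norm_char. Qed.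
Next Obligation. by move=> chi x y; rewrite /= charD rmorphM. Qed.

Program Definition char_add (chi eta : character) :=
  @Character (fun x => chi x * eta x) _ _ _.
Next Obligation.
by move=> chi eta x; apply: cvgM; exact: char_continuous.
Qed.
Next Obligation. by move=> chi eta x; rewrite normrM !norm_char mulr1. Qed.
Next Obligation. by move=> chi eta x y; rewrite /= !charD mulrACA. Qed.

Lemma char_addA : associative char_add.
Proof. by move=> a b c; apply: characterP => x /=; rewrite mulrA. Qed.

Lemma char_addC : commutative char_add.
Proof. by move=> a b; apply: characterP => x /=; rewrite mulrC. Qed.

Lemma char_add0 : left_id char0 char_add.
Proof. by move=> a; apply: characterP => x /=; rewrite mul1r. Qed.

Lemma char_addN : left_inverse char0 char_opp char_add.
Proof.
by move=> a; apply: characterP => x /=; rewrite mulrC -normCK norm_char expr1n.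
Qed.

HB.instance Definition _ :=
  GRing.isZmodule.Build character char_addA char_addC char_add0 char_addN.
HB.instance Definition _ := isPointed.Build character 0.
HB.instance Definition _ := Topological.copy character
  (@initial_topology character {compact-open, G -> R[i]} char_fun).

End Dual.

Section HaarMeasure.
Context (R : realType) (G : topologicalZmodType).
Context (mu : {measure set (borel G) -> \bar R}).

Definition haar : Prop :=
  [/\ radon mu,
      forall (t : G) (A : set (borel G)), measurable A ->
        mu (translate t A) = mu A
    & (0 < mu setT)%E].

Definition fourier (f : G -> R[i]) (chi : character R G) : R[i] :=
  cintegral mu setT (fun x => f x * (chi x)^*%R).

Definition convolution (f g : G -> R[i]) (x : G) : R[i] :=
  cintegral mu setT (fun y => f y * g (x - y)).

Definition tilde (f : G -> R[i]) (x : G) : R[i] := (f (- x))^*%R.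

Definition transforms_to (gamma : cmeasure R G)
    (nu : cmeasure R (character R G)) : Prop :=
  forall phi : G -> R[i], continuous_compact_support phi ->
    let h chi : R[i] := `|fourier phi (- chi)| ^+ 2 in
    cintegrable (tvar nu) h /\
    cmintegral gamma (convolution phi (tilde phi)) = cmintegral nu h.

Definition is_fourier_transform (gamma : cmeasure R G)
    (nu : cmeasure R (character R G)) : Prop :=
  transforms_to gamma nu /\
  forall nu', transforms_to gamma nu' -> cmeasure_eq nu' nu.

Definition van_hove_boundary (K A : set G) : set G :=
  (msum A K `\` interior A) `|` (mdiff (closure (~` A)) K `&` A).

Definition van_hove (D : nat -> set G) : Prop :=
  [/\ forall n, D n `<=` D n.+1,
      forall n, compact (D n),
      forall n, (0 < mu (D n))%E
    & forall K : set G, compact K ->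
        (fun n => fine (mu (van_hove_boundary K (D n))) / fine (mu (D n)))
          @ \oo --> (0 : R)].

End HaarMeasure.

(* Compactly supported measures are handled as functionals f |-> \int f. *)
Section Diffraction.
Context (R : realType) (G : topologicalZmodType).
Context (mu : {measure set (borel G) -> \bar R}) (D : nat -> set G).

(* The restriction to B of \sum_(s in S) w s delta_s.  The sum is finite when
   S is locally finite and B is compact. *)
Definition restricted_comb (S : set G) (w : G -> R[i]) (B : set G) :
    (G -> R[i]) -> R[i] :=
  fun f => \sum_(s \in S `&` B) w s * f s.

Definition measure_tilde (m : (G -> R[i]) -> R[i]) : (G -> R[i]) -> R[i] :=
  fun f => (m (fun x => (f (- x))^*%R))^*%R.

Definition measure_convolution (m m' : (G -> R[i]) -> R[i]) :
    (G -> R[i]) -> R[i] :=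
  fun f => m (fun x => m' (fun y => f (x + y))).

(* Vague convergence. *)
Definition is_autocorrelation (S : set G) (w : G -> R[i])
    (gamma : cmeasure R G) : Prop :=
  forall f : G -> R[i], continuous_compact_support f ->
    (fun n => ((fine (mu (D n)))^-1)%:C *
       measure_convolution (restricted_comb S w (D n))
         (measure_tilde (restricted_comb S w (D n))) f)
      @ \oo --> cmintegral gamma f.

Definition is_diffraction (S : set G) (w : G -> R[i])
    (nu : cmeasure R (character R G)) : Prop :=
  exists2 gamma, is_autocorrelation S w gamma & is_fourier_transform mu gamma nu.

End Diffraction.

Section PointSets.
Context (G : topologicalZmodType).

Definition finite_local_complexity (P : set G) : Prop :=
  [/\ countable P, closed (mdiff P P) & discrete_subset (mdiff P P)].

Definition repetitive (P : set G) : Prop :=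
  finite_local_complexity P /\
  forall K : set G, compact K -> exists2 K' : set G, compact K' &
    forall t1 t2 : G, exists2 s, K' s &
      translate t1 P `&` K = translate (s + t2) P `&` K.

End PointSets.

Definition star (X Y : zmodType) (M : set (X * Y)) (x : X) : Y :=
  xget 0 [set y | M (x, y)].

Section CutAndProject.
Context (G H : topologicalZmodType).

Record lattice (L : set (G * H)) : Prop := Lattice {
  lattice_subgroup : subgroup L;
  lattice_discrete : discrete_subset L;
  lattice_cocompact :
    compact [set: quotient_topology (quotient_group lattice_subgroup)] }.

Definition cut_and_project (L : set (G * H)) : Prop :=
  [/\ lattice L, set_inj L fst & dense (snd @` L)].

Definition window (W : set H) : Prop :=
  [/\ W !=set0, measurable (W : set (borel H)) & precompact W].

Definition model_set (L : set (G * H)) (W : set H) : set G :=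
  [set s | (fst @` L) s /\ W (star L s)].

(* Fundamental domains are taken in the product of the Borel sigma-algebras,
   the domain of the product measure. *)
Definition fundamental_domain (L : set (G * H))
    (F : set (borel G * borel H)) : Prop :=
  measurable F /\ forall z : G * H, exists! f : G * H, F f /\ L (z - f).

(* On L, a pair (chi, eta) of the annihilator satisfies
   chi s = (eta (star L s))^*, so the Fourier-Bohr coefficient at chi of
   \sum_s b (star L s) delta_s, i.e. the mean of b (star L s) * (chi s)^*,
   is fourier theta b (- eta) divided by the covolume of L. *)
Definition annihilator (R : realType) (L : set (G * H)) :
    set (character R G * character R H) :=
  [set p : character R G * character R H |
    forall z : G * H, L z -> p.1 z.1 * p.2 z.2 = 1].

End CutAndProject.

Arguments annihilator {G H} R L.

(* Main.v *)
Require Import Defs.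
From HB Require Import structures.
From mathcomp Require Import all_boot all_order all_algebra.
From mathcomp Require Import all_classical all_reals all_analysis.
From mathcomp Require Import complex measurable_realfun.
From mathcomp Require Import ring lra.

(* For a test function [phi], put u (x, y) = \sum_(l in L) phi (x + l.1) b (y + l.2)
   on G x H.  As L is cocompact, u is almost periodic on the discrete group G x H.
   Unfolding the sum over a fundamental domain, the mean of u is
   \int phi * \int b / covol L, its Fourier-Bohr coefficient at a pair (chi, eta)
   of the annihilator is the product of the Fourier coefficients of phi and b
   divided by covol L, and all its other coefficients vanish.

   Since L^star is dense in H, the mean of u can be approached by averaging
   translates along G only; along a van Hove sequence this gives the density
   formula, hence the autocorrelation: it is \sum_(t in L) c t delta_t, where
   c t is \int b y * (b (y - t^star))^* dy / covol L.  The integral of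
   phi * tilde phi against it is the mean of |u|^2, so the Parseval identity for u
   is the assertion that the announced measure is a Fourier transform of the
   autocorrelation.

   Parseval's identity comes from the spectral theory of convolution by a
   Hermitian almost periodic function, which is a Hilbert-Schmidt operator
   commuting with translations.  For uniqueness, |ft phi|^2 can be multiplied by
   trigonometric polynomials on the dual group, which separate compact sets; with
   an approximate identity the measure of every compact set is determined. *)

Set Implicit Arguments.
Unset Strict Implicit.
Unset Printing Implicit Defensive.

Import Order.TTheory GRing.Theory Num.Theory.
Import numFieldNormedType.Exports.

Local Open Scope classical_set_scope.
Local Open Scope ring_scope.

(** On the discrete group G x H the mean is an elementary limit of finite averages, so neither a
    Bohr compactification nor an invariant measure on a quotient or a dual group is constructed. The
    price is that characters of the discrete group have no continuity; it is recovered only for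
    those with a nonzero coefficient, which is all that Parseval's identity sees.

    Poisson summation would give the same weights, but [b] is merely continuous and its transform
    need not be summable over the dual lattice. Squares of coefficients are summable by Bessel's
    inequality, and [transforms_to] only involves functions [phi * tilde phi], whose transforms are
    squares: hence Parseval instead of Poisson.

    [transforms_to] takes the transform of [phi] at [- chi], and the coefficient of u at a point [p]
    of the annihilator is read at [p.1] and [p.2]; so the weight at [chi] comes from the point
    [(- chi, - star Ldual chi)].

    In the dual group the complement of a compact set may have infinite measure. Uniqueness
    therefore compares functions in L^1 and applies inner regularity to the finite measures with
    density |ft phi|^2. *)

Notation nm := Normc.normc.

(** * The real-valued modulus of complex numbers *)

Section ComplexNorm.
Context (R : realType).
Implicit Types x y z : R[i].

(** The library norm takes its values in the partially ordered field [R[i]]; [nm z] is the same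
    number in [R], where suprema and linear arithmetic are available. *)
Lemma nmE z : `|z| = (nm z)%:C%C :> R[i]. Proof. by []. Qed.
Lemma nm0 : nm (0 : R[i]) = 0. Proof. exact: Normc.normc0. Qed.
Lemma nm1 : nm (1 : R[i]) = 1. Proof. exact: Normc.normc1. Qed.
Lemma nmM x y : nm (x * y) = nm x * nm y. Proof. exact: Normc.normcM. Qed.
Lemma nmV x : nm (x^-1) = (nm x)^-1. Proof. exact: Normc.normcV. Qed.
Lemma nmN x : nm (- x) = nm x. Proof. exact: normcN. Qed.
Lemma nmD x y : nm (x + y) <= nm x + nm y. Proof. exact: le_normcD. Qed.
Lemma nmB x y : nm (x - y) <= nm x + nm y.
Proof. by rewrite -(nmN y); exact: nmD. Qed.
Lemma nmBC x y : nm (x - y) = nm (y - x). Proof. by rewrite -nmN opprB. Qed.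
Lemma nm_ge0 x : 0 <= nm x. Proof. by case: x => a b; exact: sqrtr_ge0. Qed.
Lemma nm_eq0 x : (nm x == 0) = (x == 0).
Proof. by apply/eqP/eqP => [/Normc.eq0_normc//|->]; rewrite nm0. Qed.
Lemma nm_gt0 x : (0 < nm x) = (x != 0).
Proof. by rewrite lt_neqAle nm_ge0 andbT eq_sym nm_eq0. Qed.
Lemma nm_conj x : nm x^* = nm x.
Proof. by case: x => a b /=; rewrite sqrrN. Qed.
Lemma nm_real (a : R) : nm (a%:C%C) = `|a|.
Proof. by rewrite /= expr0n addr0 sqrtr_sqr. Qed.
Lemma nm_triangle y x z : nm (x - z) <= nm (x - y) + nm (y - z).
Proof. by rewrite -[x - z](subrKA y); exact: nmD. Qed.
Lemma nm_sqr x : x * x^* = (nm x ^+ 2)%:C%C.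
Proof. by rewrite -normCK nmE rmorphXn. Qed.
Lemma ler_Re x : `|complex.Re x| <= nm x.
Proof. by have := normc_ge_Re x; rewrite nmE lecR. Qed.
Lemma ler_Im x : `|complex.Im x| <= nm x.
Proof.
case: x => a b /=; rewrite -sqrtr_sqr ler_sqrt ?addr_ge0 ?sqr_ge0//.
by rewrite lerDr sqr_ge0.
Qed.
Lemma nm_ReIm x : nm x <= `|complex.Re x| + `|complex.Im x|.
Proof.
case: x => a b /=; rewrite -[leRHS]ger0_norm ?addr_ge0// -sqrtr_sqr.
rewrite ler_sqrt ?sqr_ge0// sqrrD !real_normK ?num_real//.
by rewrite -addrA lerD2l lerDr mulrn_wge0// mulr_ge0.
Qed.
Lemma nm_sum (I : Type) (r : seq I) (P : pred I) (F : I -> R[i]) :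
  nm (\sum_(i <- r | P i) F i) <= \sum_(i <- r | P i) nm (F i).
Proof.
elim/big_rec2: _ => [|i y z _ le]; first by rewrite nm0.
by apply: le_trans (nmD _ _) _; rewrite lerD2l.
Qed.
Lemma cjM x y : (x * y)^* = x^* * y^*. Proof. exact: rmorphM. Qed.
Lemma cjB x y : (x - y)^* = x^* - y^*. Proof. exact: rmorphB. Qed.
Lemma cjK x : x^*^* = x. Proof. exact: conjCK. Qed.
Lemma cj_real (a : R) : (a%:C%C)^* = a%:C%C. Proof. exact: conjc_real. Qed.
Lemma cjV x : (x^-1)^* = (x^*)^-1. Proof. exact: fmorphV. Qed.
Lemma rcM (a b : R) : (a * b)%:C%C = a%:C%C * b%:C%C. Proof. exact: rmorphM. Qed.
Lemma rcB (a b : R) : (a - b)%:C%C = a%:C%C - b%:C%C. Proof. exact: rmorphB. Qed.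
Lemma rcV (a : R) : (a^-1)%:C%C = (a%:C%C)^-1. Proof. exact: fmorphV. Qed.
Lemma rc_sum (I : Type) (r : seq I) (P : pred I) (F : I -> R) :
  (\sum_(i <- r | P i) F i)%:C%C = \sum_(i <- r | P i) (F i)%:C%C.
Proof. exact: rmorph_sum. Qed.
Lemma nm_le0_eq x y : (forall e, 0 < e -> nm (x - y) <= e) -> x = y.
Proof.
move=> h; apply/eqP; rewrite -subr_eq0 -nm_eq0 eq_le nm_ge0 andbT.
by apply/ler_addgt0Pl => e e0; rewrite addr0; exact: h.
Qed.

End ComplexNorm.

(** * Means of almost periodic functions on a discrete group *)

Section AlmostPeriodic.
Context (R : realType).
Local Notation C := R[i].
Implicit Types Z : zmodType.

(* Bochner almost periodicity: the translates of [u] are uniformly totally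
   bounded, witnessed by a finite colouring. *)
Definition ap Z (u : Z -> C) : Prop := forall e : R, 0 < e ->
  exists (I : finType) (k : Z -> I), forall x y, k x = k y ->
    forall z, nm (u (x + z) - u (y + z)) <= e.

(** Representatives of the colours form a finite net. A colour that is never taken is sent to 0,
    whence the restriction to colours [k x]. *)
Lemma color_repr (Z : zmodType) (I : Type) (k : Z -> I) :
  exists r : I -> Z, forall x, k (r (k x)) = k x.
Proof.
have /choice[r hr] : forall i, exists y, forall x, k x = i -> k y = i.
  move=> i.
  have [[y yi]|n] := pselect (exists x, k x = i); first by exists y.
  by exists 0 => x xi; case: n; exists x.
by exists r => x; exact: hr.
Qed.

Lemma sum_seq_cst (I : Type) (K : pzRingType) (s : seq I) (c : K) :
  \sum_(w <- s) c = (size s)%:R * c.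
Proof. by rewrite big_const_seq count_predT iter_addr_0 mulr_natl. Qed.

Lemma ap_bounded Z (u : Z -> C) : ap u ->
  exists2 B, 0 < B & forall z, nm (u z) <= B.
Proof.
move=> /(_ 1 ltr01)[I [k hk]].
have [r hr] := color_repr k.
exists (1 + \sum_i nm (u (r i))) => [|z].
  by rewrite ltr_pwDl ?ltr01// sumr_ge0// => i _; exact: nm_ge0.
have := hk z (r (k z)) (esym (hr z)) 0; rewrite !addr0 => h.
rewrite -[u z](subrK (u (r (k z)))).
apply: le_trans (nmD _ _) _; apply: lerD => //.
rewrite (bigD1 (k z))//= lerDl; apply: sumr_ge0 => i _; exact: nm_ge0.
Qed.

Lemma ap_net Z (u : Z -> C) : ap u -> forall e, 0 < e ->
  exists s : seq Z, forall x, exists2 y, y \in s &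
    forall z, nm (u (x + z) - u (y + z)) <= e.
Proof.
move=> apu e /apu[I [k hk]].
have [r hr] := color_repr k.
exists [seq r i | i <- enum I] => x; exists (r (k x)).
  by apply/mapP; exists (k x); rewrite ?mem_enum.
by move=> z; apply: hk; rewrite hr.
Qed.

Lemma ap_lim Z (u : Z -> C) :
  (forall e, 0 < e -> exists2 v, ap v & forall z, nm (u z - v z) <= e) ->
  ap u.
Proof.
move=> h e e0; have e3 : 0 < e / 3 by rewrite divr_gt0.
have [v /(_ _ e3)[I [k hk]] uv] := h _ e3.
exists I, k => x y /hk{}hk z.
apply: le_trans (nm_triangle (v (x + z)) _ _) _.
have := nm_triangle (v (y + z)) (v (x + z)) (u (y + z)).
have := uv (x + z); have := uv (y + z); rewrite (nmBC (u (y + z))).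
have := hk z; lra.
Qed.

(** Pairs of colours make a colouring, so whatever depends uniformly continuously on the values of
    [u] and [v] is almost periodic. *)
Lemma ap_unif2 Z (u v w : Z -> C) : ap u -> ap v ->
  (forall e, 0 < e -> exists2 d, 0 < d & forall x y,
    nm (u x - u y) <= d -> nm (v x - v y) <= d -> nm (w x - w y) <= e) ->
  ap w.
Proof.
move=> apu apv h e /h[d d0 hd].
have [I [k hk]] := apu d d0; have [J [l hl]] := apv d d0.
exists (I * J)%type, (fun x => (k x, l x)) => x y [kxy lxy] z.
by apply: hd; [exact: hk | exact: hl].
Qed.

Lemma ap_cst Z (c : C) : ap (fun _ : Z => c).
Proof.
by move=> e e0; exists unit, (fun=> tt) => x y _ z; rewrite subrr nm0 ltW.
Qed.

Lemma apD Z (u v : Z -> C) : ap u -> ap v -> ap (fun z => u z + v z).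
Proof.
move=> apu apv; apply: (ap_unif2 apu apv) => e e0.
exists (e / 2) => [|x y hu hv]; first by rewrite divr_gt0.
by rewrite opprD addrACA; have := nmD (u x - u y) (v x - v y); lra.
Qed.

Lemma apM Z (u v : Z -> C) : ap u -> ap v -> ap (fun z => u z * v z).
Proof.
move=> apu apv; have [B B0 hB] := ap_bounded apu.
have [B' B'0 hB'] := ap_bounded apv.
apply: (ap_unif2 apu apv) => e e0.
have BB : 0 < B + B' by rewrite addr_gt0.
exists (e / (B + B')) => [|x y hu hv]; first by rewrite divr_gt0.
have -> : u x * v x - u y * v y = u x * (v x - v y) + (u x - u y) * v y by ring.
apply: le_trans (nmD _ _) _; rewrite !nmM.
rewrite -[leRHS](divfK (lt0r_neq0 BB)) mulrDr; apply: lerD.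
  by rewrite mulrC; apply: ler_pM; rewrite ?nm_ge0.
by apply: ler_pM; rewrite ?nm_ge0.
Qed.

Lemma ap_conj Z (u : Z -> C) : ap u -> ap (fun z => (u z)^*).
Proof.
move=> apu; apply: (ap_unif2 apu apu) => e e0; exists e => // x y hu _.
by rewrite -rmorphB nm_conj.
Qed.

Lemma apZ Z (c : C) (u : Z -> C) : ap u -> ap (fun z => c * u z).
Proof. by move=> apu; apply: apM => //; exact: ap_cst. Qed.

Lemma apN Z (u : Z -> C) : ap u -> ap (fun z => - u z).
Proof.
move=> apu; apply: (ap_unif2 apu apu) => e e0; exists e => // x y hu _.
by rewrite -opprD nmN.
Qed.

Lemma apB Z (u v : Z -> C) : ap u -> ap v -> ap (fun z => u z - v z).
Proof. by move=> apu apv; apply: apD => //; exact: apN. Qed.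

Lemma ap_sum Z (I : Type) (r : seq I) (P : pred I) (u : I -> Z -> C) :
  (forall i, P i -> ap (u i)) -> ap (fun z => \sum_(i <- r | P i) u i z).
Proof.
move=> h; elim: r => [|i r ih].
  by under eq_fun do rewrite big_nil; exact: ap_cst.
have [Pi|nPi] := boolP (P i); last first.
  by under eq_fun do rewrite big_cons (negbTE nPi).
under eq_fun do rewrite big_cons Pi.
exact: apD (h i Pi) ih.
Qed.

Lemma ap_shift Z (u : Z -> C) a : ap u -> ap (fun z => u (z + a)).
Proof.
move=> apu e /apu[I [k hk]]; exists I, k => x y /hk{}hk z.
by rewrite -!addrA.
Qed.

Lemma ap_comp Z Z' (h : Z' -> Z) (u : Z -> C) :
  (forall x y, h (x + y) = h x + h y) -> ap u -> ap (u \o h).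
Proof.
move=> hD apu e /apu[I [k hk]]; exists I, (k \o h) => x y /hk{}hk z.
by rewrite /= !hD.
Qed.

Lemma apNV Z (u : Z -> C) : ap u -> ap (fun z => u (- z)).
Proof. by apply: (ap_comp (h := -%R)) => x y; rewrite opprD. Qed.

Definition avg Z (K : fieldType) (s : seq Z) (u : Z -> K) (z : Z) : K :=
  (size s)%:R^-1 * \sum_(w <- s) u (z + w).

(** Averages over [s] and over [t] compose to the average over [addseq s t]; as they commute,
    several means can be approached with one sequence. *)
Definition addseq Z (s t : seq Z) : seq Z := [seq x + y | x <- s, y <- t].

Lemma addseq_neq0 Z (s t : seq Z) : s != [::] -> t != [::] ->
  addseq s t != [::].
Proof. by rewrite -!size_eq0 size_allpairs muln_eq0 negb_or => -> ->. Qed.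

Lemma avg_addseq Z (K : fieldType) (s t : seq Z) (u : Z -> K) z :
  avg (addseq s t) u z = avg s (avg t u) z.
Proof.
rewrite /avg size_allpairs natrM invfM -mulrA; congr (_ * _).
rewrite big_allpairs_dep /= mulr_sumr; apply: eq_bigr => x _.
by congr (_ * _); apply: eq_bigr => y _; rewrite addrA.
Qed.

Lemma avgC Z (K : fieldType) (s t : seq Z) (u : Z -> K) z :
  avg s (avg t u) z = avg t (avg s u) z.
Proof.
rewrite /avg; under eq_bigr do rewrite mulr_sumr.
rewrite exchange_big /= mulr_sumr [in RHS]mulr_sumr; apply: eq_bigr => y _.
rewrite -mulr_sumr mulrCA; congr (_ * (_ * _)); apply: eq_bigr => x _.
by rewrite addrAC.
Qed.

Lemma avgB_le Z (s : seq Z) (u : Z -> R) a e z : s != [::] ->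
  (forall z, `|u z - a| <= e) -> `|avg s u z - a| <= e.
Proof.
move=> s0 h; have n0 : (0 : R) < (size s)%:R by rewrite ltr0n lt0n size_eq0.
have -> : avg s u z - a = (size s)%:R^-1 * \sum_(w <- s) (u (z + w) - a).
  by rewrite big_split/= sumrN sum_seq_cst mulrBr mulKf// lt0r_neq0.
rewrite normrM gtr0_norm ?invr_gt0// ler_pdivrMl//.
apply: le_trans (ler_norm_sum _ _ _) _.
rewrite -sum_seq_cst.
by apply: ler_sum => w _; exact: h.
Qed.

Lemma avg_lipC Z (s : seq Z) (u v : Z -> C) e z : s != [::] ->
  (forall z, nm (u z - v z) <= e) -> nm (avg s u z - avg s v z) <= e.
Proof.
move=> s0 h; have n0 : (0 : R) < (size s)%:R by rewrite ltr0n lt0n size_eq0.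
rewrite -mulrBr -sumrB nmM nmV -[_%:R]/(_%:R)%R -(rmorph_nat (real_complex R)).
rewrite nm_real gtr0_norm// ler_pdivrMl//.
apply: le_trans (nm_sum _ _ _) _.
rewrite -sum_seq_cst.
by apply: ler_sum => w _; exact: h.
Qed.

Lemma avg_cst Z (K : numFieldType) (s : seq Z) (c : K) z : s != [::] ->
  avg s (fun=> c) z = c.
Proof.
move=> s0; by rewrite /avg sum_seq_cst mulKf// pnatr_eq0 size_eq0.
Qed.

Lemma avg_leC Z (s : seq Z) (u : Z -> C) a e z : s != [::] ->
  (forall z, nm (u z - a) <= e) -> nm (avg s u z - a) <= e.
Proof.
by move=> s0 h; rewrite -(avg_cst a z s0); exact: (@avg_lipC _ s u (fun=> a)).
Qed.

(* Averaging the translates of an almost minimal average [v] over a net pushes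
   all values of [v] close to its supremum. *)
Lemma real_mean_exists Z (v : Z -> R) :
  (forall e : R, 0 < e -> exists (I : finType) (k : Z -> I),
    forall x y, k x = k y -> forall z, `|v (x + z) - v (y + z)| <= e) ->
  exists a, forall e, 0 < e ->
    exists2 s : seq Z, s != [::] & forall z, `|avg s v z - a| <= e.
Proof.
move=> apv.
have [B hB] : exists B, forall z, `|v z| <= B.
  have /ap_bounded[B B0 hB] : ap (fun z => (v z)%:C%C).
    move=> e /apv[I [k hk]]; exists I, k => x y /hk h z.
    by rewrite -rmorphB nm_real.
  by exists B => z; rewrite -nm_real.
(* The uniform upper bounds of averages of [v]; their infimum is the mean. *)
pose S := [set b | exists2 s : seq Z, s != [::] & forall z, avg s v z <= b].
have S0 : S !=set0.
  exists B, [:: 0] => // z; rewrite /avg big_seq1 invr1 mul1r.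
  exact: le_trans (ler_norm _) _.
have lbS : lbound S (- B).
  move=> b [s s0 hs]; apply: le_trans (hs 0); rewrite -lerN2 opprK.
  apply: le_trans (ler_norm _) _; rewrite normrN.
  by have := @avgB_le _ s v 0 B 0 s0; rewrite subr0; apply => z; rewrite subr0.
have infS : has_inf S by split => //; exists (- B).
exists (inf S) => e e0.
have [I [k hk]] := apv (e / 2) ltac:(by rewrite divr_gt0).
have [r hr] := color_repr k.
set n : R := #|I|%:R.
have n0 : 0 < n by rewrite ltr0n; apply/card_gt0P; exists (k 0).
pose d := e / (4 * n).
have d0 : 0 < d by rewrite divr_gt0// mulr_gt0.
have [b [s s0 hs] bd] := @inf_adherent _ S d d0 infS.
exists s => // z.
pose t := [seq r i | i <- enum I].
have t0 : t != [::] by rewrite -size_eq0 size_map -cardE -lt0n -(ltr0n R).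
(* Otherwise [inf S - d] would bound an average from above and belong to [S]. *)
have [z0 hz0] : exists z0, inf S - d < avg (addseq t s) v z0.
  apply: contrapT => h; have : S (inf S - d).
    exists (addseq t s); first exact: addseq_neq0.
    by move=> z'; rewrite leNgt; apply/negP => h'; apply: h; exists z'.
  by move=> /(ge_inf infS.2); lra.
move: hz0; rewrite avg_addseq {1}/avg size_map -cardE -/n big_map big_enum /=.
rewrite mulrC ltr_pdivlMr// => hz0.
have nd : n * d = e / 4 by rewrite /d; field; rewrite lt0r_neq0.
have n1 : 1 <= n by rewrite /n ler1n -(ltr0n R).
have de : d <= e / 4 by rewrite -nd ler_peMl// ltW.
(* The [n] averages at the points [z0 + r i] have mean above [inf S - d] and each is at most
   [inf S + d], so none is below [inf S - (2 * n - 1) * d]; and [n * d = e / 4]. *)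
have low i : inf S - e / 2 <= avg s v (z0 + r i).
  have : \sum_(j | j != i) avg s v (z0 + r j) <= (n - 1) * (inf S + d).
    have -> : (n - 1) * (inf S + d) = \sum_(j | j != i) (inf S + d).
      rewrite sumr_const -mulr_natl /n; congr (_ * _).
      rewrite -(cardC (pred1 i)) card1 natrD addrAC subrr add0r.
      by congr (_%:R); exact: eq_card.
    apply: ler_sum => j _; exact: le_trans (hs _) (ltW bd).
  move: hz0; rewrite (bigD1 i) //=.
  have -> : (inf S - d) * n = n * inf S - n * d by ring.
  have -> : (n - 1) * (inf S + d) = n * inf S - inf S + n * d - d by ring.
  by lra.
(* The value at [z] is compared with the value at [z0] translated by the representative of the
   colour of [z - z0]. *)
have close : `|avg s v z - avg s v (z0 + r (k (z - z0)))| <= e / 2.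
  have := @avgB_le _ s (fun w => v (z - z0 + w) - v (r (k (z - z0)) + w)) 0
    (e / 2) z0 s0.
  rewrite subr0; set X := avg _ _ _ => h; suff -> : avg s v z - 
    avg s v (z0 + r (k (z - z0))) = X.
    by apply: h => w; rewrite subr0; apply: hk; rewrite hr.
  rewrite /X /avg -mulrBr -sumrB; congr (_ * _); apply: eq_bigr => w _.
  by rewrite !addrA subrK [r _ + z0]addrC.
rewrite ler_norml; have := low (k (z - z0)); have := hs z.
by move: close; rewrite ler_norml => /andP[? ?] ? ?; apply/andP; split; lra.
Qed.

(** Von Neumann's description of the mean: averages over finitely many translates approach it
    uniformly, without any invariant measure. *)
Definition is_mean Z (u : Z -> C) (a : C) : Prop := forall e : R, 0 < e ->
  exists2 s : seq Z, s != [::] & forall z, nm (avg s u z - a) <= e.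

Lemma avg_Re Z (s : seq Z) (u : Z -> C) z :
  complex.Re (avg s u z) = avg s (fun z => complex.Re (u z)) z.
Proof.
rewrite /avg -(rmorph_nat (real_complex R)) -fmorphV.
case E : (\sum_(w <- s) u (z + w)) => [a b] /=; rewrite mul0r subr0.
by congr (_ * _); rewrite -[a]/(complex.Re (a +i* b)%C) -E raddf_sum.
Qed.

Lemma avg_Im Z (s : seq Z) (u : Z -> C) z :
  complex.Im (avg s u z) = avg s (fun z => complex.Im (u z)) z.
Proof.
rewrite /avg -(rmorph_nat (real_complex R)) -fmorphV.
case E : (\sum_(w <- s) u (z + w)) => [a b] /=; rewrite mul0r addr0.
by congr (_ * _); rewrite -[b]/(complex.Im (a +i* b)%C) -E raddf_sum.
Qed.

Lemma mean_exists Z (u : Z -> C) : ap u -> exists a, is_mean u a.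
Proof.
move=> apu.
have [|a ha] := @real_mean_exists Z (fun z => complex.Re (u z)).
  move=> e /apu[I [k hk]]; exists I, k => x y /hk{}hk z.
  by rewrite -raddfB; exact: le_trans (ler_Re _) (hk z).
have [|b hb] := @real_mean_exists Z (fun z => complex.Im (u z)).
  move=> e /apu[I [k hk]]; exists I, k => x y /hk{}hk z.
  by rewrite -raddfB; exact: le_trans (ler_Im _) (hk z).
exists (a +i* b)%C => e e0.
have [s s0 hs] := ha (e / 2) ltac:(by rewrite divr_gt0).
have [t t0 ht] := hb (e / 2) ltac:(by rewrite divr_gt0).
exists (addseq s t); first exact: addseq_neq0.
move=> z; apply: le_trans (nm_ReIm _) _; rewrite !raddfB /= avg_Re avg_Im.
rewrite avg_addseq avgC avg_addseq.
have := avgB_le z t0 hs; have := avgB_le z s0 ht.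
by rewrite (avgC t); lra.
Qed.

(** The two averages commute, and applying both gives a number close to [a] and to [b]. *)
Lemma is_mean_unique Z (u : Z -> C) a b : is_mean u a -> is_mean u b -> a = b.
Proof.
move=> ha hb; apply: nm_le0_eq => e e0.
have [s s0 hs] := ha (e / 2) ltac:(by rewrite divr_gt0).
have [t t0 ht] := hb (e / 2) ltac:(by rewrite divr_gt0).
have := nm_triangle (avg t (avg s u) 0) a b; rewrite (nmBC a (avg _ _ _)).
have := avg_leC 0 t0 hs; have := avg_leC 0 s0 ht; rewrite (avgC s).
by lra.
Qed.

Definition mean Z (u : Z -> C) : C := xget 0 (is_mean u).

Lemma meanP Z (u : Z -> C) : ap u -> is_mean u (mean u).
Proof. by move=> /mean_exists[a ha]; rewrite /mean; case: xgetP => [//|/(_ a)]; exact. Qed.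

Lemma meanE Z (u : Z -> C) a : is_mean u a -> mean u = a.
Proof.
move=> ha; rewrite /mean; case: xgetP => [b _ hb|/(_ a)//].
exact: is_mean_unique hb ha.
Qed.

End AlmostPeriodic.

(** * The mean as an invariant positive functional, and its inner product *)

Section MeanTheory.
Context (R : realType).
Local Notation C := R[i].
Implicit Types (Z : zmodType) (c : C).

Lemma avgD Z (s : seq Z) (u v : Z -> C) z :
  avg s (fun z => u z + v z) z = avg s u z + avg s v z.
Proof. by rewrite /avg big_split mulrDr. Qed.

Lemma avgZ Z (s : seq Z) c (u : Z -> C) z :
  avg s (fun z => c * u z) z = c * avg s u z.
Proof. by rewrite /avg -mulr_sumr mulrCA. Qed.

Lemma mean2P Z (u v : Z -> C) e : ap u -> ap v -> 0 < e ->
  exists s : seq Z, [/\ s != [::], forall z, nm (avg s u z - mean u) <= e &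
    forall z, nm (avg s v z - mean v) <= e].
Proof.
move=> apu apv e0; have [s s0 hs] := meanP apu e0.
have [t t0 ht] := meanP apv e0.
exists (addseq s t); split => [|z|z]; first exact: addseq_neq0.
  by rewrite avg_addseq avgC; exact: avg_leC.
by rewrite avg_addseq; exact: avg_leC.
Qed.

Lemma meanD Z (u v : Z -> C) : ap u -> ap v ->
  mean (fun z => u z + v z) = mean u + mean v.
Proof.
move=> apu apv; apply: meanE => e e0.
have [s [s0 hu hv]] := mean2P apu apv (divr_gt0 e0 (ltr0n R 2)).
exists s => // z; rewrite avgD opprD addrACA.
have := nmD (avg s u z - mean u) (avg s v z - mean v).
by have := hu z; have := hv z; lra.
Qed.

Lemma meanZ Z c (u : Z -> C) : ap u -> mean (fun z => c * u z) = c * mean u.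
Proof.
move=> apu; apply: meanE => e e0.
have c0 : 0 < nm c + 1 by rewrite ltr_wpDl ?nm_ge0.
have [s s0 hs] := meanP apu (divr_gt0 e0 c0).
exists s => // z; rewrite avgZ -mulrBr nmM.
rewrite -[leRHS](divfK (lt0r_neq0 c0)) mulrC; apply: ler_pM; rewrite ?nm_ge0//.
by rewrite lerDl.
Qed.

Lemma mean_cst Z (c : C) : mean (fun _ : Z => c) = c.
Proof.
apply: meanE => e e0; exists [:: 0] => // z.
by rewrite avg_cst// subrr nm0 ltW.
Qed.

Lemma meanN Z (u : Z -> C) : ap u -> mean (fun z => - u z) = - mean u.
Proof.
move=> apu; rewrite -mulN1r -meanZ//.
by congr mean; apply/funext => z; rewrite mulN1r.
Qed.

Lemma meanB Z (u v : Z -> C) : ap u -> ap v ->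
  mean (fun z => u z - v z) = mean u - mean v.
Proof. by move=> apu apv; rewrite meanD// ?meanN//; exact: apN. Qed.

Lemma mean_sum Z (I : Type) (r : seq I) (P : pred I) (u : I -> Z -> C) :
  (forall i, P i -> ap (u i)) ->
  mean (fun z => \sum_(i <- r | P i) u i z) = \sum_(i <- r | P i) mean (u i).
Proof.
move=> h; elim: r => [|i r ih].
  by under eq_fun do rewrite big_nil; rewrite big_nil mean_cst.
rewrite big_cons; have [Pi|nPi] := boolP (P i); last first.
  by under eq_fun do rewrite big_cons (negbTE nPi).
under eq_fun do rewrite big_cons Pi.
by rewrite -ih; apply: meanD; [exact: h|exact: ap_sum].
Qed.

Lemma avg_conj Z (s : seq Z) (u : Z -> C) z :
  avg s (fun z => (u z)^*) z = (avg s u z)^*.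
Proof. by rewrite /avg rmorphM fmorphV rmorph_nat rmorph_sum. Qed.

Lemma mean_conj Z (u : Z -> C) : ap u -> mean (fun z => (u z)^*) = (mean u)^*.
Proof.
move=> apu; apply: meanE => e /(meanP apu)[s s0 hs].
by exists s => // z; rewrite avg_conj -rmorphB nm_conj.
Qed.

Lemma mean_shift Z (u : Z -> C) a : ap u -> mean (fun z => u (z + a)) = mean u.
Proof.
move=> apu; apply: meanE => e /(meanP apu)[s s0 hs]; exists s => // z.
suff -> : avg s (fun z => u (z + a)) z = avg s u (z + a) by [].
by rewrite /avg; under eq_bigr do rewrite addrAC.
Qed.

Lemma meanNV Z (u : Z -> C) : ap u -> mean (fun z => u (- z)) = mean u.
Proof.
move=> apu; apply: meanE => e /(meanP apu)[s s0 hs].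
exists [seq - x | x <- s]; first by rewrite -size_eq0 size_map size_eq0.
move=> z; suff -> : avg [seq - x | x <- s] (fun z => u (- z)) z = avg s u (- z).
  by [].
rewrite /avg size_map big_map; congr (_ * _); apply: eq_bigr => x _.
by rewrite opprD opprK.
Qed.

Lemma mean_reflect Z (u : Z -> C) a : ap u ->
  mean (fun z => u (a - z)) = mean u.
Proof.
move=> apu; rewrite -[RHS](mean_shift a)// -[RHS]meanNV; last exact: ap_shift.
by congr mean; apply/funext => z; rewrite addrC.
Qed.

Lemma nm_mean_le Z (u : Z -> C) B : ap u -> (forall z, nm (u z) <= B) ->
  nm (mean u) <= B.
Proof.
move=> apu h; apply/ler_addgt0Pr => e e0.
have [s s0 hs] := meanP apu e0.
have := nm_triangle (avg s u 0) (mean u) 0; rewrite !subr0 (nmBC (mean u)).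
have := hs 0; have := @avg_leC R Z s u 0 B 0 s0; rewrite subr0.
have hB z : nm (u z - 0) <= B by rewrite subr0.
by move=> /(_ hB); lra.
Qed.

Lemma mean_ge0 Z (u : Z -> C) : ap u -> (forall z, 0 <= u z) -> 0 <= mean u.
Proof.
move=> apu h.
have key e : 0 < e -> exists2 a, 0 <= a & nm (a - mean u) <= e.
  move=> /(meanP apu)[s s0 hs]; exists (avg s u 0) => //.
  by rewrite mulr_ge0 ?invr_ge0 ?ler0n// sumr_ge0.
rewrite lecE /=; apply/andP; split.
  rewrite -normr_eq0 eq_le normr_ge0 andbT; apply/ler_addgt0Pl => e e0.
  have [a /ger0_Im a0 hae] := key e e0; rewrite addr0.
  apply: le_trans hae; apply: le_trans (ler_Im _).
  by rewrite raddfB /= a0 sub0r normrN.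
apply/ler_addgt0Pl => e e0; have [a] := key e e0.
rewrite lecE => /andP[_ /= a0 hae].
have := le_trans (ler_Re _) hae; rewrite raddfB /= ler_norml => /andP[_].
by lra.
Qed.

(** Faithfulness: finitely many translates of [u], taken from a net, add up to at least
    [nm (u z0) / 2] everywhere, and each of them has the mean of [u]. *)
Lemma mean_gt0 Z (u : Z -> C) z0 : ap u -> (forall z, 0 <= u z) -> u z0 != 0 ->
  0 < mean u.
Proof.
move=> apu u0 uz0; pose e := nm (u z0) / 2.
have e0 : 0 < e by rewrite divr_gt0// nm_gt0.
have [s hs] := ap_net apu e0.
pose v z := \sum_(y <- s) u (z + y).
have apv : ap v by apply: ap_sum => y _; exact: ap_shift.
have ve z : 0 <= v z - e%:C%C.
  have [y ys /(_ z)] := hs (z0 - z); rewrite subrK => h.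
  rewrite subr_ge0 /v (big_rem y)//=; apply: ler_wpDr; first exact: sumr_ge0.
  rewrite addrC -[u (y + z)]ger0_norm// nmE lecR.
  by have := nm_triangle (u (y + z)) (u z0) 0; rewrite !subr0 /e in h *; lra.
have : 0 <= mean v - e%:C%C.
  rewrite -[X in _ - X](mean_cst Z) -meanB//; last exact: ap_cst.
  by apply: mean_ge0 => //; apply: apB => //; exact: ap_cst.
rewrite subr_ge0 mean_sum; last by move=> y _; exact: ap_shift.
under eq_bigr do rewrite mean_shift//.
rewrite sum_seq_cst => le; rewrite lt_neqAle mean_ge0// andbT.
apply/eqP => m0; move: le; rewrite -m0 mulr0 lecR => /le_lt_trans/(_ e0).
by rewrite ltxx.
Qed.

Section Fubini.
Context (Z1 Z2 : zmodType) (k : Z1 * Z2 -> C) (apk : ap k).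

Lemma ap_section1 x : ap (fun y => k (x, y)).
Proof.
move=> e /apk[I [c hc]]; exists I, (fun y => c (0, y)) => y y' /hc h z.
have E w : (x, w + z) = (0, w) + (x, z) by rewrite -[RHS]/(0 + x, w + z) add0r.
by rewrite !E.
Qed.

Lemma ap_mean1 : ap (fun x => mean (fun y => k (x, y))).
Proof.
move=> e /apk[I [c hc]]; exists I, (fun x => c (x, 0)) => x x' /hc h z.
rewrite -meanB; [|exact: ap_section1..].
apply: nm_mean_le; first by apply: apB; exact: ap_section1.
move=> y; have E w : (w + z, y) = (w, 0) + (z, y) by rewrite -[RHS]/(w + z, 0 + y) add0r.
by rewrite !E.
Qed.

(** A sequence that averages [k] on the product projects to one that averages the partial means on
    the first factor. *)
Lemma fubini_mean1 : mean (fun x => mean (fun y => k (x, y))) = mean k.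
Proof.
apply: meanE => e /(meanP apk)[s s0 hs].
exists [seq p.1 | p <- s]; first by rewrite -size_eq0 size_map size_eq0.
move=> x; suff -> : avg [seq p.1 | p <- s] (fun x => mean (fun y => k (x, y))) x =
    mean (fun y => avg s k (x, y)).
  have apm : ap (fun y => avg s k (x, y)).
    apply: apZ; apply: ap_sum => p _.
    exact: (@ap_shift _ _ (fun y => k (x + p.1, y)) p.2 (ap_section1 _)).
  rewrite -[mean k](mean_cst Z2) -meanB//; last exact: ap_cst.
  by apply: nm_mean_le => //; apply: apB => //; exact: ap_cst.
have aps (p : Z1 * Z2) : ap (fun y => k (x + p.1, y + p.2)).
  exact: (@ap_shift _ _ (fun y => k (x + p.1, y)) p.2 (ap_section1 _)).
rewrite /avg size_map big_map meanZ; last by apply: ap_sum => p _; exact: aps.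
congr (_ * _); rewrite (@mean_sum _ _ _ _ (fun p y => k ((x, y) + p))).
  apply: eq_bigr => p _.
  exact/esym/(@mean_shift _ (fun y => k (x + p.1, y)))/ap_section1.
by move=> p _; exact: aps.
Qed.

End Fubini.

(** Exchanging the coordinates is additive and carries averages to averages, so both iterated means
    equal [mean k]. *)
Lemma fubini_mean Z1 Z2 (k : Z1 * Z2 -> C) : ap k ->
  mean (fun x => mean (fun y => k (x, y))) =
  mean (fun y => mean (fun x => k (x, y))).
Proof.
move=> apk; rewrite fubini_mean1//.
pose sw (p : Z2 * Z1) := (p.2, p.1).
have swD p q : sw (p + q) = sw p + sw q by [].
rewrite (@fubini_mean1 Z2 Z1 (k \o sw)); last exact: ap_comp.
apply/esym; apply: meanE => e /(meanP apk)[s s0 hs].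
exists [seq (p.2, p.1) | p <- s]; first by rewrite -size_eq0 size_map size_eq0.
move=> z; suff -> : avg [seq (p.2, p.1) | p <- s] (k \o sw) z = avg s k (sw z).
  by [].
by rewrite /avg size_map big_map.
Qed.

Definition ip Z (u v : Z -> C) : C := mean (fun z => u z * (v z)^*).
Definition sqn Z (u : Z -> C) : R := complex.Re (ip u u).

Lemma ap_ip Z (u v : Z -> C) : ap u -> ap v -> ap (fun z => u z * (v z)^*).
Proof. by move=> apu apv; apply: apM => //; exact: ap_conj. Qed.

Lemma ip_ge0 Z (u : Z -> C) : ap u -> 0 <= ip u u.
Proof.
by move=> apu; apply: mean_ge0 => [|z]; [exact: ap_ip|exact: mul_conjC_ge0].
Qed.

Lemma ipE Z (u : Z -> C) : ap u -> ip u u = (sqn u)%:C%C.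
Proof. by move=> /ip_ge0 /ger0_Im h; rewrite /sqn; case: (ip u u) h => a b /= ->. Qed.

Lemma sqn_ge0 Z (u : Z -> C) : ap u -> 0 <= sqn u.
Proof. by move=> apu; have := ip_ge0 apu; rewrite ipE// ler0c. Qed.

(** Faithfulness of the mean makes [sqn] definite on functions rather than on classes of functions:
    an identity in the mean is a pointwise one. *)
Lemma sqn_eq0 Z (u : Z -> C) : ap u -> sqn u = 0 -> forall z, u z = 0.
Proof.
move=> apu u0 z; apply/eqP; apply: contrapT => /negP uz.
have : 0 < ip u u.
  apply: (mean_gt0 (z0 := z)); [exact: ap_ip|by move=> ?; exact: mul_conjC_ge0|].
  by rewrite mulf_neq0// conjC_eq0.
by rewrite ipE// u0 ltxx.
Qed.

Lemma ip_conj Z (u v : Z -> C) : ap u -> ap v -> ip v u = (ip u v)^*.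
Proof.
move=> apu apv; rewrite /ip -mean_conj; last exact: ap_ip.
by congr mean; apply/funext => z; rewrite cjM cjK mulrC.
Qed.

Lemma ipDl Z (u v w : Z -> C) : ap u -> ap v -> ap w ->
  ip (fun z => u z + v z) w = ip u w + ip v w.
Proof.
move=> apu apv apw; rewrite /ip -meanD; [|exact: ap_ip..].
by congr mean; apply/funext => z; rewrite mulrDl.
Qed.

Lemma ipZl Z c (u w : Z -> C) : ap u -> ap w ->
  ip (fun z => c * u z) w = c * ip u w.
Proof.
move=> apu apw; rewrite /ip -meanZ; last exact: ap_ip.
by congr mean; apply/funext => z; rewrite mulrA.
Qed.

Lemma ipBl Z (u v w : Z -> C) : ap u -> ap v -> ap w ->
  ip (fun z => u z - v z) w = ip u w - ip v w.
Proof.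
move=> apu apv apw; rewrite /ip -meanB; [|exact: ap_ip..].
by congr mean; apply/funext => z; rewrite mulrBl.
Qed.

Lemma ipBr Z (u v w : Z -> C) : ap u -> ap v -> ap w ->
  ip w (fun z => u z - v z) = ip w u - ip w v.
Proof.
move=> apu apv apw; rewrite ip_conj//; last exact: apB.
by rewrite ipBl// cjB -!ip_conj.
Qed.

Lemma ipZr Z c (u w : Z -> C) : ap u -> ap w ->
  ip w (fun z => c * u z) = c^* * ip w u.
Proof.
move=> apu apw; rewrite ip_conj//; last exact: apZ.
by rewrite ipZl// cjM -!ip_conj.
Qed.

Lemma ip_suml Z (I : Type) (r : seq I) (u : I -> Z -> C) (w : Z -> C) :
  (forall i, ap (u i)) -> ap w ->
  ip (fun z => \sum_(i <- r) u i z) w = \sum_(i <- r) ip (u i) w.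
Proof.
move=> apu apw; rewrite /ip -mean_sum; last by move=> i _; exact: ap_ip.
by congr mean; apply/funext => z; rewrite mulr_suml.
Qed.

Lemma sqn_le Z (u : Z -> C) B : ap u -> (forall z, nm (u z) <= B) ->
  sqn u <= B ^+ 2.
Proof.
move=> apu h; apply: le_trans (ler_norm _) _; apply: le_trans (ler_Re _) _.
apply: nm_mean_le => [|z]; first exact: ap_ip.
by rewrite nmM nm_conj expr2; apply: ler_pM; rewrite ?nm_ge0.
Qed.

Lemma sqnZ Z c (u : Z -> C) : ap u -> sqn (fun z => c * u z) = nm c ^+ 2 * sqn u.
Proof.
move=> apu; have apcu := apZ c apu; apply: (@complexI R).
rewrite -ipE// ipZl// ipZr// mulrA nm_sqr ipE//.
by rewrite [RHS]rcM.
Qed.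

Lemma sqnB Z (u v : Z -> C) : ap u -> ap v ->
  sqn (fun z => u z - v z) = sqn u - 2 * complex.Re (ip u v) + sqn v.
Proof.
move=> apu apv; rewrite /sqn ipBl//; last exact: apB.
rewrite !ipBr// (ip_conj apu apv); case: (ip u v) => a b /=.
by case: (ip u u) => ? ?; case: (ip v v) => ? ? /=; ring.
Qed.

Lemma cauchy_schwarz Z (u v : Z -> C) : ap u -> ap v ->
  nm (ip u v) ^+ 2 <= sqn u * sqn v.
Proof.
move=> apu apv; have [v0|v0] := eqVneq (sqn v) 0.
  rewrite v0 mulr0; suff -> : ip u v = 0 by rewrite nm0 expr0n.
  rewrite /ip -[RHS](mean_cst Z); congr mean; apply/funext => z.
  by rewrite (sqn_eq0 apv v0) rmorph0 mulr0.
have vp : 0 < sqn v by rewrite lt_neqAle eq_sym v0 sqn_ge0.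
pose c := ip u v / (sqn v)%:C%C.
have apc : ap (fun z => c * v z) by exact: apZ.
have := sqn_ge0 (apB apu apc); rewrite sqnB// sqnZ// ipZr//.
have -> : complex.Re (c^* * ip u v) = nm (ip u v) ^+ 2 / sqn v.
  rewrite /c cjM mulrAC [_^* * _]mulrC nm_sqr cjV cj_real.
  by rewrite -rcV -rcM.
rewrite /c nmM nmV nm_real gtr0_norm//.
have -> : (nm (ip u v) / sqn v) ^+ 2 * sqn v = nm (ip u v) ^+ 2 / sqn v by field.
set q := _ / _ => h; rewrite -ler_pdivrMr//; rewrite -/q; lra.
Qed.

(** Almost periodicity is asked at every index, also outside [r], so that sums over [r] are handled
    without membership conditions. *)
Definition orthonormal_on Z (I : eqType) (r : seq I) (g : I -> Z -> C) : Prop :=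
  (forall i, ap (g i)) /\
  {in r &, forall i j, ip (g i) (g j) = (i == j)%:R}.

Section Bessel.
Context (Z : zmodType) (I : eqType) (r : seq I) (ur : uniq r) (g : I -> Z -> C).
Context (og : orthonormal_on r g) (u : Z -> C) (apu : ap u).

Definition residual z := u z - \sum_(i <- r) ip u (g i) * g i z.

Lemma ap_proj : ap (fun z => \sum_(i <- r) ip u (g i) * g i z).
Proof. by apply: ap_sum => i _; apply: apZ; exact: og.1. Qed.

Lemma ap_residual : ap residual.
Proof. exact: (apB apu ap_proj). Qed.

Lemma ip_residual j : j \in r -> ip residual (g j) = 0.
Proof.
move=> jr; have [apg gE] := og.
rewrite ipBl//; last exact: ap_proj.
rewrite (@ip_suml _ _ r (fun i z => ip u (g i) * g i z))//; last first.
  by move=> i; exact: apZ.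
rewrite (bigD1_seq j)//= ipZl// gE// eqxx mulr1 big_seq_cond big1 ?addr0 ?subrr//.
by move=> i /andP[ir /negbTE ij]; rewrite ipZl// gE// ij mulr0.
Qed.

Lemma sqn_residual :
  sqn residual = sqn u - \sum_(i <- r) nm (ip u (g i)) ^+ 2.
Proof.
have [apg gE] := og; have apr := ap_residual.
have E : ip residual residual = ip residual u.
  rewrite {2}/residual ipBr//; last exact: ap_proj.
  rewrite [X in _ - X](_ : _ = 0) ?subr0// ip_conj//; last exact: ap_proj.
  rewrite (@ip_suml _ _ r (fun i z => ip u (g i) * g i z))//; last first.
    by move=> i; exact: apZ.
  rewrite big_seq big1 ?rmorph0// => i ir.
  by rewrite ipZl// (ip_conj apr)// ip_residual// rmorph0 mulr0.
apply: (@complexI R); rewrite -ipE// E ipBl//; last exact: ap_proj.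
rewrite (@ip_suml _ _ r (fun i z => ip u (g i) * g i z))//; last first.
  by move=> i; exact: apZ.
rewrite rcB rc_sum -ipE//; congr (_ - _).
by apply: eq_bigr => i _; rewrite ipZl// (ip_conj apu)// nm_sqr.
Qed.

Lemma bessel : \sum_(i <- r) nm (ip u (g i)) ^+ 2 <= sqn u.
Proof. by rewrite -subr_ge0 -sqn_residual sqn_ge0//; exact: ap_residual. Qed.

End Bessel.

End MeanTheory.

(** * Completeness of characters and the Parseval identity *)

Section UltraLimit.
Context (R : realType) (U : set_system nat) (ultraU : UltraFilter U).
Local Notation C := R[i].

(** The limit along [U] is the supremum of the numbers that are below the terms on a set of [U]. *)
Lemma real_ultralimit (a : nat -> R) B : (forall n, `|a n| <= B) ->
  exists l, forall e, 0 < e -> U [set n | `|a n - l| <= e].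
Proof.
move=> aB; pose S := [set x | U [set n | x <= a n]].
have lo n : - B <= a n by have := aB n; rewrite ler_norml => /andP[].
have hi n : a n <= B by have := aB n; rewrite ler_norml => /andP[].
have SB : S (- B) by apply: filterS filterT => n _ /=; exact: lo.
have ubS : ubound S B.
  by move=> x /filter_ex[n /= xn]; exact: le_trans xn (hi n).
have supS : has_sup S by split; [exists (- B)|exists B].
exists (sup S) => e e0.
have [x Sx hx] := sup_adherent e0 supS.
have : U (~` [set n | sup S + e <= a n]).
  have [|//] := in_ultra_setVsetC [set n | sup S + e <= a n] ultraU.
  by move=> /(ub_le_sup supS.2); rewrite -subr_le0 addrAC subrr add0r leNgt e0.
move=> h; apply: filterS2 h Sx => n /= /negP; rewrite -ltNge => h1 h2.
by rewrite ler_norml; apply/andP; split; lra.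
Qed.

Lemma ultralimit (a : nat -> C) B : (forall n, nm (a n) <= B) ->
  exists l, forall e, 0 < e -> U [set n | nm (a n - l) <= e].
Proof.
move=> aB.
have [n|x hx] := @real_ultralimit (fun n => complex.Re (a n)) B.
  exact: le_trans (ler_Re _) (aB n).
have [n|y hy] := @real_ultralimit (fun n => complex.Im (a n)) B.
  exact: le_trans (ler_Im _) (aB n).
exists (x +i* y)%C => e e0; have e2 : 0 < e / 2 by rewrite divr_gt0.
apply: filterS2 (hx _ e2) (hy _ e2) => n /= h1 h2.
by apply: le_trans (nm_ReIm _) _; rewrite !raddfB /=; lra.
Qed.

End UltraLimit.

Section Operator.
Context (R : realType) (Z : zmodType).
Local Notation C := R[i].
Implicit Types (u f g : Z -> C) (c : C).

Lemma nat_ultrafilter : exists U : set_system nat,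
  UltraFilter U /\ forall N, U [set n | (N <= n)%N].
Proof.
have [U [uU hU]] := @ultraFilterLemma nat \oo _.
by exists U; split => // N; apply: hU; exists N.
Qed.

(** Arzela-Ascoli: the pointwise limit along an ultrafilter is uniform on suitable indices because
    one colouring serves all [g n], and sets of the ultrafilter meet every tail. *)
Lemma ap_cluster (g : nat -> Z -> C) B : (forall n z, nm (g n z) <= B) ->
  (forall e, 0 < e -> exists (I : finType) (k : Z -> I), forall x y, k x = k y ->
    forall n, nm (g n x - g n y) <= e) ->
  exists h : Z -> C, forall e, 0 < e -> forall N, exists2 n, (N <= n)%N &
    forall z, nm (g n z - h z) <= e.
Proof.
move=> gB equi; have [U [uU hU]] := nat_ultrafilter.
have /choice[h hh] : forall z, exists l, forall e, 0 < e ->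
    U [set n | nm (g n z - l) <= e].
  by move=> z; exact: (@ultralimit _ U uU (fun n => g n z) B).
exists h => e e0 N; have e3 : 0 < e / 5 by rewrite divr_gt0.
have [I [k hk]] := equi _ e3; have [r hr] := color_repr k.
have hUI : U [set n | forall i, nm (g n (r i) - h (r i)) <= e / 5].
  by apply: filter_forall => i; exact: hh.
have [n [Nn hn]] := filter_ex (filterI (hU N) hUI).
exists n => // z; pose y := r (k z).
(* [m] depends on [z] but [n] does not. The path from [g n z] to [h z] passes through [g n y],
   [h y], [g m y] and [g m z]: five gaps of size [e / 5]. *)
have [m [h1 h2]] := filter_ex (filterI (hh z _ e3) (hh y _ e3)).
have kzy : k z = k y by rewrite /y hr.
have := nm_triangle (g n y) (g n z) (h z).
have := nm_triangle (h y) (g n y) (h z).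
have := nm_triangle (g m y) (h y) (h z).
have := nm_triangle (g m z) (g m y) (h z).
have := hk z y kzy n; have := hk z y kzy m; have : nm (g n y - h y) <= e / 5 by exact: hn.
rewrite (nmBC (h y) (g m y)) (nmBC (g m y) (g m z)) => /=; move: h1 h2 => /=; lra.
Qed.

(** A character of the discrete group, with no continuity. *)
Definition ischar (xi : Z -> C) : Prop :=
  (forall x y, xi (x + y) = xi x * xi y) /\ forall x, nm (xi x) = 1.

(** Values are coloured by the cells of a grid of mesh [e / 2] in the real and in the imaginary
    direction. *)
Lemma bounded_color (f : Z -> C) B e : (forall z, nm (f z) <= B) -> 0 < e ->
  exists (I : finType) (k : Z -> I), forall x y, k x = k y ->
    nm (f x - f y) <= e.
Proof.
move=> fB e0; pose q (x : R) := Num.trunc ((x + B) * (2 / e)).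
pose N := (Num.trunc (2 * B * (2 / e))).+1.
have e2 : 0 < 2 / e by rewrite divr_gt0.
have qN x : x <= B -> (q x < N)%N.
  move=> xB; rewrite ltnS; apply: le_truncn; apply: (ler_wpM2r (ltW e2)); lra.
have qE x y : - B <= x -> - B <= y -> q x = q y -> `|x - y| <= e / 2.
  move=> xB yB E; have xp : 0 <= (x + B) * (2 / e) by apply: mulr_ge0 (ltW e2); lra.
  have yp : 0 <= (y + B) * (2 / e) by apply: mulr_ge0 (ltW e2); lra.
  have := truncn_itv xp; have := truncn_itv yp.
  rewrite -/(q x) -/(q y) E -natr1 => /andP[h1 h2] /andP[h3 h4].
  have : `|(x - y) * (2 / e)| <= 1.
    by rewrite ler_norml; apply/andP; split; lra.
  rewrite normrM (gtr0_norm e2) -ler_pdivlMr// invf_div mul1r; exact.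
have le_B x : nm (f x) <= B -> [/\ complex.Re (f x) <= B, - B <= complex.Re (f x),
    complex.Im (f x) <= B & - B <= complex.Im (f x)].
  move=> h; have := le_trans (ler_Re _) h; have := le_trans (ler_Im _) h.
  by rewrite !ler_norml => /andP[? ?] /andP[? ?]; split.
exists ('I_N * 'I_N)%type.
exists (fun x => (inord (q (complex.Re (f x))), inord (q (complex.Im (f x))))).
move=> x y [/(congr1 val) /= E1 /(congr1 val) /= E2].
have [a1 a2 a3 a4] := le_B x (fB x); have [b1 b2 b3 b4] := le_B y (fB y).
rewrite !inordK ?qN// in E1 E2.
apply: le_trans (nm_ReIm _) _; rewrite !raddfB /=.
by have := qE _ _ a2 b2 E1; have := qE _ _ a4 b4 E2; lra.
Qed.

(** Translates of a character are unimodular multiples of it, so a colouring of its values is a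
    colouring of its translates. *)
Lemma ap_char xi : ischar xi -> ap xi.
Proof.
move=> [xiD xi1] e e0.
have [I [k hk]] := @bounded_color xi 1 e ltac:(by move=> z; rewrite xi1) e0.
exists I, k => x y /hk h z.
by rewrite !xiD -mulrBl nmM xi1 mulr1.
Qed.

Lemma char0E xi : ischar xi -> xi 0 = 1.
Proof.
move=> [xiD xi1]; have := xiD 0 0; rewrite addr0 -{1}[xi 0]mulr1.
move=> /mulfI -> //; by rewrite -nm_eq0 xi1 oner_neq0.
Qed.

Lemma charNE xi z : ischar xi -> xi (- z) = (xi z)^*.
Proof.
move=> hxi; have [xiD xi1] := hxi.
have xi0 : xi z != 0 by rewrite -nm_eq0 xi1 oner_neq0.
apply: (mulfI xi0); rewrite -xiD subrr char0E// nm_sqr xi1 expr1n.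
by [].
Qed.

Lemma ip_char xi eta : ischar xi -> ischar eta -> ip xi eta = (xi == eta)%:R.
Proof.
move=> hx he; have [xD x1] := hx; have [eD e1] := he.
have [<-|ne] := eqVneq xi eta.
  rewrite /ip -[RHS](mean_cst Z); congr mean; apply/funext => z.
  by rewrite nm_sqr x1 expr1n.
have [z hz] : exists z, xi z != eta z.
  apply: contrapT => h; move/eqP: ne; apply; apply/funext => z.
  by apply/eqP; apply: contrapT => /negP hz; apply: h; exists z.
have apxe : ap (fun z => xi z * (eta z)^*) by apply: ap_ip; exact: ap_char.
have := mean_shift z apxe.
have -> : (fun w => xi (w + z) * (eta (w + z))^*) =
    (fun w => (xi z * (eta z)^*) * (xi w * (eta w)^*)).
  by apply/funext => w; rewrite xD eD cjM; ring.
rewrite meanZ// -/(ip xi eta) => /eqP; rewrite -subr_eq0 -[X in _ - X]mul1r.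
rewrite -mulrBl mulf_eq0 => /orP[|/eqP->//]; rewrite subr_eq0 => /eqP E.
have : xi z * ((eta z)^* * eta z) = eta z by rewrite mulrA E mul1r.
by rewrite [_^* * _]mulrC nm_sqr e1 expr1n mulr1 => E2; rewrite E2 eqxx in hz.
Qed.

(** Off [X] the family is the constant 1, only to be almost periodic at every index. *)
Lemma orthonormal_chars (X : seq (Z -> C)) : (forall xi, xi \in X -> ischar xi) ->
  exists g : (Z -> C) -> (Z -> C), orthonormal_on X g /\ {in X, g =1 id}.
Proof.
move=> hX; exists (fun xi => if xi \in X then xi else fun=> 1); split; last first.
  by move=> xi /= ->.
split => [xi|xi eta xX eX]; last by rewrite xX eX ip_char//; exact: hX.
by case: ifPn => [/hX /ap_char//|_]; exact: ap_cst.
Qed.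

Section Kernel.
Context (v : Z -> C) (apv : ap v).

Definition mconv f z := mean (fun w => v (z - w) * f w).

Lemma ap_kernel z : ap (fun w => v (z - w)).
Proof.
have -> : (fun w => v (z - w)) = (fun w => (fun w => v (- w)) (w + - z)).
  by apply/funext => w; rewrite opprB.
exact: (ap_shift (- z) (apNV apv)).
Qed.

Lemma ap_kernel_mul f z : ap f -> ap (fun w => v (z - w) * f w).
Proof. by move=> apf; apply: apM => //; exact: ap_kernel. Qed.

Lemma sqn_conj f : ap f -> sqn (fun z => (f z)^*) = sqn f.
Proof.
move=> apf; congr complex.Re; congr mean; apply/funext => z.
by rewrite cjK mulrC.
Qed.

(** By Cauchy-Schwarz the modulus of continuity of [mconv v f] depends on [f] only through [sqn f];
    this equicontinuity on the unit ball is the compactness of the operator. *)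
Lemma mconv_lip f E x y : ap f -> (forall z, nm (v (x + z) - v (y + z)) <= E) ->
  nm (mconv f x - mconv f y) ^+ 2 <= E ^+ 2 * sqn f.
Proof.
move=> apf hE; have apfc := ap_conj apf.
have apd : ap (fun w => v (x - w) - v (y - w)) by apply: apB; exact: ap_kernel.
have -> : mconv f x - mconv f y = ip (fun w => v (x - w) - v (y - w)) (fun w => (f w)^*).
  rewrite -meanB; [|exact: ap_kernel_mul..].
  by congr mean; apply/funext => w; rewrite cjK mulrBl.
apply: le_trans (cauchy_schwarz apd apfc) _; rewrite sqn_conj//.
by apply: ler_wpM2r; [exact: sqn_ge0|apply: sqn_le].
Qed.

Lemma sqn_kernel z : sqn (fun w => v (z - w)) = sqn v.
Proof.
congr complex.Re; rewrite /ip; exact: (@mean_reflect R Z (fun w => v w * (v w)^*) z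
  (ap_ip apv apv)).
Qed.

Lemma mconv_bound f z : ap f -> nm (mconv f z) ^+ 2 <= sqn v * sqn f.
Proof.
move=> apf; have -> : mconv f z = ip (fun w => v (z - w)) (fun w => (f w)^*).
  by congr mean; apply/funext => w; rewrite cjK.
apply: le_trans (cauchy_schwarz (ap_kernel z) (ap_conj apf)) _.
by rewrite sqn_conj// sqn_kernel.
Qed.

Lemma ap_mconv f : ap f -> ap (mconv f).
Proof.
move=> apf e e0; pose s := Num.sqrt (sqn f) + 1.
have s0 : 0 < s by rewrite ltr_wpDl ?sqrtr_ge0.
have [I [k hk]] := apv (divr_gt0 e0 s0); exists I, k => x y /hk h z.
have h' w : nm (v (x + z + w) - v (y + z + w)) <= e / s by rewrite -!addrA.
rewrite -ler_sqr ?nnegrE ?nm_ge0 ?(ltW e0)//.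
apply: le_trans (mconv_lip apf h') _; rewrite exprMn -mulrA ler_piMr ?sqr_ge0//.
rewrite exprVn ler_pdivrMl ?exprn_gt0// mulr1 -[leLHS]sqr_sqrtr ?sqn_ge0//.
by rewrite ler_sqr ?nnegrE ?sqrtr_ge0 ?(ltW s0)// lerDl.
Qed.

Lemma sqn_mconv_le f : ap f -> sqn (mconv f) <= sqn v * sqn f.
Proof.
move=> apf; have V0 : 0 <= sqn v * sqn f by rewrite mulr_ge0 ?sqn_ge0.
rewrite -[leRHS]sqr_sqrtr//; apply: sqn_le; first exact: ap_mconv.
by move=> z; rewrite -ler_sqr ?nnegrE ?nm_ge0 ?sqrtr_ge0// sqr_sqrtr// mconv_bound.
Qed.

Lemma mconvB f g : ap f -> ap g -> mconv (fun z => f z - g z) = (fun z => mconv f z - mconv g z).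
Proof.
move=> apf apg; apply/funext => z; rewrite -meanB; [|exact: ap_kernel_mul..].
by congr mean; apply/funext => w; rewrite mulrBr.
Qed.

Lemma mconvZ c f : ap f -> mconv (fun z => c * f z) = (fun z => c * mconv f z).
Proof.
move=> apf; apply/funext => z; rewrite -meanZ; last exact: ap_kernel_mul.
by congr mean; apply/funext => w; rewrite mulrCA.
Qed.

Lemma mconv_shift f x : ap f -> mconv (fun z => f (z + x)) = (fun z => mconv f (z + x)).
Proof.
move=> apf; apply/funext => z; rewrite /mconv -[RHS](mean_shift x); last exact: ap_kernel_mul.
by congr mean; apply/funext => w; rewrite opprD addrACA subrr addr0.
Qed.

Lemma mconv_char xi z : ischar xi -> mconv xi z = ip v xi * xi z.
Proof.
move=> hxi; have apxi := ap_char hxi; have [xiD xi1] := hxi.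
rewrite /mconv -(mean_reflect z); last exact: ap_kernel_mul.
rewrite mulrC -meanZ; last exact: ap_ip.
congr mean; apply/funext => w.
by rewrite opprB addrCA subrr addr0 xiD charNE// mulrCA mulrA.
Qed.

Context (hermv : forall z, v (- z) = (v z)^*).

Lemma mconv_self f g : ap f -> ap g -> ip (mconv f) g = ip f (mconv g).
Proof.
move=> apf apg; pose k (p : Z * Z) := v (p.1 - p.2) * f p.2 * (g p.1)^*.
have apk : ap k.
  apply: apM; last by apply: ap_conj; exact: (ap_comp (h := fst)).
  apply: apM; last exact: (ap_comp (h := snd)).
  by apply: (ap_comp (h := fun p : Z * Z => p.1 - p.2)) => // p q /=;
    rewrite opprD addrACA.
transitivity (mean (fun x => mean (fun y => k (x, y)))).
  congr mean; apply/funext => x; rewrite mulrC -meanZ; last exact: ap_kernel_mul.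
  by congr mean; apply/funext => y; rewrite mulrC.
rewrite fubini_mean//; congr mean; apply/funext => y.
rewrite -mean_conj; last exact: ap_kernel_mul.
rewrite -meanZ; last by apply: ap_conj; exact: ap_kernel_mul.
congr mean; apply/funext => x.
by rewrite /k /= cjM -hermv opprB; ring.
Qed.

End Kernel.
End Operator.

(** Some finite subfamily has a span of maximal dimension, which contains all the other matrices; a
    common eigenvector of the subfamily is one for its combinations. *)
Lemma common_eigenvector_family (F : numClosedFieldType) (T : eqType) (m : nat)
    (A : T -> 'M[F]_m) : (0 < m)%N -> (forall x y, A x *m A y = A y *m A x) ->
  exists2 a : 'rV[F]_m, a != 0 & forall x, exists mu, a *m A x = mu *: a.
Proof.
move=> m0 commA.
pose P (d : nat) := `[< exists s : seq T, \dim <<[seq A x | x <- s]>>%VS = d >].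
have exP : exists d, P d.
  by exists (\dim <<[seq A x | x <- ([::] : seq T)]>>%VS); apply/asboolP; exists [::].
have ubP d : P d -> (d <= \dim {: 'M[F]_m})%N.
  by move=> /asboolP[s <-]; apply: dimvS; exact: subvf.
case: (ex_maxnP exP ubP) => d /asboolP[s sd] dmax.
have spanA y : A y \in <<[seq A x | x <- s]>>%VS.
  have sub : (<<[seq A x | x <- s]>> <= <<[seq A x | x <- y :: s]>>)%VS.
    by rewrite /= span_cons addvSr.
  have : (<<[seq A x | x <- s]>> == <<[seq A x | x <- y :: s]>>)%VS.
    by rewrite eqEdim sub sd dmax//; apply/asboolP; exists (y :: s).
  by move=> /eqP ->; apply: memv_span; rewrite mem_head.
have [|a a0 /allP ha] := @common_eigenvector F m [seq A x | x <- s] m0.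
  by move=> B B' h1 h2; case/mapP: h1 => x _ ->; case/mapP: h2 => y _ ->; exact: commA.
exists a => // y; have := coord_span (X := in_tuple [seq A x | x <- s]) (spanA y).
set c := coord _ => E.
have /choice[mu hmu] : forall i : 'I_(size [seq A x | x <- s]), exists mu,
    a *m [seq A x | x <- s]`_i = mu *: a.
  by move=> i; apply/sub_rVP; apply: ha; exact: mem_nth.
exists (\sum_i c i (A y) * mu i); rewrite [in LHS]E mulmx_sumr scaler_suml.
by apply: eq_bigr => i _; rewrite -scalemxAr hmu scalerA.
Qed.

(** * Eigenspaces of convolution operators *)

Section Spectral.
Context (R : realType) (Z : zmodType).
Local Notation C := R[i].
Implicit Types (u v f g : Z -> C) (c : C).

(** The orthogonal complement of the characters. Completeness, [null_coef_eq0], says that it is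
    zero. *)
Definition null_coef f := ap f /\ forall xi, ischar xi -> ip f xi = 0.

Lemma null_coefB f g : null_coef f -> null_coef g ->
  null_coef (fun z => f z - g z).
Proof.
move=> [apf f0] [apg g0]; split=> [|xi hxi]; first exact: apB.
by rewrite ipBl//; [rewrite f0// g0// subrr|exact: ap_char].
Qed.

Lemma null_coefZ c f : null_coef f -> null_coef (fun z => c * f z).
Proof.
move=> [apf f0]; split=> [|xi hxi]; first exact: apZ.
by rewrite ipZl//; [rewrite f0// mulr0|exact: ap_char].
Qed.

Lemma null_coef_shift x f : null_coef f -> null_coef (fun z => f (z + x)).
Proof.
move=> [apf f0]; split=> [|xi hxi]; first exact: ap_shift.
have [xiD xi1] := hxi; have apxi := ap_char hxi.
rewrite /ip -(mean_shift (- x)); last by apply: ap_ip => //; exact: ap_shift.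
transitivity (mean (fun z => xi x * (f z * (xi z)^*))).
  by congr mean; apply/funext => z; rewrite subrK xiD charNE// cjM cjK; ring.
by rewrite meanZ ?[mean _]f0 ?mulr0//; exact: ap_ip.
Qed.

Lemma null_coef_lim f :
  (forall e, 0 < e -> exists2 g, null_coef g & forall z, nm (f z - g z) <= e) ->
  null_coef f.
Proof.
move=> h; have apf : ap f by apply: ap_lim => e /h[g [apg _]]; exists g.
split=> // xi hxi; have apxi := ap_char hxi; apply: nm_le0_eq => e e0.
have [g [apg g0] fg] := h e e0.
rewrite -(g0 _ hxi) -ipBl//; apply: nm_mean_le.
  by apply: ap_ip => //; exact: apB.
by move=> z; rewrite nmM nm_conj hxi.2 mulr1.
Qed.

Lemma normalize f : ap f -> sqn f != 0 ->
  exists2 c : C, c != 0 & ip (fun z => c * f z) (fun z => c * f z) = 1.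
Proof.
move=> apf f0; have fp : 0 < sqn f by rewrite lt_neqAle eq_sym f0 sqn_ge0.
exists ((Num.sqrt (sqn f))^-1)%:C%C.
  by rewrite -nm_eq0 nm_real normr_eq0 invr_eq0 sqrtr_eq0 -ltNge.
rewrite ipE; last exact: apZ.
by rewrite sqnZ// nm_real real_normK ?num_real// exprVn sqr_sqrtr ?ltW// mulVf.
Qed.

Section Hermitian.
Context (v : Z -> C) (apv : ap v) (hermv : forall z, v (- z) = (v z)^*).
Local Notation K := (mconv v).
Let V := sqn v.

Lemma null_coef_mconv f : null_coef f -> null_coef (K f).
Proof.
move=> [apf f0]; split=> [|xi hxi]; first exact: ap_mconv.
have apxi := ap_char hxi; rewrite mconv_self//.
have -> : K xi = (fun z => ip v xi * xi z) by apply/funext => z; exact: mconv_char.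
by rewrite ipZr// f0// mulr0.
Qed.

Section Eigen.
Context (lam : R) (lam0 : 0 < lam).

(** [K \o K] is used rather than [K] because it is positive: its top eigenvalue is found by
    maximizing [sqn (K f)], with no sign to discuss. *)
Definition eigen g := null_coef g /\ forall z, K (K g) z = lam%:C%C * g z.

Lemma eigenB f g : eigen f -> eigen g -> eigen (fun z => f z - g z).
Proof.
move=> [nf fE] [ng gE]; split=> [|z]; first exact: null_coefB.
have [apf apg] := (nf.1, ng.1); have [apKf apKg] := (ap_mconv apv apf, ap_mconv apv apg).
by rewrite !mconvB// fE gE mulrBr.
Qed.

Lemma eigenZ c f : eigen f -> eigen (fun z => c * f z).
Proof.
move=> [nf fE]; split=> [|z]; first exact: null_coefZ.
have apf := nf.1; have apKf := ap_mconv apv apf; by rewrite !mconvZ// fE mulrCA.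
Qed.

Lemma eigen_shift x f : eigen f -> eigen (fun z => f (z + x)).
Proof.
move=> [nf fE]; split=> [|z]; first exact: null_coef_shift.
have apf := nf.1; have apKf := ap_mconv apv apf; by rewrite !mconv_shift// fE.
Qed.

Lemma eigen0 : eigen (fun=> 0).
Proof.
have n0 : null_coef (fun=> 0 : C).
  split=> [|xi hxi]; first exact: ap_cst.
  rewrite /ip -[RHS](mean_cst Z); congr mean.
  by apply/funext => z; rewrite mul0r.
have K0 : K (fun=> 0) = (fun=> 0).
  apply/funext => z; rewrite /mconv -[RHS](mean_cst Z); congr mean.
  by apply/funext => w; rewrite mulr0.
by split => // z; rewrite !K0 mulr0.
Qed.

Lemma eigen_sum (I : Type) (r : seq I) (F : I -> Z -> C) :
  (forall i, eigen (F i)) -> eigen (fun z => \sum_(i <- r) F i z).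
Proof.
move=> h; elim: r => [|i r ih].
  by under eq_fun do rewrite big_nil; exact: eigen0.
have := eigenB (h i) (eigenZ (-1) ih); congr eigen; apply/funext => z.
by rewrite big_cons mulN1r opprK.
Qed.

(* Summing Bessel's inequality for the functions [v (z - _)] over [z] bounds the
   dimension of the eigenspace by the squared Hilbert-Schmidt norm. *)
Lemma eigen_dim (I : eqType) (r : seq I) (g : I -> Z -> C) : uniq r ->
  orthonormal_on r g -> (forall i, eigen (g i)) -> (size r)%:R * lam <= V.
Proof.
move=> ur og eg; have apg := og.1.
have apKg i : ap (K (g i)) by exact: ap_mconv.
have sqnK i : i \in r -> sqn (K (g i)) = lam.
  move=> ir; apply: (@complexI R); rewrite -ipE// -mconv_self//.
  have -> : K (K (g i)) = (fun z => lam%:C%C * g i z) by apply/funext => z; rewrite (eg i).2.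
  by rewrite ipZl// og.2// eqxx mulr1.
(* The claim becomes positivity of the mean over [z] of [V - \sum_i nm (K (g i) z) ^+ 2], which is
   checked point by point. *)
rewrite -sum_seq_cst big_seq -(eq_bigr _ sqnK) -big_seq -subr_ge0 -ler0c rcB rc_sum.
under eq_bigr do rewrite -ipE//.
rewrite -[V%:C%C](mean_cst Z) /ip -mean_sum; last by move=> i _; exact: ap_ip.
have aps : ap (fun z => \sum_(i <- r) K (g i) z * (K (g i) z)^*).
  by apply: ap_sum => i _; exact: ap_ip.
rewrite -meanB//; last exact: ap_cst.
apply: mean_ge0 => [|z]; first by apply: apB => //; exact: ap_cst.
under eq_bigr do rewrite nm_sqr.
rewrite -rc_sum -rcB ler0c subr_ge0 /V -(sqn_kernel apv z) -(sqn_conj (ap_kernel apv z)).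
have apk := ap_conj (ap_kernel apv z).
apply: le_trans (bessel ur og apk); rewrite le_eqVlt; apply/orP; left; apply/eqP.
apply: eq_bigr => i _; congr (_ ^+ 2); rewrite -[RHS]nm_conj /ip -mean_conj.
  by congr (nm (mean _)); apply/funext => w; rewrite cjM !cjK.
exact: ap_ip.
Qed.

(* Translations commute on the finite-dimensional eigenspace; a common
   eigenvector is a multiple of a character, which null coefficients exclude. *)
Lemma eigen_eq0 f : eigen f -> forall z, f z = 0.
Proof.
move=> ef; have apf := ef.1.1; apply: (sqn_eq0 apf); apply/eqP.
apply: contrapT => /negP f0.
(* The dimension of the eigenspace, as the largest size of an orthonormal family; [eigen_dim] bounds
   it. *)
pose P (m : nat) := `[< exists g : 'I_m -> Z -> C,
  orthonormal_on (index_enum 'I_m) g /\ forall i, eigen (g i) >].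
have P1 : P 1%N.
  have [c c0 cf1] := normalize apf f0.
  apply/asboolP; exists (fun=> fun z => c * f z); split; last by move=> _; exact: eigenZ.
  by split=> [_|i j _ _]; [exact: apZ|rewrite !ord1 eqxx].
have ubP m : P m -> (m <= Num.trunc (V / lam))%N.
  move=> /asboolP[g [og eg]].
  have := eigen_dim (index_enum_uniq 'I_m) og eg.
  rewrite -ler_pdivlMr// => h; rewrite truncn_ge_nat; last first.
    by rewrite divr_ge0 ?(ltW lam0)// sqn_ge0.
  apply: le_trans h; rewrite ler_nat; apply: eq_leq.
  by rewrite /index_enum -enumT size_enum_ord.
have exP : exists m, P m by exists 1%N.
case: (ex_maxnP exP ubP) => m /asboolP[g [og eg]] mmax.
have apg := og.1; have gE i j : ip (g i) (g j) = (i == j)%:R.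
  by apply: og.2; exact: mem_index_enum.
have m0 : (0 < m)%N by exact: mmax.
(* By maximality: a nonzero residual, once normalized, would extend the family. *)
have expand h : eigen h -> forall z, h z = \sum_i ip h (g i) * g i z.
  move=> eh z; have aph := eh.1.1.
  pose rr := residual (index_enum 'I_m) g h.
  have err : eigen rr.
    by apply: eigenB => //; apply: eigen_sum => i; exact: eigenZ.
  have aprr : ap rr by exact: err.1.1.
  have [r0|r0] := eqVneq (sqn rr) 0.
    by apply/eqP; rewrite -subr_eq0; apply/eqP; exact: (sqn_eq0 aprr r0 z).
  have [c c0 cr1] := normalize aprr r0.
  suff : P m.+1 by move=> /mmax; rewrite ltnn.
  apply/asboolP.
  exists (fun i => if unlift ord0 i is Some j then g j else fun z => c * rr z).
  have cr j : ip (fun z => c * rr z) (g j) = 0.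
    have ui := index_enum_uniq 'I_m; have ji := mem_index_enum j.
    by rewrite ipZl// ip_residual ?mulr0.
  have apcr : ap (fun z => c * rr z) by exact: apZ.
  split; last by move=> i; case: unliftP => [j _|_]; [exact: eg|exact: eigenZ].
  split=> [i|i j _ _]; first by case: unliftP.
  case: unliftP => [i' ->|->]; case: unliftP => [j' ->|->].
  - by rewrite gE (inj_eq lift_inj).
  - by rewrite ip_conj// cr rmorph0.
  - by rewrite cr.
  - by rewrite cr1 eqxx.
(* The matrices of the translations in the orthonormal basis; they commute because [Z] does. *)
pose A x : 'M[C]_m := \matrix_(i, j) ip (fun z => g i (z + x)) (g j).
have AE x i z : g i (z + x) = \sum_j A x i j * g j z.
  rewrite (expand (fun z => g i (z + x))); last exact: eigen_shift.
  by apply: eq_bigr => j _; rewrite mxE.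
have AD x y : A (x + y) = A x *m A y.
  apply/matrixP => i k; rewrite !mxE.
  have -> : (fun z => g i (z + (x + y))) = (fun z => \sum_j A x i j * g j (z + y)).
    by apply/funext => z; rewrite [x + y]addrC addrA AE.
  rewrite ip_suml//; last by move=> j; apply: apZ; exact: ap_shift.
  by apply: eq_bigr => j _; rewrite ipZl ?mxE//; exact: ap_shift.
have [|a a0 ha] := @common_eigenvector_family _ Z m A m0.
  by move=> x y; rewrite -!AD addrC.
have {ha}/choice[mu hmu] := ha.
pose h z := \sum_i a 0 i * g i z.
have eh : eigen h by apply: eigen_sum => i; exact: eigenZ.
have aph := eh.1.1.
have hsh x z : h (z + x) = mu x * h z.
  rewrite /h; under eq_bigr do rewrite AE mulr_sumr.
  rewrite exchange_big mulr_sumr; apply: eq_bigr => j _ /=.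
  have := congr1 (fun M : 'rV_m => M 0 j) (hmu x); rewrite !mxE mulrA => <-.
  by rewrite mulr_suml; apply: eq_bigr => i _; rewrite mulrA.
(* As [h z = mu z * h 0], a zero at 0 would make [h] vanish identically, and then [a], whose entries
   are the coefficients of [h]. *)
have h0 : h 0 != 0.
  apply/eqP => h0; move/eqP: a0; apply; apply/rowP => j; rewrite mxE.
  have hz z : h z = 0 by rewrite -[z]add0r hsh h0 mulr0.
  transitivity (ip h (g j)).
    rewrite ip_suml//; last by move=> i; exact: apZ.
    rewrite (bigD1 j)//= ipZl// gE eqxx mulr1 big1 ?addr0// => i ij.
    by rewrite ipZl// gE (negbTE ij) mulr0.
  rewrite /ip -[RHS](mean_cst Z); congr mean; apply/funext => z.
  by rewrite hz mul0r.
pose xi z := h z / h 0.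
have xiE x z : h (z + x) = xi x * h z.
  by rewrite hsh; congr (_ * _); rewrite /xi -[x in RHS]add0r hsh mulfK.
have hxi : ischar xi.
  split=> [x y|x]; first by rewrite {1}/xi addrC xiE -mulrA.
  (* Translation preserves [sqn h], which forces [nm (xi x) = 1]. *)
  have sh : sqn h != 0.
    by apply/eqP => /(sqn_eq0 aph)/(_ 0) E; rewrite E eqxx in h0.
  have : sqn (fun z => h (z + x)) = sqn h.
    by congr complex.Re; exact: (mean_shift x (ap_ip aph aph)).
  have -> : (fun z => h (z + x)) = (fun z => xi x * h z).
    by apply/funext => z; exact: xiE.
  rewrite sqnZ// => /eqP; rewrite -subr_eq0 -[X in _ - X]mul1r -mulrBl.
  rewrite mulf_eq0 (negbTE sh) orbF subr_eq0 => /eqP E.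
  by apply/eqP; rewrite -(@eqrXn2 _ 2%N) ?nm_ge0// E expr1n.
have := eh.1.2 xi hxi.
have -> : h = (fun z => h 0 * xi z).
  by apply/funext => z; rewrite /xi mulrCA mulfV// mulr1.
have apxi := ap_char hxi; rewrite ipZl// ip_char// eqxx mulr1 => E.
by rewrite E eqxx in h0.
Qed.

End Eigen.

End Hermitian.
End Spectral.

(** * Completeness of the characters *)

Section Completeness.
Context (R : realType) (Z : zmodType).
Local Notation C := R[i].
Implicit Types (u v f g : Z -> C) (c : C).

Lemma ler_of_sqr (x y : R) : 0 <= x -> 0 <= y -> x ^+ 2 <= y ^+ 2 -> x <= y.
Proof. by move=> x0 y0; rewrite ler_sqr. Qed.

Lemma sum_seq_capC (T : eqType) (M : nmodType) (Y Y' : seq T) (F : T -> M) :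
  uniq Y -> uniq Y' ->
  \sum_(i <- Y | i \in Y') F i = \sum_(i <- Y' | i \in Y) F i.
Proof.
move=> uY uY'; rewrite -(big_filter Y (fun i => i \in Y')).
rewrite -(big_filter Y' (fun i => i \in Y)); apply: perm_big.
apply: uniq_perm; rewrite ?filter_uniq// => i.
by rewrite !mem_filter andbC.
Qed.

Lemma harmonic_small (e : R) : 0 < e -> exists N, forall n, (N <= n)%N ->
  n.+1%:R^-1 <= e.
Proof.
move=> e0; exists (Num.trunc e^-1) => n Nn.
rewrite -[e]invrK lef_pV2 ?posrE ?ltr0n ?invr_gt0//.
by apply: le_trans (ltW (truncnS_gt _)) _; rewrite ler_nat.
Qed.

Section Hermitian.
Context (v : Z -> C) (apv : ap v) (hermv : forall z, v (- z) = (v z)^*).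
Local Notation K := (mconv v).
Let V := sqn v.
Let V0 : 0 <= V. Proof. exact: sqn_ge0. Qed.

Lemma mconv2_bound f z : ap f -> nm (K (K f) z) ^+ 2 <= V ^+ 2 * sqn f.
Proof.
move=> apf; have apKf := ap_mconv apv apf.
apply: le_trans (mconv_bound apv z apKf) _; rewrite expr2 -mulrA.
by apply: ler_wpM2l => //; exact: sqn_mconv_le.
Qed.

Lemma sqn_mconv_ip f : ap f -> sqn (K f) = complex.Re (ip (K (K f)) f).
Proof. by move=> apf; rewrite mconv_self//; exact: ap_mconv. Qed.

(* Otherwise [K \o K] has a nonzero eigenfunction with null coefficients: a
   cluster point of [K (K (h n))] for a sequence [h] maximizing [sqn (K g)] on
   the unit ball. *)
Lemma null_coef_mconv_eq0 f : null_coef f -> sqn (K f) = 0.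
Proof.
move=> nf; apply/eqP; apply: contrapT => /negP Kf0.
(* The supremum of [S] is the squared norm of [K] restricted to functions with null coefficients. *)
pose S := [set s | exists2 g, null_coef g /\ sqn g <= 1 & s = sqn (K g)].
have scale g : null_coef g -> sqn (K g) != 0 ->
    0 < sqn g /\ S (sqn (K g) / sqn g).
  move=> ng Kg0; have apg := ng.1.
  have g0 : 0 < sqn g.
    rewrite lt_neqAle sqn_ge0// andbT eq_sym; apply/eqP => g0.
    have := sqn_mconv_le apv apg; rewrite g0 mulr0 => le0.
    move/eqP: Kg0; apply; apply/eqP; rewrite eq_le le0 sqn_ge0//; exact: ap_mconv.
  split=> //; pose c := ((Num.sqrt (sqn g))^-1)%:C%C.
  have c2 : nm c ^+ 2 = (sqn g)^-1.
    by rewrite nm_real real_normK ?num_real// exprVn sqr_sqrtr// ltW.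
  exists (fun z => c * g z).
    by split; [exact: null_coefZ|rewrite sqnZ// c2 mulVf// lt0r_neq0].
  by rewrite mconvZ// sqnZ ?c2 1?mulrC//; exact: ap_mconv.
have apf := nf.1; have [f0 Sf] := scale f nf Kf0.
have ubS : ubound S V.
  move=> _ [g [ng g1] ->]; apply: le_trans (sqn_mconv_le apv ng.1) _.
  by rewrite ler_piMr.
have supS : has_sup S by split; [exists (sqn (K f) / sqn f)|exists V].
pose L := sup S.
have L0 : 0 < L.
  apply: lt_le_trans (ub_le_sup supS.2 Sf); rewrite divr_gt0//.
  by rewrite lt_neqAle eq_sym Kf0 sqn_ge0//; exact: ap_mconv.
have KL g : null_coef g -> sqn (K g) <= L * sqn g.
  move=> ng; have [->|Kg0] := eqVneq (sqn (K g)) 0.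
    by rewrite mulr_ge0 ?(ltW L0) ?sqn_ge0//; exact: ng.1.
  have [g0 Sg] := scale g ng Kg0.
  by rewrite -ler_pdivrMr//; apply: (ub_le_sup supS.2 Sg).
have /choice[h hh] : forall n, exists g, [/\ null_coef g, sqn g <= 1 &
    L - n.+1%:R^-1 < sqn (K g)].
  move=> n; have n0 : (0 : R) < n.+1%:R^-1 by rewrite invr_gt0.
  have [_ [g [ng g1] ->] gL] := sup_adherent n0 supS.
  by exists g.
have nh n : null_coef (h n) by have [] := hh n.
have aph n : ap (h n) by exact: (nh n).1.
have h1 n : sqn (h n) <= 1 by have [] := hh n.
have hL n : L - n.+1%:R^-1 < sqn (K (h n)) by have [] := hh n.
have apKh n : ap (K (h n)) by exact: ap_mconv.
have apKKh n : ap (K (K (h n))) by exact: ap_mconv.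
have sqnKh n : sqn (K (h n)) <= V.
  by apply: le_trans (sqn_mconv_le apv (aph n)) _; rewrite ler_piMr.
have cvg_eig n z : nm (K (K (K (K (h n)))) z - L%:C%C * K (K (h n)) z) ^+ 2 <=
    V ^+ 2 * (L / n.+1%:R).
  (* Expanding the square and using [sqn (K g) <= L * sqn g], [sqn d] is at most
     [L ^ 2 - L * sqn (K (h n))], which is small since [h n] is nearly maximal. *)
  pose d z := K (K (h n)) z - L%:C%C * h n z.
  have apLh : ap (fun z => L%:C%C * h n z) by exact: apZ.
  have apd : ap d by exact: apB.
  have dE : sqn d <= L / n.+1%:R.
    rewrite sqnB// sqnZ// ipZr// cj_real nm_real real_normK ?num_real//.
    have -> : complex.Re (L%:C%C * ip (K (K (h n))) (h n)) = L * sqn (K (h n)).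
      by rewrite sqn_mconv_ip//; case: (ip _ _) => a b /=; rewrite mul0r subr0.
    have q1 := KL _ (null_coef_mconv apv hermv (nh n)).
    have q2 : L ^+ 2 * sqn (h n) <= L ^+ 2 by rewrite ler_piMr// sqr_ge0.
    have q3 : L * (L - n.+1%:R^-1) <= L * sqn (K (h n)).
      by rewrite ler_wpM2l ?(ltW L0)// ltW.
    move: (n.+1%:R^-1) q3 => a; rewrite mulrBr -expr2 => q3.
    by clear -q1 q2 q3; lra.
  have -> : K (K (K (K (h n)))) z - L%:C%C * K (K (h n)) z = K (K d) z.
    rewrite /d mconvB// mconvB//; [|exact: ap_mconv..].
    by rewrite mconvZ// mconvZ.
  apply: le_trans (mconv2_bound z apd) _.
  by rewrite ler_wpM2l ?sqr_ge0.
have gbound n z : nm (K (K (h n)) z) <= V.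
  apply: ler_of_sqr; rewrite ?nm_ge0//.
  apply: le_trans (mconv2_bound z (aph n)) _.
  by rewrite ler_piMr ?sqr_ge0.
(* All [K (K (h n))] inherit the modulus of continuity of [v], up to the common bound on
   [sqn (K (h n))]. *)
have [e e0|g hg] := @ap_cluster R Z (fun n => K (K (h n))) V gbound.
  have V1 : 0 < Num.sqrt V + 1 by rewrite ltr_wpDl ?sqrtr_ge0.
  have [I [k hk]] := apv (divr_gt0 e0 V1); exists I, k => x y /hk hxy n.
  apply: ler_of_sqr; rewrite ?nm_ge0 ?(ltW e0)//.
  apply: le_trans (mconv_lip apv (apKh n) hxy) _.
  rewrite exprMn -mulrA ler_piMr ?sqr_ge0// exprVn ler_pdivrMl ?exprn_gt0// mulr1.
  apply: le_trans (sqnKh n) _; rewrite -[leLHS](sqr_sqrtr V0).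
  by rewrite ler_sqr ?nnegrE ?sqrtr_ge0 ?(ltW V1)// lerDl.
have ng : null_coef g.
  apply: null_coef_lim => e /hg/(_ 0%N)[n _ hn]; exists (K (K (h n))).
    by do 2!apply: null_coef_mconv => //.
  by move=> z; rewrite nmBC.
have apg := ng.1.
have eg : eigen v L g.
  split=> // z; apply: nm_le0_eq => e e0.
  pose M := V + L + 1; have M0 : 0 < M by rewrite /M; have := V0; lra.
  have e3 : 0 < e / (2 * M) by rewrite divr_gt0// mulr_gt0.
  have e4 : 0 < (e / 2) ^+ 2 / (V ^+ 2 * L + 1).
    by rewrite divr_gt0 ?exprn_gt0 ?divr_gt0// ltr_wpDl// mulr_ge0 ?sqr_ge0 ?ltW.
  have [N hN] := harmonic_small e4.
  have [n Nn hn] := hg _ e3 N.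
  pose gn := K (K (h n)); have apgn : ap gn by exact: apKKh.
  have b1 : nm (K (K g) z - K (K gn) z) <= V * (e / (2 * M)).
    have Ve : 0 <= V * (e / (2 * M)) by rewrite mulr_ge0// ltW.
    apply: ler_of_sqr => //; first exact: nm_ge0.
    have apd : ap (fun z => g z - gn z) by exact: apB.
    have -> : K (K g) z - K (K gn) z = K (K (fun z => g z - gn z)) z.
      by rewrite mconvB// mconvB//; exact: ap_mconv.
    apply: le_trans (mconv2_bound z apd) _; rewrite exprMn ler_wpM2l ?sqr_ge0//.
    by apply: sqn_le => // w; rewrite nmBC.
  have b2 : nm (K (K gn) z - L%:C%C * gn z) <= e / 2.
    apply: ler_of_sqr; rewrite ?nm_ge0 ?divr_ge0 ?(ltW e0)//.
    apply: le_trans (cvg_eig n z) _; rewrite mulrA.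
    have := hN n Nn; have VL : 0 <= V ^+ 2 * L by rewrite mulr_ge0 ?sqr_ge0 ?ltW.
    rewrite ler_pdivlMr; last by rewrite ltr_wpDl.
    rewrite mulrC mulrDl mul1r; have : 0 <= n.+1%:R^-1 :> R by rewrite invr_ge0.
    by move=> h2 h3; apply: le_trans h3; rewrite lerDl.
  have b3 : nm (L%:C%C * gn z - L%:C%C * g z) <= L * (e / (2 * M)).
    rewrite -mulrBr nmM nm_real (gtr0_norm L0) ler_wpM2l ?(ltW L0)//; exact: hn.
  have b4 : (V + L) * (e / (2 * M)) <= e / 2.
    rewrite (_ : e / 2 = M * (e / (2 * M))); last by field; rewrite lt0r_neq0.
    by rewrite ler_wpM2r ?(ltW e3)// /M lerDl.
  have := nm_triangle (K (K gn) z) (K (K g) z) (L%:C%C * g z).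
  have := nm_triangle (L%:C%C * gn z) (K (K gn) z) (L%:C%C * g z).
  by rewrite mulrDl in b4; clear -b1 b2 b3 b4; lra.
(* Since [g = 0], the functions [K (K (h n))] become arbitrarily small, whereas their norm dominates
   [sqn (K (h n))], which stays above [3 * L / 4]. *)
have g0 := eigen_eq0 apv hermv L0 eg.
have L4 : 0 < L / 4 by rewrite divr_gt0.
have [N hN] := harmonic_small L4; have [n Nn hn] := hg _ L4 N.
have : sqn (K (K (h n))) <= (L / 4) ^+ 2.
  by apply: sqn_le => // z; have := hn z; rewrite g0 subr0.
have : sqn (K (h n)) <= Num.sqrt (sqn (K (K (h n)))).
  apply: ler_of_sqr; rewrite ?sqrtr_ge0 ?sqn_ge0//.
  rewrite sqr_sqrtr ?sqn_ge0//.
  have cs := cauchy_schwarz (apKKh n) (aph n).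
  apply: le_trans (_ : nm (ip (K (K (h n))) (h n)) ^+ 2 <= _).
    rewrite sqn_mconv_ip// -[leLHS]real_normK ?num_real//.
    by rewrite ler_sqr ?nnegrE ?nm_ge0//; exact: ler_Re.
  by apply: le_trans cs _; rewrite ler_piMr ?sqn_ge0.
move=> q1 q2; have q3 : Num.sqrt (sqn (K (K (h n)))) <= L / 4.
  rewrite -[leRHS]ger0_norm ?(ltW L4)// -sqrtr_sqr ler_sqrt//.
  by rewrite sqr_ge0.
move: (hN n Nn) (hL n); move: (n.+1%:R^-1) => a.
by clear -q1 q3 L4; lra.
Qed.

End Hermitian.

(** [ip f f] is the value at 0 of the convolution of [f] by its reflected conjugate [v]. To reach
    Hermitian kernels, [v] is written with [v + v~] and [i (v - v~)], where [v~] is the reflected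
    conjugate of [v]. *)
Lemma null_coef_eq0 f : null_coef f -> forall z, f z = 0.
Proof.
move=> nf; have apf := nf.1.
have Kherm v z : ap v -> (forall z, v (- z) = (v z)^*) -> mconv v f z = 0.
  move=> apv hv; apply: sqn_eq0; first exact: ap_mconv.
  exact: null_coef_mconv_eq0.
pose v z := (f (- z))^*.
have apv : ap v by apply: ap_conj; exact: apNV.
have apvN : ap (fun z => (v (- z))^*) by apply: ap_conj; exact: apNV.
have apv1 : ap (fun z => v z + (v (- z))^*) by exact: apD.
have apv2 : ap (fun z => 'i%C * (v z - (v (- z))^*)) by apply: apZ; exact: apB.
have h1 z : v (- z) + (v (- - z))^* = (v z + (v (- z))^*)^*.
  by rewrite opprK rmorphD [X in _ = _ + X]cjK addrC.
have k1 := Kherm _ 0 apv1 h1.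
have conji : ('i%C : C)^* = - 'i%C.
  by apply/eqP; rewrite eq_complex /= oppr0 !eqxx.
have h2 z : 'i%C * (v (- z) - (v (- - z))^*) = ('i%C * (v z - (v (- z))^*))^*.
  by rewrite opprK cjM cjB cjK conji mulNr -mulrN opprB.
have k2 := Kherm _ 0 apv2 h2.
apply: (sqn_eq0 apf); apply: (@complexI R); rewrite -ipE//.
have -> : ip f f = mconv v f 0.
  by congr mean; apply/funext => w; rewrite /v sub0r opprK mulrC.
have ap1 := ap_kernel_mul apv1 0 apf; have ap2 := ap_kernel_mul apv2 0 apf.
have -> : mconv v f 0 = 2^-1 * (mconv (fun z => v z + (v (- z))^*) f 0
    - 'i%C * mconv (fun z => 'i%C * (v z - (v (- z))^*)) f 0).
  rewrite -meanZ// -meanB//; last exact: apZ.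
  rewrite -meanZ; last by apply: apB => //; exact: apZ.
  congr mean; apply/funext => w.
  have i2 : 'i%C * 'i%C = -1 :> C by rewrite -expr2 sqr_i.
  by rewrite !mulrA i2; field.
by rewrite k1 k2 mulr0 subr0 mulr0.
Qed.

Definition char_sum u (X : seq (Z -> C)) : R := \sum_(xi <- X) nm (ip u xi) ^+ 2.

Definition char_seq (X : seq (Z -> C)) : Prop :=
  uniq X /\ forall xi, xi \in X -> ischar xi.

Lemma bessel_char u X : ap u -> char_seq X -> char_sum u X <= sqn u.
Proof.
move=> apu [uX hX]; have [g [og gE]] := orthonormal_chars hX.
apply: le_trans (bessel uX og apu); rewrite /char_sum.
rewrite big_seq [leRHS]big_seq; apply: ler_sum => xi xX; rewrite gE//.
Qed.

(* The almost periodic function [z |-> <u (. + z), u>] minus its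
   Fourier series has zero coefficients, hence vanishes, in particular at 0. *)
Lemma parseval u e : ap u -> 0 < e ->
  exists2 X, char_seq X & sqn u <= char_sum u X + e.
Proof.
move=> apu e0.
pose S := [set s | exists2 X, char_seq X & s = char_sum u X].
have S0 : S !=set0 by exists (char_sum u [::]), [::].
have ubS : ubound S (sqn u) by move=> _ [X hX ->]; exact: bessel_char.
have supS : has_sup S by split=> //; exists (sqn u).
pose s := sup S.
suff us : sqn u <= s.
  have [_ [X hX ->] hs] := sup_adherent e0 supS.
  by exists X => //; rewrite /s in us; lra.
have /choice[X hX] : forall n : nat, exists X, char_seq X /\
    s - n.+1%:R^-1 < char_sum u X.
  move=> n; have n0 : (0 : R) < n.+1%:R^-1 by rewrite invr_gt0.
  by have [_ [X cX ->] Xs] := sup_adherent n0 supS; exists X.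
have cX n : char_seq (X n) by exact: (hX n).1.
have Xs Y : char_seq Y -> char_sum u Y <= s.
  by move=> cY; apply: ub_le_sup; [exact: supS.2|exists Y].
pose w z := ip (fun y => u (y + z)) u.
(* Partial Fourier series of [w]. *)
pose t n z : C := \sum_(xi <- X n) (nm (ip u xi) ^+ 2)%:C%C * xi z.
have apw : ap w.
  pose k (p : Z * Z) := u (p.2 + p.1) * (u p.2)^*.
  apply: (@ap_mean1 _ Z Z k); apply: apM.
    by apply: (ap_comp (h := fun p : Z * Z => p.2 + p.1)) => // p q /=; rewrite addrACA.
  by apply: ap_conj; exact: (ap_comp (h := snd)).
have apt n : ap (t n).
  rewrite /t; have -> : (fun z => \sum_(xi <- X n) (nm (ip u xi) ^+ 2)%:C%C * xi z) =
    (fun z => \sum_(xi <- X n | xi \in X n) (nm (ip u xi) ^+ 2)%:C%C * xi z).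
    by apply/funext => z; rewrite big_seq.
  by apply: ap_sum => xi xX; apply: apZ; apply: ap_char; exact: (cX n).2.
(* Appending to [Y'] the characters of [Y] outside it cannot push the sum above [s], and characters
   are unimodular. *)
have part (Y Y' : seq (Z -> C)) z : char_seq Y -> char_seq Y' ->
    nm (\sum_(xi <- Y | xi \notin Y') (nm (ip u xi) ^+ 2)%:C%C * xi z) <=
    s - char_sum u Y'.
  move=> [uY hY] [uY' hY']; apply: le_trans (nm_sum _ _ _) _.
  apply: le_trans (_ : \sum_(xi <- Y | xi \notin Y') nm (ip u xi) ^+ 2 <= _).
    rewrite big_seq_cond [leRHS]big_seq_cond; apply: ler_sum => xi /andP[xY _].
    by rewrite nmM nm_real (hY _ xY).2 mulr1 ger0_norm ?sqr_ge0.
  rewrite lerBrDl -big_filter /= -/(char_sum u [seq xi <- Y | xi \notin Y']).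
  rewrite /char_sum -big_cat; apply: Xs; split.
    rewrite cat_uniq uY' filter_uniq// andbT; apply/hasPn => xi.
    by rewrite mem_filter => /andP[].
  move=> xi; rewrite mem_cat mem_filter => /orP[/hY'//|/andP[_ /hY]//].
(* The common characters cancel, which leaves two tails. *)
have cauchy n m z : nm (t n z - t m z) <= n.+1%:R^-1 + m.+1%:R^-1.
  rewrite /t (bigID (fun xi => xi \in X m)) /= [X in _ - X](bigID (fun xi => xi \in X n)) /=.
  rewrite (@sum_seq_capC _ _ (X n) (X m)) ?(cX _).1// opprD addrACA subrr add0r.
  apply: le_trans (nmB _ _) _; rewrite addrC; apply: lerD.
    apply: le_trans (part _ _ z (cX m) (cX n)) _.
    by apply: ltW; rewrite ltrBlDl -ltrBlDr; exact: (hX n).2.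
  apply: le_trans (part _ _ z (cX n) (cX m)) _.
  by apply: ltW; rewrite ltrBlDl -ltrBlDr; exact: (hX m).2.
have tb n z : nm (t n z) <= nm (t 0%N z) + 2.
  have := nm_triangle (t 0%N z) (t n z) 0; rewrite !subr0.
  have := cauchy n 0%N z; rewrite invr1.
  have : n.+1%:R^-1 <= 1 :> R by rewrite invf_le1// ler1n.
  by move: (n.+1%:R^-1) => a; clear -R; lra.
have [U [uU hU]] := nat_ultrafilter.
have /choice[T hT] : forall z, exists l, forall e, 0 < e ->
    U [set n | nm (t n z - l) <= e].
  by move=> z; exact: (@ultralimit _ U uU (fun n => t n z) _ (tb ^~ z)).
have tT n z : nm (t n z - T z) <= n.+1%:R^-1.
  apply/ler_addgt0Pr => d d0; have d2 : 0 < d / 2 by rewrite divr_gt0.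
  have [N hN] := harmonic_small d2.
  have [m [/= Nm hm]] := filter_ex (filterI (hU N) (hT z _ d2)).
  have := nm_triangle (t m z) (t n z) (T z).
  have := cauchy n m z; have := hN m Nm; move: hm => /=.
  by move: (n.+1%:R^-1) (m.+1%:R^-1) => a a'; clear -R; lra.
have apT : ap T.
  apply: ap_lim => d /harmonic_small[N hN]; exists (t N) => // z.
  by rewrite nmBC; apply: le_trans (tT N z) (hN N _).
(* By Fubini and translation, the coefficients of [w] are the squared moduli of those of [u]. *)
have ip_w xi : ischar xi -> ip w xi = (nm (ip u xi) ^+ 2)%:C%C.
  move=> hxi; have apxi := ap_char hxi; have [xiD xi1] := hxi.
  pose k (p : Z * Z) := u (p.2 + p.1) * (u p.2)^* * (xi p.1)^*.
  have apk : ap k.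
    apply: apM; last by apply: ap_conj; exact: (ap_comp (h := fst)).
    apply: apM.
      by apply: (ap_comp (h := fun p : Z * Z => p.2 + p.1)) => // p q /=; rewrite addrACA.
    by apply: ap_conj; exact: (ap_comp (h := snd)).
  transitivity (mean (fun x => mean (fun y => k (x, y)))).
    congr mean; apply/funext => x; rewrite mulrC -meanZ; last first.
      by apply: ap_ip => //; exact: ap_shift.
    by congr mean; apply/funext => y; rewrite mulrC.
  rewrite fubini_mean// -nm_sqr -ip_conj// -meanZ; last exact: ap_ip.
  congr mean; apply/funext => y.
  have apuy : ap (fun x => u (x + y) * (xi x)^*) by apply: ap_ip => //; exact: ap_shift.
  transitivity ((u y)^* * mean (fun x => u (x + y) * (xi x)^*)).
    rewrite -meanZ//; congr mean; apply/funext => x.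
    by rewrite /k /= [y + x]addrC; ring.
  rewrite -(mean_shift (- y))//.
  transitivity ((u y)^* * mean (fun x => xi y * (u x * (xi x)^*))).
    congr (_ * mean _); apply/funext => x.
    by rewrite subrK xiD charNE// cjM cjK; ring.
  by rewrite meanZ; [rewrite -/(ip u xi); ring|exact: ap_ip].
have ip_t n xi : ischar xi ->
    ip (t n) xi = if xi \in X n then (nm (ip u xi) ^+ 2)%:C%C else 0.
  move=> hxi; have apxi := ap_char hxi; have [uX hXn] := cX n.
  have -> : ip (t n) xi = \sum_(eta <- X n) (nm (ip u eta) ^+ 2)%:C%C * (eta == xi)%:R.
    have [g [og gE]] := orthonormal_chars hXn.
    have -> : t n = (fun z => \sum_(eta <- X n) (nm (ip u eta) ^+ 2)%:C%C * g eta z).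
      apply/funext => z; rewrite /t big_seq [RHS]big_seq; apply: eq_bigr => eta eX.
      by rewrite gE.
    rewrite ip_suml//; last by move=> eta; apply: apZ; exact: og.1.
    rewrite big_seq [RHS]big_seq; apply: eq_bigr => eta eX.
    rewrite ipZl//; last exact: og.1.
    by rewrite [g eta](gE _ eX) (ip_char (hXn _ eX) hxi).
  case: ifPn => xX.
    rewrite (bigD1_seq xi)//= eqxx mulr1 big1 ?addr0// => eta /negbTE ->.
    by rewrite mulr0.
  rewrite big_seq big1// => eta eX.
  have -> : (eta == xi) = false by apply/negbTE; apply: contraNneq xX => <-.
  by rewrite mulr0.
have apwt n : ap (fun z => w z - t n z) by exact: apB.
have nB : null_coef (fun z => w z - T z).
  split=> [|xi hxi]; first exact: apB.
  have apxi := ap_char hxi; apply: nm_le0_eq => d d0; rewrite subr0.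
  have d2 : 0 < d / 2 by rewrite divr_gt0.
  have [n /(_ n (leqnn _)) hn] := harmonic_small d2.
  have -> : ip (fun z => w z - T z) xi =
      ip (fun z => w z - t n z) xi + ip (fun z => t n z - T z) xi.
    rewrite -ipDl//; last exact: apB.
    by congr (ip _ _); apply/funext => z; rewrite addrA subrK.
  have b1 : nm (ip (fun z => t n z - T z) xi) <= n.+1%:R^-1.
    apply: nm_mean_le => [|z]; first by apply: ap_ip => //; exact: apB.
    by rewrite nmM nm_conj hxi.2 mulr1; exact: tT.
  (* A character outside [X n] could be added to it, so its squared coefficient is at most the gap
     [s - char_sum u (X n)]. *)
  have b2 : nm (ip (fun z => w z - t n z) xi) <= n.+1%:R^-1.
    rewrite ipBl// ip_w// ip_t//; case: ifPn => xX.
      by rewrite subrr nm0 invr_ge0.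
    rewrite subr0 nm_real ger0_norm ?sqr_ge0//.
    have : char_sum u (xi :: X n) <= s.
      apply: Xs; split; first by rewrite /= xX (cX n).1.
      by move=> eta; rewrite inE => /orP[/eqP->//|/(cX n).2].
    rewrite /char_sum big_cons -/(char_sum u (X n)) => h.
    have := (hX n).2; rewrite ltrBlDr => /ltW h'; rewrite -(lerD2r (char_sum u (X n))).
    by apply: le_trans h _; rewrite addrC.
  have := nmD (ip (fun z => w z - t n z) xi) (ip (fun z => t n z - T z) xi).
  by move: hn b1 b2; move: (n.+1%:R^-1) => a; clear -R; lra.
have := null_coef_eq0 nB 0; have -> : w 0 = (sqn u)%:C%C.
  rewrite -ipE//; congr (ip _ _); apply/funext => z.
  by rewrite addr0.
move=> /eqP; rewrite subr_eq0 => /eqP T0.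
apply/ler_addgt0Pr => d /harmonic_small[n /(_ n (leqnn _)) hn].
have t0 : t n 0 = (char_sum u (X n))%:C%C.
  rewrite /t /char_sum rc_sum big_seq [RHS]big_seq; apply: eq_bigr => xi xX.
  by rewrite char0E ?mulr1//; exact: (cX n).2.
have := tT n 0; rewrite t0 -T0 -rcB nm_real ler_norml => /andP[+ _].
by have := Xs _ (cX n); move: hn; move: (n.+1%:R^-1) => a; clear -R; lra.
Qed.

End Completeness.

(** * Integration against Haar measures *)

(** Finite subcovers are hidden here once and for all: a hereditary property stable under binary
    unions holds on a compact set as soon as it holds locally. *)
Lemma compact_ind (X : topologicalType) (P : set X -> Prop) (K : set X) :
  P set0 -> (forall A B, P A -> P B -> P (A `|` B)) ->
  (forall A B, A `<=` B -> P B -> P A) ->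
  compact K -> (forall x, K x -> exists2 U, nbhs x U & P U) -> P K.
Proof.
move=> P0 PU PS /compact_near_coveringP cK hK.
pose F : set_system (set X) := filter_from P (fun B => [set C | B `<=` C]).
have FF : Filter F.
  apply: filter_from_filter; first by exists set0.
  move=> A B PA PB; exists (A `|` B); first exact: PU.
  by move=> C ABC; split=> x hx; apply: ABC; [left|right].
have [|B PB hB] := @cK (set X) F (fun C x => C x) FF.
  move=> x /hK[U Ux PU']; exists (U, [set C | U `<=` C]) => /=.
    by split => //; exists U.
  by move=> [y C] /= [Uy UC]; exact: UC.
by apply: PS PB; exact: (hB B).
Qed.

Section CompactSupport.
Context (R : realType).
Local Notation C := R[i].

(** A compact set containing the support is kept instead of the closure of the support, so that
    operations on functions compute no closure. *)
Definition cc (X : topologicalType) (f : X -> R) : Prop :=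
  continuous f /\ exists2 K, compact K & forall x, f x != 0 -> K x.

Section Algebra.
Context (X : topologicalType).
Implicit Types f g : X -> R.

Lemma ccD f g : cc f -> cc g -> cc (fun x => f x + g x).
Proof.
move=> [cf [K cK hK]] [cg [K' cK' hK']]; split.
  by move=> x; apply: cvgD; [exact: cf|exact: cg].
exists (K `|` K'); first exact: compactU.
move=> x; have [fx|/hK ? _] := eqVneq (f x) 0; last by left.
by rewrite fx add0r => /hK'; right.
Qed.

Lemma cc_mul f g : continuous f -> cc g -> cc (fun x => f x * g x).
Proof.
move=> cf [cg [K cK hK]]; split.
  by move=> x; apply: cvgM; [exact: cf|exact: cg].
by exists K => // x; rewrite mulf_eq0 negb_or => /andP[_ /hK].
Qed.

Lemma ccZ c f : cc f -> cc (fun x => c * f x).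
Proof. by apply: cc_mul => x; exact: cvg_cst. Qed.

Lemma cc_abs f : cc f -> cc (fun x => `|f x|).
Proof.
move=> [cf [K cK hK]]; split; first by move=> x; apply: cvg_norm; exact: cf.
by exists K => // x; rewrite normr_eq0 => /hK.
Qed.

Lemma cc_bounded f : cc f -> exists2 B, 0 < B & forall x, `|f x| <= B.
Proof.
move=> [cf [K cK hK]].
have [B hB] : exists B, forall x, K x -> `|f x| <= B.
  apply: (@compact_ind X (fun A => exists B, forall x, A x -> `|f x| <= B) K) => //.
  - by exists 0.
  - move=> A A' [B hB] [B' hB']; exists (Num.max B B') => x [/hB|/hB'] h;
      by rewrite le_max h ?orbT.
  - by move=> A A' AA' [B hB]; exists B => x /AA'; exact: hB.
  - move=> x _; exists [set y | `|f x - f y| < 1].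
      by have /cvgrPdist_lt/(_ 1 ltr01) := cf x.
    exists (`|f x| + 1) => y /= h; have := ler_normB (f x) (f x - f y).
    by rewrite subKr; lra.
exists (`|B| + 1) => [|x]; first by rewrite ltr_wpDl.
have [->|/hK/hB] := eqVneq (f x) 0; first by rewrite normr0 addr_ge0.
by have := ler_norm B; lra.
Qed.

End Algebra.

Lemma cc_comp (X Y : topologicalType) (h : X -> Y) (k : Y -> X) (f : Y -> R) :
  continuous h -> continuous k -> cancel h k -> cc f -> cc (f \o h).
Proof.
move=> ch ck hK [cf [K cK supp]]; split.
  by move=> x; apply: continuous_comp; [exact: ch|exact: cf].
exists (k @` K); first by apply: continuous_compact => //; exact: continuous_subspaceT.
by move=> x /= /supp Kx; exists (h x) => //; rewrite hK.
Qed.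

Lemma compact_precompact_nbhs (X : topologicalType) (K : set X) :
  locally_compact [set: X] -> compact K ->
  exists2 W, open W & K `<=` W /\ exists2 K', compact K' & W `<=` K'.
Proof.
move=> lcX cK.
have [K' cK' KK'] : exists2 K', compact K' & K `<=` interior K'.
  apply: (@compact_ind X (fun A => exists2 K', compact K' & A `<=` interior K') K) => //.
  - by exists set0 => //; exact: compact0.
  - move=> A B [A' cA' AA'] [B' cB' BB']; exists (A' `|` B'); first exact: compactU.
    move=> x [/AA'|/BB'] h; apply: interiorS h => y; [by left|by right].
  - by move=> A B AB [K' cK' BK']; exists K' => // x /AB /BK'.
  - move=> x _; have [|U /= hU [cU clU]] := lcX x; first by [].
    exists (interior U); last by exists U.
    apply: nbhs_interior; suff : nbhs x [set y | [set: X] y -> U y].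
      by apply: (@filterS _ (nbhs x)) => y /=; exact.
    exact: hU.
exists (interior K'); first exact: open_interior.
by split => //; exists K' => //; exact: interior_subset.
Qed.

(** The one-point compactification is compact Hausdorff, hence normal, and Urysohn's lemma applies
    there. Intersecting [U] with a relatively compact [W] bounds the support. *)
Lemma urysohn_cc (X : topologicalType) (K U : set X) :
  hausdorff_space X -> locally_compact [set: X] -> compact K -> open U ->
  K `<=` U -> exists f : X -> R, [/\ cc f, forall x, 0 <= f x <= 1,
    forall x, K x -> f x = 1 & forall x, f x != 0 -> U x].
Proof.
move=> hX lX cK oU KU.
have [W oW [KW [K' cK' WK']]] := compact_precompact_nbhs lX cK.
pose T := one_point_compactification X.
have hT : hausdorff_space T := one_point_compactification_hausdorff lX hX.
have cT : compact [set: T] := one_point_compactification_compact.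
have cS : continuous (Some : X -> T) := one_point_compactification_some_continuous.
pose A : set T := Some @` K; pose B : set T := ~` (Some @` (W `&` U)).
have clA : closed A.
  by apply: compact_closed => //; apply: continuous_compact => //;
    exact: continuous_subspaceT.
have clB : closed B.
  by apply: open_closedC; apply: one_point_compactification_open_some; exact: openI.
have AB0 : B `&` A = set0.
  rewrite -subset0 => t [nB [x Kx xt]]; apply: nB; rewrite -xt.
  by exists x => //; split; [exact: KW|exact: KU].
have [f [cf f01 fB fA]] : exists f : T -> R, [/\ continuous f,
    range f `<=` `[0, 1], f @` B `<=` [set 0] & f @` A `<=` [set 1]].
  apply/uniform_separatorP.
  exact: normal_uniform_separator (compact_normal hT cT) _ _ clB clA AB0.
have f0 x : f (Some x) != 0 -> (W `&` U) x.
  move=> fx; apply: contrapT => nx; move/eqP: fx; apply; apply: fB.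
  by exists (Some x) => // -[y [Wy Uy] [yx]]; apply: nx; rewrite -yx.
exists (f \o Some); split => /=.
- split; first by move=> x; apply: continuous_comp; [exact: cS|exact: cf].
  by exists K' => // x /f0[/WK'].
- move=> x; have : range f (f (Some x)) by exists (Some x).
  by move=> /f01; rewrite /= in_itv.
- by move=> x Kx; apply: fA; exists (Some x) => //; exists x.
- by move=> x /f0[].
Qed.

End CompactSupport.

Section TopologicalGroup.
Context (G : topologicalZmodType).

Lemma add_continuousr (a : G) : continuous (fun x : G => x + a).
Proof.
move=> x; apply: (@continuous_comp _ _ _ (fun x : G => (x, a)) (fun p : G * G => p.1 + p.2)).
  by apply: cvg_pair => /=; [exact: cvg_id|exact: cvg_cst].
exact: add_continuous.
Qed.

Lemma nbhs_sub (a : G) U : nbhs 0 U -> nbhs a [set x | U (x - a)].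
Proof. by move=> U0; have := @add_continuousr (- a) a; rewrite /continuous_at subrr; apply. Qed.

Lemma nbhs_opp U : nbhs (0 : G) U -> nbhs (0 : G) [set u | U (- u)].
Proof. by move=> U0; have := @opp_continuous G 0; rewrite /continuous_at oppr0; apply. Qed.

Lemma nbhs_add0 U : nbhs (0 : G) U ->
  exists2 V, nbhs (0 : G) V & forall x y, V x -> V y -> U (x + y).
Proof.
move=> U0; have := @add_continuous G (0, 0); rewrite /continuous_at /= addr0.
move=> /(_ _ U0) [[V1 V2] /= [V10 V20] hV]; exists (V1 `&` V2); first exact: filterI.
by move=> x y [V1x _] [_ V2y]; exact: (hV (x, y)).
Qed.

Lemma nbhs_sub0 U : nbhs (0 : G) U ->
  exists2 V, nbhs (0 : G) V & forall x y, V x -> V y -> U (x - y).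
Proof.
move=> /nbhs_add0[V V0 hV]; exists (V `&` [set u | V (- u)]).
  by apply: filterI => //; exact: nbhs_opp.
by move=> x y [Vx _] [_ Vy]; exact: hV.
Qed.

Lemma compactN (K : set G) : compact K -> compact (-%R @` K).
Proof.
move=> cK; apply: continuous_compact => //; apply: continuous_subspaceT.
exact: opp_continuous.
Qed.

Lemma compactD (A B : set G) : compact A -> compact B -> compact (Defs.msum A B).
Proof.
move=> cA cB; have -> : Defs.msum A B = (fun p : G * G => p.1 + p.2) @` (A `*` B).
  apply/seteqP; split => [_ [x Ax [y By <-]]|_ [[x y] /= [Ax By] <-]].
    by exists (x, y).
  by exists x => //; exists y.
apply: continuous_compact; last exact: compact_setX.
by apply: continuous_subspaceT; exact: add_continuous.
Qed.

Lemma compactB (A B : set G) : compact A -> compact B -> compact (mdiff A B).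
Proof.
move=> cA cB; have -> : mdiff A B = (fun p : G * G => p.1 - p.2) @` (A `*` B).
  apply/seteqP; split => [_ [x Ax [y By <-]]|_ [[x y] /= [Ax By] <-]].
    by exists (x, y).
  by exists x => //; exists y.
apply: continuous_compact; last exact: compact_setX.
by apply: continuous_subspaceT; exact: sub_continuous.
Qed.

Lemma cc_shift (R : realType) (f : G -> R) a : cc f -> cc (fun x => f (x + a)).
Proof.
apply: (@cc_comp _ _ _ (fun x => x + a) (fun x => x - a)).
- exact: add_continuousr.
- exact: add_continuousr.
- by move=> x; rewrite addrK.
Qed.

Lemma cc_opp (R : realType) (f : G -> R) : cc f -> cc (fun x => f (- x)).
Proof.
apply: (@cc_comp _ _ _ -%R -%R); [exact: opp_continuous..|exact: opprK].
Qed.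

Lemma cc_unif (R : realType) (f : G -> R) (e : R) : cc f -> 0 < e ->
  exists2 U, nbhs (0 : G) U & forall x u, U u -> `|f (x + u) - f x| <= e.
Proof.
move=> [cf [K cK hK]] e0.
have : \forall u \near (0 : G), K `<=` (fun x => `|f (x + u) - f x| <= e).
  move/compact_near_coveringP: cK => cK; apply: cK => x _.
  have /cvgrPdist_lt/(_ (e / 2) ltac:(by rewrite divr_gt0)) := cf x => fx.
  have := @add_continuous G (x, 0); rewrite /continuous_at /= addr0.
  move=> /(_ _ fx) [[V1 V2] /= [V10 V20] hV].
  exists (V1 `&` [set y | `|f x - f y| < e / 2], V2) => /=.
    by split => //; exact: filterI.
  move=> [y u] /= [[V1y h1] V2u]; have := hV (y, u) (conj V1y V2u) => /= h2.
  have := ler_normB (f x - f y) (f x - f (y + u)).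
  have -> : f x - f y - (f x - f (y + u)) = f (y + u) - f y by ring.
  by lra.
move=> h; pose U := [set u : G | forall x, K x -> `|f (x + u) - f x| <= e].
have U0 : nbhs (0 : G) U by exact: h.
(* When [x] is off the support and [x + u] is not, the estimate is used at [x + u] with the
   increment [- u]. *)
exists (U `&` [set u | U (- u)]); first by apply: filterI => //; exact: nbhs_opp.
move=> x u [Uu UNu]; have [/hK Kx|] := boolP (f x != 0); first exact: Uu.
rewrite negbK => /eqP fx0; have [/hK Kx|] := boolP (f (x + u) != 0).
  by have := UNu _ Kx; rewrite addrK distrC.
by rewrite negbK => /eqP ->; rewrite fx0 subrr normr0 ltW.
Qed.

End TopologicalGroup.

Section Borel.
Context (R : realType) (X : ptopologicalType).

Lemma borel_open (A : set X) : open A -> measurable (A : set (borel X)).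
Proof. by move=> oA; exact: sub_gen_smallest. Qed.

Lemma borel_closed (A : set X) : closed A -> measurable (A : set (borel X)).
Proof.
move=> cA; rewrite -[A]setCK; apply: measurableC; apply: borel_open.
by rewrite openC.
Qed.

Lemma borel_compact (A : set X) : hausdorff_space X -> compact A ->
  measurable (A : set (borel X)).
Proof. by move=> hX cA; apply: borel_closed; exact: compact_closed. Qed.

Lemma continuous_borel (f : X -> R) : continuous f ->
  measurable_fun setT (f : borel X -> R).
Proof.
move=> /continuousP cf; apply: (measurability _ (RGenOpens.measurableE R)).
move=> _ [_ [a [b ->] <-]]; rewrite setTI; apply: borel_open.
exact/cf/interval_open.
Qed.

Section Radon.
Context (mu : {measure set (borel X) -> \bar R}) (hX : hausdorff_space X).
Context (fin_mu : forall K : set X, compact K -> (mu K < +oo)%E).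

Lemma integrable_compact_support (f : borel X -> R) (K : set X) B :
  measurable_fun setT f -> compact K -> (forall x, f x != 0 -> K x) ->
  (forall x, `|f x| <= B) -> mu.-integrable setT (EFin \o f).
Proof.
move=> mf cK supp fB; have mK := borel_compact hX cK.
have -> : EFin \o f = (EFin \o f) \_ K.
  apply/funext => x; rewrite patchE; case: ifPn => // /negP nK /=.
  apply/eqP; apply: contrapT => fx; apply: nK; rewrite inE; apply: supp.
  by apply: contra_notN fx => /eqP ->.
apply/(integrable_mkcond _ mK); apply: measurable_bounded_integrable => //.
- exact: fin_mu.
- exact: measurable_funTS.
- exists B; split; first exact: num_real.
  by move=> M BM x _; apply: le_trans (fB x) (ltW BM).
Qed.

Lemma cc_integrable (f : X -> R) : cc f ->
  mu.-integrable setT (EFin \o (f : borel X -> R)).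
Proof.
move=> ccf; have [B _ hB] := cc_bounded ccf; have [cf [K cK hK]] := ccf.
apply: (integrable_compact_support _ cK hK hB); exact: continuous_borel.
Qed.

Lemma cc_intD (f g : X -> R) : cc f -> cc g ->
  \int[mu]_x (f x + g x) = \int[mu]_x f x + \int[mu]_x g x.
Proof. by move=> cf cg; apply: RintegralD => //; exact: cc_integrable. Qed.

Lemma cc_intZ c (f : X -> R) : cc f ->
  \int[mu]_x (c * f x) = c * \int[mu]_x f x.
Proof. by move=> cf; apply: RintegralZl => //; exact: cc_integrable. Qed.

Lemma cc_int_le (f g : X -> R) : cc f -> cc g -> (forall x, f x <= g x) ->
  \int[mu]_x f x <= \int[mu]_x g x.
Proof.
by move=> cf cg fg; apply: le_Rintegral => //; exact: cc_integrable.
Qed.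

Lemma cc_int_abs (f g : X -> R) : cc f -> cc g -> (forall x, `|f x| <= g x) ->
  `|\int[mu]_x f x| <= \int[mu]_x g x.
Proof.
move=> cf cg fg; apply: le_trans (le_normr_Rintegral _ _) _ => //.
  exact: cc_integrable.
by apply: cc_int_le => //; exact: cc_abs.
Qed.

Lemma ge0_cc_intE (f : X -> R) : cc f -> (forall x, 0 <= f x) ->
  (\int[mu]_x (f x)%:E)%E = (\int[mu]_x f x)%:E.
Proof.
move=> cf f0; rewrite /Rintegral fineK// ge0_fin_numE.
  have /integrableP[_] := cc_integrable cf; apply: le_lt_trans.
  rewrite le_eqVlt; apply/orP; left; apply/eqP; apply: eq_integral => x _ /=.
  by rewrite ger0_norm.
by apply: integral_ge0 => x _; rewrite lee_fin.
Qed.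

End Radon.
End Borel.

(** * Consequences of translation invariance *)

Section Haar.
Context (R : realType) (G : topologicalZmodType).
Context (mu : {measure set (borel G) -> \bar R}).
Context (lcG : lcag G) (haar_mu : haar mu).

Let hG : hausdorff_space G. Proof. by case: lcG. Qed.

Lemma haar_fin (K : set G) : compact K -> (mu K < +oo)%E.
Proof. by case: haar_mu => -[h _] _ _; exact: h. Qed.

Definition shiftb (a : G) : borel G -> borel G := fun x : G => x + a.

Lemma measurable_shift a : measurable_fun setT (shiftb a).
Proof.
apply: (@measurability _ _ (borel G) (borel G) setT (shiftb a) (@open G)) => // _ [A oA <-].
rewrite setTI; apply: borel_open; move/continuousP: (@add_continuousr G a).
exact.
Qed.

Lemma integral_shift (f : borel G -> \bar R) a :
  measurable_fun setT f -> (forall x, (0 <= f x)%E) ->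
  (\int[mu]_x f (x + a)%R = \int[mu]_x f x)%E.
Proof.
move=> mf f0.
have mS := measurable_shift a.
have := ge0_integral_pushforward mS mu measurableT mf (fun y _ => f0 y).
rewrite preimage_setT => <-; apply: eq_measure_integral => A mA _.
have [_ inv _] := haar_mu; change (mu (shiftb a @^-1` A) = mu A).
have -> : shiftb a @^-1` A = translate (- a) A.
  apply/seteqP; split => [x /= Ax|_ [x Ax <-]] ; last by rewrite /shiftb /= addrAC addNr add0r.
  by exists (x + a) => //; rewrite addrC addrK.
exact: inv.
Qed.

Lemma cc_int_shift (f : G -> R) a : cc f ->
  \int[mu]_x f (x + a) = \int[mu]_x f x.
Proof.
move=> cf; have mf : measurable_fun setT (EFin \o (f : borel G -> R)).
  by apply/measurable_EFinP; apply: continuous_borel; exact: cf.1.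
congr fine; rewrite integralE [RHS]integralE; congr (_ - _)%E.
  rewrite -(@integral_shift ((EFin \o (f : borel G -> R))^\+)%E a)//; last exact: measurable_funepos.
  by apply: eq_integral => x _; rewrite ?funeposE ?funenegE.
rewrite -(@integral_shift ((EFin \o (f : borel G -> R))^\-)%E a)//; last exact: measurable_funeneg.
by apply: eq_integral => x _; rewrite ?funeposE ?funenegE.
Qed.

(** If [U] were null, so would be every compact set, covered by finitely many translates of [U], and
    then the whole group by inner regularity. *)
Lemma haar_open_gt0 (U : set G) : open U -> U !=set0 -> (0 < mu U)%E.
Proof.
move=> oU [u Uu]; rewrite lt0e measure_ge0 andbT; apply/eqP => U0.
have [[_ inner] inv mu0] := haar_mu; move: mu0; rewrite inner// ltNge => /negP; apply.
apply: ge_ereal_sup => _ [K [cK _] <-].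
(* The property carries a measurable null cover because [compact_ind] also passes through subsets
   that need not be measurable. *)
have [B mB [KB B0]] : exists2 B : set (borel G), measurable B & K `<=` B /\ mu B = 0%E.
  apply: (@compact_ind _ (fun K => exists2 B : set (borel G), measurable B &
    K `<=` B /\ mu B = 0%E) K) => //.
  - by exists set0 => //; split => //; rewrite measure0.
  - move=> A A' [B mB [AB B0]] [B' mB' [AB' B'0]]; exists (B `|` B').
      exact: measurableU.
    split; first by move=> x [/AB|/AB']; [left|right].
    apply/eqP; rewrite eq_le measure_ge0 andbT.
    have : (mu (B `|` B') <= mu B + mu B')%E by exact: measureU2.
    by rewrite B0 B'0 adde0.
  - by move=> A A' AA' [B mB [AB B0]]; exists B => //; split => // x /AA' /AB.
  - move=> x _; exists (translate (x - u) U).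
      have -> : translate (x - u) U = (fun y => y + (u - x)) @^-1` U.
        apply/seteqP; split => [_ [y Uy <-]|y /= Uy] /=.
          by rewrite addrAC -[u - x]opprB subrr add0r.
        by exists (y + (u - x)) => //; rewrite addrC -addrA -[x - u]opprB subrr addr0.
      apply: open_nbhs_nbhs; split => /=; last by rewrite addrCA subrr addr0.
      by move/continuousP: (@add_continuousr G (u - x)); exact.
    exists (translate (x - u) U) => //; last first.
      by split => //; rewrite inv//; exact: borel_open.
    have -> : translate (x - u) U = (fun y => y + (u - x)) @^-1` U.
      apply/seteqP; split => [_ [y Uy <-]|y /= Uy] /=.
        by rewrite addrAC -[u - x]opprB subrr add0r.
      by exists (y + (u - x)) => //; rewrite addrC -addrA -[x - u]opprB subrr addr0.
    by apply: borel_open; move/continuousP: (@add_continuousr G (u - x)); exact.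
rewrite -B0; apply: le_measure; rewrite ?inE//; exact: borel_compact.
Qed.

Lemma cc_int_gt0 (f : G -> R) x : cc f -> (forall x, 0 <= f x) -> 0 < f x ->
  0 < \int[mu]_x f x.
Proof.
move=> cf f0 fx; pose U := f @^-1` `]f x / 2, +oo[%classic.
have oU : open U by have /continuousP := cf.1; apply; exact: interval_open.
have mU := borel_open oU.
have U0 : (0 < mu U)%E.
  apply: haar_open_gt0 => //; exists x; rewrite /U /= in_itv /= andbT.
  by rewrite ltr_pdivrMr// ltr_pMr// ltr1n.
have : ((f x / 2)%:E * mu U <= \int[mu]_y (f y)%:E)%E.
  rewrite -integral_cst// integral_mkcond; apply: ge0_le_integral => //.
  - by move=> y _; rewrite patchE; case: ifP => // _; rewrite lee_fin divr_ge0// ltW.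
  - by apply/(measurable_restrictT _ mU); exact: measurable_cst.
  - by apply/measurable_EFinP; apply: continuous_borel; exact: cf.1.
  - move=> y _; rewrite patchE; case: ifPn => [|_]; last by rewrite lee_fin.
    by rewrite inE /U /= in_itv /= andbT lee_fin => /ltW.
rewrite (ge0_cc_intE hG haar_fin cf f0) -lte_fin; apply: lt_le_trans.
by rewrite mule_gt0// lte_fin divr_gt0.
Qed.

End Haar.

(** * Complex functions, treated componentwise *)

Section ComplexFunctions.
Context (R : realType).
Local Notation C := R[i].

Definition contC (X : topologicalType) (f : X -> C) : Prop :=
  continuous (fun x => complex.Re (f x)) /\ continuous (fun x => complex.Im (f x)).

Lemma contCP (X : topologicalType) (f : X -> C) : continuous f <-> contC f.
Proof.
split=> [cf|[cr ci] x].
  split=> x; apply/cvgrPdist_lt => e e0;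
    have /cvgrPdist_lt/(_ e%:C%C) := cf x; rewrite ltcR => /(_ e0);
    apply: filterS => y; rewrite nmE ltcR => h; rewrite -raddfB.
    exact: le_lt_trans (ler_Re _) h.
  exact: le_lt_trans (ler_Im _) h.
apply/cvgrPdist_lt => e e0.
have [r r0 ->] : exists2 r : R, 0 < r & e = r%:C%C.
  by move: e0; case: e => r s; rewrite ltcE /= => /andP[/eqP -> r0]; exists r.
have r2 : 0 < r / 2 by rewrite divr_gt0.
have /cvgrPdist_lt/(_ _ r2) h1 := cr x; have /cvgrPdist_lt/(_ _ r2) h2 := ci x.
apply: filterS2 h1 h2 => y; rewrite -!raddfB => h1 h2.
by rewrite nmE ltcR; apply: le_lt_trans (nm_ReIm _) _; lra.
Qed.

Definition ccC (X : topologicalType) (f : X -> C) : Prop :=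
  cc (fun x => complex.Re (f x)) /\ cc (fun x => complex.Im (f x)).

Section Space.
Context (X : topologicalType).
Implicit Types f g : X -> C.

Lemma ccC_cont f : ccC f -> contC f.
Proof. by move=> [[cr _] [ci _]]. Qed.

Lemma ccCP f : hausdorff_space X -> continuous_compact_support f <-> ccC f.
Proof.
move=> hX; split=> [[cf csupp]|[[cr [K cK hK]] [ci [K' cK' hK']]]].
  have [cr ci] := (contCP f).1 cf; split; split => //;
    exists (tsupport f) => // x fx; apply: subset_closure => /=;
    by apply: contra_neq fx => ->.
split; first exact/contCP.
apply: (@subclosed_compact _ _ (K `|` K')); [exact: closed_closure|exact: compactU|].
have cl : closed (K `|` K') by apply: compact_closed => //; exact: compactU.
rewrite [X in _ `<=` X](closure_id _).1//; apply: closureS => x /= fx.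
have [re0|/hK] := eqVneq (complex.Re (f x)) 0; last by left.
right; apply: hK'; apply: contra_neq fx => im0.
by rewrite (complexE (f x)) re0 im0 mulr0 addr0.
Qed.

Lemma ccC_supp f : ccC f -> exists2 K, compact K & forall x, f x != 0 -> K x.
Proof.
move=> [[cr [K cK hK]] [ci [K' cK' hK']]]; exists (K `|` K'); first exact: compactU.
move=> x fx; have [re0|/hK] := eqVneq (complex.Re (f x)) 0; last by left.
right; apply: hK'; apply: contra_neq fx => im0.
by rewrite (complexE (f x)) re0 im0 mulr0 addr0.
Qed.

Lemma ccC_real (f : X -> R) : cc f -> ccC (fun x => (f x)%:C%C).
Proof.
move=> cf; split => //=; split; first by move=> x; exact: cvg_cst.
by exists set0; [exact: compact0|move=> x; rewrite eqxx].
Qed.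

Lemma ccCD f g : ccC f -> ccC g -> ccC (fun x => f x + g x).
Proof.
move=> [fr fi] [gr gi]; split.
  by under eq_fun do rewrite raddfD; exact: ccD.
by under eq_fun do rewrite raddfD; exact: ccD.
Qed.

Lemma cReM (x y : C) : complex.Re (x * y) =
  complex.Re x * complex.Re y + (- 1) * (complex.Im x * complex.Im y).
Proof. by case: x y => a b [c d] /=; rewrite mulN1r. Qed.

Lemma cImM (x y : C) : complex.Im (x * y) =
  complex.Re x * complex.Im y + complex.Im x * complex.Re y.
Proof. by case: x y => a b [c d] /=. Qed.

Lemma ccC_mul f g : contC f -> ccC g -> ccC (fun x => f x * g x).
Proof.
move=> [fr fi] [gr gi]; split.
  under eq_fun do rewrite cReM; apply: ccD; first exact: cc_mul.
  by apply: ccZ; exact: cc_mul.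
by under eq_fun do rewrite cImM; apply: ccD; exact: cc_mul.
Qed.

Lemma contC_cst (c : C) : contC (fun _ : X => c).
Proof. by split => x; exact: cvg_cst. Qed.

Lemma ccCZ c f : ccC f -> ccC (fun x => c * f x).
Proof. by apply: ccC_mul; exact: contC_cst. Qed.

Lemma contC_conj f : contC f -> contC (fun x => (f x)^*).
Proof.
move=> [fr fi]; split.
  have -> : (fun x => complex.Re (f x)^*) = (fun x => complex.Re (f x)).
    by apply/funext => x; case: (f x).
  exact: fr.
have -> : (fun x => complex.Im (f x)^*) = (fun x => - complex.Im (f x)).
  by apply/funext => x; case: (f x).
by move=> x; apply: cvgN; exact: fi.
Qed.

Lemma ccC_conj f : ccC f -> ccC (fun x => (f x)^*).
Proof.
move=> [fr fi]; split.
  have -> : (fun x => complex.Re (f x)^*) = (fun x => complex.Re (f x)).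
    by apply/funext => x; case: (f x).
  exact: fr.
have -> : (fun x => complex.Im (f x)^*) = (fun x => (-1) * complex.Im (f x)).
  by apply/funext => x; rewrite mulN1r; case: (f x).
exact: ccZ.
Qed.

Lemma ccC_bounded f : ccC f -> exists2 B, 0 < B & forall x, nm (f x) <= B.
Proof.
move=> [/cc_bounded[B B0 hB] /cc_bounded[B' B'0 hB']].
exists (B + B'); first exact: addr_gt0.
by move=> x; apply: le_trans (nm_ReIm _) _; apply: lerD.
Qed.

(** Reduces a statement that is linear in [f] to nonnegative real functions, where Tonelli and sums
    in the extended reals apply. *)
Lemma ccC_ind (Q : (X -> C) -> Prop) :
  (forall f : X -> R, cc f -> (forall x, 0 <= f x) -> Q (fun x => (f x)%:C%C)) ->
  (forall f g, ccC f -> ccC g -> Q f -> Q g -> Q (fun x => f x + g x)) ->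
  (forall c f, ccC f -> Q f -> Q (fun x => c * f x)) ->
  forall f, ccC f -> Q f.
Proof.
move=> Q0 QD QZ.
have Qreal (f : X -> R) : cc f -> Q (fun x => (f x)%:C%C).
  move=> cf; have ca := cc_abs cf.
  pose p x := 2^-1 * (`|f x| + f x); pose n x := 2^-1 * (`|f x| + (-1) * f x).
  have cp : cc p by apply: ccZ; exact: ccD.
  have cn : cc n by apply: ccZ; apply: ccD => //; exact: ccZ.
  have p0 x : 0 <= p x by rewrite mulr_ge0 ?invr_ge0// -lerBlDr sub0r -normrN ler_norm.
  have n0 x : 0 <= n x by rewrite mulr_ge0 ?invr_ge0// mulN1r subr_ge0 ler_norm.
  have -> : (fun x => (f x)%:C%C) = (fun x => (p x)%:C%C + (-1) * (n x)%:C%C).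
    apply/funext => x; rewrite mulN1r -rcB; congr (_%:C)%C.
    by rewrite /p /n; field.
  have ccp := ccC_real cp; have ccn := ccC_real cn.
  by apply: QD => //; [exact: ccCZ|exact: Q0|apply: QZ => //; exact: Q0].
move=> f [fr fi]; have ccr := ccC_real fr; have cci := ccC_real fi.
have -> : f = (fun x => (complex.Re (f x))%:C%C + 'i%C * (complex.Im (f x))%:C%C).
  by apply/funext => x; rewrite -complexE.
by apply: QD => //; [exact: ccCZ|exact: Qreal|apply: QZ => //; exact: Qreal].
Qed.

End Space.

Lemma ccC_shift (G : topologicalZmodType) (f : G -> C) a :
  ccC f -> ccC (fun x => f (x + a)).
Proof.
move=> [fr fi]; split; first exact: (cc_shift a fr).
exact: (cc_shift a fi).
Qed.

Section Integral.
Context (X : ptopologicalType) (hX : hausdorff_space X).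
Context (mu : {measure set (borel X) -> \bar R}).
Context (fin_mu : forall K : set X, compact K -> (mu K < +oo)%E).
Implicit Types f g : X -> C.
Local Notation I f := (cintegral mu setT f).

Lemma cintE f : I f = (\int[mu]_x complex.Re (f x) +i* \int[mu]_x complex.Im (f x))%C.
Proof. by []. Qed.

Lemma cintD f g : ccC f -> ccC g -> I (fun x => f x + g x) = I f + I g.
Proof.
move=> [fr fi] [gr gi]; rewrite !cintE.
under eq_Rintegral do rewrite raddfD.
under [X in (_ +i* X)%C]eq_Rintegral do rewrite raddfD.
by rewrite !cc_intD.
Qed.

Lemma cintZ c f : ccC f -> I (fun x => c * f x) = c * I f.
Proof.
move=> [fr fi]; rewrite !cintE.
under eq_Rintegral do rewrite cReM.
under [X in (_ +i* X)%C]eq_Rintegral do rewrite cImM.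
rewrite cc_intD//; [|exact: ccZ|by apply: ccZ; exact: ccZ].
rewrite cc_intD//; [|exact: ccZ|exact: ccZ].
rewrite !cc_intZ//; last exact: ccZ.
by apply/eqP; rewrite eq_complex cReM cImM /= !eqxx.
Qed.

Lemma cint_real (f : X -> R) : I (fun x => (f x)%:C%C) = (\int[mu]_x f x)%:C%C.
Proof.
rewrite cintE /=; congr (_ +i* _)%C.
by rewrite Rintegral_cst// mul0r.
Qed.

(** The factor 2 is the price of bounding the two components separately. *)
Lemma nm_cint_le f (g : X -> R) : ccC f -> cc g -> (forall x, nm (f x) <= g x) ->
  nm (I f) <= 2 * \int[mu]_x g x.
Proof.
move=> [fr fi] cg fg; apply: le_trans (nm_ReIm _) _; rewrite cintE /= mulr2n mulrDl mul1r.
apply: lerD; apply: cc_int_abs => // x; apply: le_trans (fg x); [exact: ler_Re|exact: ler_Im].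
Qed.

End Integral.

Lemma cint_shift (G : topologicalZmodType) (mu : {measure set (borel G) -> \bar R})
    (f : G -> C) a : haar mu -> ccC f ->
  cintegral mu setT (fun x => f (x + a)) = cintegral mu setT f.
Proof.
move=> hmu [fr fi]; rewrite !cintE; congr (_ +i* _)%C.
  exact: (cc_int_shift hmu a fr).
exact: (cc_int_shift hmu a fi).
Qed.

End ComplexFunctions.

(** * Periodic sums over a lattice *)

Section Lattice.
Context (R : realType) (G H : topologicalZmodType).
Local Notation C := R[i].
Context (lcG : lcag G) (lcH : lcag H) (L : set (G * H)) (latL : lattice L).

Let hG : hausdorff_space G. Proof. by case: lcG. Qed.
Let hH : hausdorff_space H. Proof. by case: lcH. Qed.

Lemma lattice0 : L 0. Proof. exact: (lattice_subgroup latL).1. Qed.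
Lemma latticeB x y : L x -> L y -> L (x - y).
Proof. exact: (lattice_subgroup latL).2. Qed.
Lemma latticeN x : L x -> L (- x).
Proof. by move=> Lx; rewrite -sub0r; apply: latticeB => //; exact: lattice0. Qed.
Lemma latticeD x y : L x -> L y -> L (x + y).
Proof. by move=> Lx Ly; rewrite -[y]opprK; apply: latticeB => //; exact: latticeN. Qed.

(** A neighbourhood whose differences all lie in a neighbourhood of 0 isolating 0 in [L] contains at
    most one lattice point. *)
Lemma lattice_finite K1 K2 : compact K1 -> compact K2 ->
  finite_set (L `&` (K1 `*` K2)).
Proof.
move=> cK1 cK2.
have [_ [V V0 VL]] := lattice_discrete latL lattice0.
have [[V1 V2] /= [V10 V20] V12] := V0.
have [W1 W10 hW1] := nbhs_sub0 V10; have [W2 W20 hW2] := nbhs_sub0 V20.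
apply: (@compact_ind _ (fun A => finite_set (L `&` A)) (K1 `*` K2)).
- by rewrite setI0.
- by move=> A B fA fB; rewrite setIUr finite_setU.
- by move=> A B AB; apply: sub_finite_set; exact: setIS.
- exact: compact_setX.
- move=> x _; exists [set z | W1 (z.1 - x.1) /\ W2 (z.2 - x.2)].
    exists ([set y | W1 (y - x.1)], [set y | W2 (y - x.2)]) => //=.
    by split; exact: nbhs_sub.
  have [[l [Ll Ul]]|n] := pselect (L `&` [set z | W1 (z.1 - x.1) /\ W2 (z.2 - x.2)] !=set0);
    last by apply: (@sub_finite_set _ _ set0) => // z hz; apply: n; exists z.
  apply: (@sub_finite_set _ _ [set l]) => // z [Lz Uz].
  have : (V `&` L) (z - l).
    split; last exact: latticeB.
    apply: V12 => /=; split.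
      have -> : z.1 - l.1 = (z.1 - x.1) - (l.1 - x.1) by rewrite opprB addrA subrK.
      by apply: hW1; [exact: Uz.1|exact: Ul.1].
    have -> : z.2 - l.2 = (z.2 - x.2) - (l.2 - x.2) by rewrite opprB addrA subrK.
    by apply: hW2; [exact: Uz.2|exact: Ul.2].
  by rewrite VL /= => /eqP; rewrite subr_eq0 => /eqP.
Qed.

Lemma lattice_box_seq K1 K2 : compact K1 -> compact K2 -> exists s : seq (G * H),
  [/\ uniq s, forall l, l \in s -> L l &
    forall l, L l -> K1 l.1 -> K2 l.2 -> l \in s].
Proof.
move=> cK1 cK2; have /finite_seqP[s sE] := lattice_finite cK1 cK2.
exists (undup s); split; first exact: undup_uniq.
- move=> l; rewrite mem_undup => ls; have : [set` s] l by [].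
  by rewrite -sE => -[].
- by move=> l Ll K1l K2l; rewrite mem_undup; have : [set` s] l by rewrite -sE.
Qed.

(** Locally the quotient is the image of a relatively compact open box, and the union of two boxes
    is contained in a box; compactness of the quotient does the rest. *)
Lemma lattice_cocompact_box : exists K1 K2, [/\ compact K1, compact K2 &
  forall z : G * H, exists2 l, L l & K1 (z.1 + l.1) /\ K2 (z.2 + l.2)].
Proof.
pose subL := lattice_subgroup latL.
pose Q := quotient_topology (quotient_group subL).
have cQ : compact [set: Q] := @lattice_cocompact _ _ _ latL.
pose pi (z : G * H) : Q := (\pi_Q z)%qT.
have piE z w : pi z = pi w <-> L (z - w).
  split=> [h|Lzw].
    by have /eqquotP/asboolP : (z = w %[mod quotient_group subL])%qT by exact: h.
  have : (z = w %[mod quotient_group subL])%qT by apply/eqquotP/asboolP.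
  exact.
suff [K1 [K2 [cK1 cK2 hK]]] : exists K1 K2, [/\ compact K1, compact K2 &
    forall z, [set: Q] (pi z) -> exists2 l, L l & K1 (z.1 + l.1) /\ K2 (z.2 + l.2)].
  by exists K1, K2; split => // z; exact: hK.
apply: (@compact_ind _ (fun A => exists K1 K2, [/\ compact K1, compact K2 &
    forall z, A (pi z) -> exists2 l, L l & K1 (z.1 + l.1) /\ K2 (z.2 + l.2)]) _ _ _ _ cQ).
- by exists set0, set0; split => //; exact: compact0.
- move=> A B [A1 [A2 [cA1 cA2 hA]]] [B1 [B2 [cB1 cB2 hB]]].
  exists (A1 `|` B1), (A2 `|` B2); split; [exact: compactU|exact: compactU|].
  by move=> z [/hA|/hB] [l Ll [h1 h2]]; exists l => //; split; [left|left|right|right].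
- by move=> A B AB [K1 [K2 [cK1 cK2 hK]]]; exists K1, K2; split => // z /AB /hK.
move=> q _; pose z0 := repr q.
have [_ lG _] := lcG; have [_ lH _] := lcH.
have [|W1 oW1 [zW1 [N1 cN1 WN1]]] := @compact_precompact_nbhs _ [set z0.1] lG.
  exact: compact_set1.
have [|W2 oW2 [zW2 [N2 cN2 WN2]]] := @compact_precompact_nbhs _ [set z0.2] lH.
  exact: compact_set1.
exists (pi @` (W1 `*` W2)).
  apply: open_nbhs_nbhs; split; last first.
    by exists z0; [split; [exact: zW1|exact: zW2]|exact: reprK].
  rewrite /open /= /quotient_open.
  (* The saturation of the box is the union of its lattice translates, hence open. *)
  have -> : (\pi_Q)%qT @^-1` (pi @` (W1 `*` W2)) =
      \bigcup_(l in L) [set z : G * H | W1 (z.1 + l.1) /\ W2 (z.2 + l.2)].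
    apply/seteqP; split => [z [w [W1w W2w] /piE Lwz]|z [l Ll [h1 h2]]].
      by exists (w - z) => //=; rewrite !addrA ![_ + _ - _]addrAC !subrr !add0r.
    exists (z + l); first by split.
    by apply/piE; rewrite addrAC subrr add0r.
  apply: bigcup_open => l _.
  have -> : [set z : G * H | W1 (z.1 + l.1) /\ W2 (z.2 + l.2)] =
      ((fun z : G * H => z.1 + l.1) @^-1` W1) `&` ((fun z : G * H => z.2 + l.2) @^-1` W2) by [].
  have c1 : continuous (fun z : G * H => z.1 + l.1).
    move=> z; apply: (@continuous_comp _ _ _ fst (fun x => x + l.1)).
      exact: cvg_fst.
    exact: add_continuousr.
  have c2 : continuous (fun z : G * H => z.2 + l.2).
    move=> z; apply: (@continuous_comp _ _ _ snd (fun x => x + l.2)).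
      exact: cvg_snd.
    exact: add_continuousr.
  by apply: openI; [move/continuousP: c1; exact|move/continuousP: c2; exact].
exists N1, N2; split => // z [w [W1w W2w] /piE Lwz]; exists (w - z) => //=.
by rewrite !addrA ![_ + _ - _]addrAC !subrr !add0r; split; [exact: WN1|exact: WN2].
Qed.

Section PeriodicSum.
Context (phi : G -> C) (g : H -> C) (ccphi : ccC phi) (ccg : ccC g).

(** The periodization of the product of [phi] and [g]. For compact supports only finitely many terms
    are nonzero. *)
Definition psum (z : G * H) : C :=
  \sum_(l \in L) (phi (z.1 + l.1) * g (z.2 + l.2)).

Lemma psumE (s : seq (G * H)) z : uniq s -> (forall l, l \in s -> L l) ->
  (forall l, L l -> phi (z.1 + l.1) * g (z.2 + l.2) != 0 -> l \in s) ->
  psum z = \sum_(l <- s) phi (z.1 + l.1) * g (z.2 + l.2).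
Proof.
move=> us sL hs; rewrite /psum (fsbigE s _ us) => [|l /sL//|l Ll ls].
  by rewrite big_seq_cond [RHS]big_seq_cond; apply: eq_bigl => l; case: (boolP (l \in s)) => //= /sL Ll; rewrite mem_set.
by apply/eqP; apply: contraNT ls => h; exact: hs.
Qed.

Lemma psum_box A1 A2 : compact A1 -> compact A2 -> exists s : seq (G * H),
  [/\ uniq s, forall l, l \in s -> L l &
   forall z, A1 z.1 -> A2 z.2 -> forall l, L l -> phi (z.1 + l.1) * g (z.2 + l.2) != 0 -> l \in s].
Proof.
move=> cA1 cA2; have [K cK hK] := ccC_supp ccphi; have [K' cK' hK'] := ccC_supp ccg.
have [s [us sL hs]] := lattice_box_seq (compactB cK cA1) (compactB cK' cA2).
exists s; split => // z A1z A2z l Ll; rewrite mulf_eq0 negb_or => /andP[/hK Kz /hK' Kz'].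
apply: hs => //.
  by exists (z.1 + l.1) => //; exists z.1 => //; rewrite addrAC subrr add0r.
by exists (z.2 + l.2) => //; exists z.2 => //; rewrite addrAC subrr add0r.
Qed.

Lemma psum_periodic z l : L l -> psum (z + l) = psum z.
Proof.
move=> Ll; rewrite /psum.
rewrite [RHS](@reindex_fsbig _ _ _ _ _ (fun l' => l + l') L).
  by apply: eq_fsbigr => l' _; rewrite /= !addrA.
split; first by move=> l' Ll'; exact: latticeD.
  by move=> x y _ _; exact: addrI.
by move=> l' Ll'; exists (l' - l); [exact: latticeB|rewrite addrC subrK].
Qed.

Lemma psum_unif (e : R) : 0 < e -> exists U1 U2, [/\ nbhs (0 : G) U1, nbhs (0 : H) U2 &
  forall z u, U1 u.1 -> U2 u.2 -> nm (psum (z + u) - psum z) <= e].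
Proof.
move=> e0; have [K1 [K2 [cK1 cK2 hK]]] := lattice_cocompact_box.
have [_ lG _] := lcG; have [_ lH _] := lcH.
have [|W1 oW1 [zW1 [N1 cN1 WN1]]] := @compact_precompact_nbhs _ [set (0 : G)] lG.
  exact: compact_set1.
have [|W2 oW2 [zW2 [N2 cN2 WN2]]] := @compact_precompact_nbhs _ [set (0 : H)] lH.
  exact: compact_set1.
have W10 : nbhs 0 W1 by apply: open_nbhs_nbhs; split => //; exact: zW1.
have W20 : nbhs 0 W2 by apply: open_nbhs_nbhs; split => //; exact: zW2.
have N10 := WN1 _ (nbhs_singleton W10); have N20 := WN2 _ (nbhs_singleton W20).
(* The box is enlarged by [N1] and [N2] so that one finite list serves both [z] and [z + u]. *)
have [s [us sL hs]] := psum_box (compactD cK1 cN1) (compactD cK2 cN2).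
have [B B0 hB] := ccC_bounded ccphi; have [B' B'0 hB'] := ccC_bounded ccg.
pose n : R := (size s).+1%:R; have n0 : 0 < n by rewrite ltr0n.
(* Chosen so that [n * d * (B + B') = e / 2]; the successor in [n] avoids dividing by 0 when the
   list is empty. *)
pose d := e / (2 * n * (B + B')).
have BB : 0 < B + B' by exact: addr_gt0.
have d0 : 0 < d by rewrite divr_gt0// !mulr_gt0.
have d2 : 0 < d / 2 by rewrite divr_gt0.
have unifC (T : topologicalZmodType) (f : T -> C) : ccC f -> exists2 U, nbhs (0 : T) U &
    forall x u, U u -> nm (f (x + u) - f x) <= d.
  move=> [fr fi]; have [U U0 hU] := cc_unif fr d2; have [U' U'0 hU'] := cc_unif fi d2.
  exists (U `&` U') => [|x u [/hU h1 /hU' h2]]; first exact: filterI.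
  apply: le_trans (nm_ReIm _) _; rewrite !raddfB.
  by have := h1 x; have := h2 x; rewrite /=; lra.
have [U1 U10 hU1] := unifC _ _ ccphi; have [U2 U20 hU2] := unifC _ _ ccg.
exists (U1 `&` W1), (U2 `&` W2); split; [exact: filterI|exact: filterI|].
move=> z u [U1u W1u] [U2u W2u].
have [l Ll [h1 h2]] := hK z.
rewrite -(psum_periodic z Ll) -(psum_periodic (z + u) Ll) -addrA [u + l]addrC addrA.
have {}h1 : K1 (z + l).1 by exact: h1.
have {}h2 : K2 (z + l).2 by exact: h2.
move: (z + l) h1 h2 => {}z h1 h2.
rewrite (psumE (s := s) (z := z))//; last first.
  apply: hs; first by exists z.1 => //; exists 0 => //; rewrite addr0.
  by exists z.2 => //; exists 0 => //; rewrite addr0.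
rewrite (psumE (s := s))//; last first.
  apply: hs; first by exists z.1 => //; exists u.1 => //; exact: WN1.
  by exists z.2 => //; exists u.2 => //; exact: WN2.
rewrite -sumrB; apply: le_trans (nm_sum _ _ _) _.
apply: le_trans (_ : \sum_(l <- s) (e / n) <= _); last first.
  rewrite sum_seq_cst mulrCA ler_piMr ?(ltW e0)// ler_pdivrMr// mul1r /n.
  by rewrite ler_nat.
move=> {l Ll}; apply: ler_sum => l _ /=.
have -> : z.1 + u.1 + l.1 = (z.1 + l.1) + u.1 by rewrite addrAC.
have -> : z.2 + u.2 + l.2 = (z.2 + l.2) + u.2 by rewrite addrAC.
set x := z.1 + l.1; set y := z.2 + l.2.
have -> : phi (x + u.1) * g (y + u.2) - phi x * g y =
   (phi (x + u.1) - phi x) * g (y + u.2) + phi x * (g (y + u.2) - g y) by ring.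
apply: le_trans (nmD _ _) _; rewrite !nmM.
have q1 : nm (phi (x + u.1) - phi x) * nm (g (y + u.2)) <= d * B'.
  by apply: ler_pM; rewrite ?nm_ge0//; exact: hU1.
have q2 : nm (phi x) * nm (g (y + u.2) - g y) <= B * d.
  by apply: ler_pM; rewrite ?nm_ge0//; exact: hU2.
have q3 : B * d + d * B' = (e / n) / 2.
  by rewrite /d; field; rewrite !lt0r_neq0.
have en : 0 < e / n by rewrite divr_gt0.
apply: le_trans (lerD q1 q2) _; rewrite addrC q3 ler_pdivrMr//.
by rewrite ler_peMr ?(ltW en)// ler1n.
Qed.

Lemma psum_periodic2 (x y z : G * H) : L (y - x) -> psum (x + z) = psum (y + z).
Proof.
move=> Lyx; rewrite -(psum_periodic (x + z) Lyx); congr psum.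
by rewrite addrC addrA subrK.
Qed.

(** Periodicity brings every translation into a compact box, which finitely many neighbourhoods of
    small oscillation cover; the colour of a point is such a neighbourhood. *)
Lemma ap_psum : ap psum.
Proof.
move=> e e0; have e2 : 0 < e / 2 by rewrite divr_gt0.
have [U1 [U2 [U10 U20 hU]]] := psum_unif e2.
have [K1 [K2 [cK1 cK2 hK]]] := lattice_cocompact_box.
have [I [k hk]] : exists (I : finType) (k : G * H -> I), forall x y,
    (K1 `*` K2) x -> (K1 `*` K2) y -> k x = k y ->
    forall z, nm (psum (x + z) - psum (y + z)) <= e.
  apply: (@compact_ind _ (fun A => exists (I : finType) (k : G * H -> I), forall x y,
    A x -> A y -> k x = k y ->
    forall z, nm (psum (x + z) - psum (y + z)) <= e) (K1 `*` K2)).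
  - by exists unit, (fun=> tt).
  - move=> A B [I [k hk]] [J [k' hk']].
    exists (I + J)%type, (fun x => if x \in A then inl (k x) else inr (k' x)) => x y.
    case: ifPn => xA; case: ifPn => yA xAB yAB //= [E].
      by apply: hk => //; rewrite -inE.
    move/negP: xA; move/negP: yA; rewrite !inE => yA xA.
    by apply: hk' => //; [case: xAB|case: yAB].
  - by move=> A B AB [I [k hk]]; exists I, k => x y /AB Bx /AB By; exact: hk.
  - exact: compact_setX.
  - move=> x0 _; exists [set z | U1 (z.1 - x0.1) /\ U2 (z.2 - x0.2)].
      exists ([set y | U1 (y - x0.1)], [set y | U2 (y - x0.2)]) => //=.
      by split; exact: nbhs_sub.
    exists unit, (fun=> tt) => x y [x1 x2] [y1 y2] _ z.
    have E w : w + z = (x0 + z) + (w - x0) by rewrite addrC [x0 + z]addrC -addrA [x0 + _]addrC subrK.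
    rewrite (E x) (E y); apply: le_trans (nm_triangle (psum (x0 + z)) _ _) _.
    rewrite [e]splitr; apply: lerD; first exact: (hU (x0 + z) (x - x0) x1 x2).
    by rewrite nmBC; exact: (hU (x0 + z) (y - x0) y1 y2).
have /choice[r hr] : forall z : G * H, exists w, (K1 `*` K2) w /\ L (w - z).
  move=> z; have [l Ll [h1 h2]] := hK z; exists (z + l); split => //.
  by rewrite addrAC subrr add0r.
exists I, (k \o r) => x y kxy z.
rewrite (@psum_periodic2 x (r x) z (hr x).2) (@psum_periodic2 y (r y) z (hr y).2).
by apply: hk => //; [exact: (hr x).1|exact: (hr y).1].
Qed.

End PeriodicSum.
End Lattice.

Lemma esum_finite_support (R : realType) (T : choiceType) (I : set T)
    (a : T -> R) (s : seq T) : uniq s -> (forall i, i \in s -> I i) ->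
  (forall i, I i -> 0 <= a i) -> (forall i, I i -> a i != 0 -> i \in s) ->
  (\esum_(i in I) (a i)%:E = (\sum_(i <- s) a i)%:E)%E.
Proof.
move=> us sI a0 hs; rewrite -sumEFin.
have fs : finite_set [set` s] by exact: finite_seq.
transitivity (\esum_(i in [set` s]) (a i)%:E)%E; last first.
  rewrite esum_fset//; last first.
    by move=> i; rewrite inE /= => si; rewrite lee_fin; apply: a0; exact: sI.
  by rewrite -fsbig_seq.
rewrite esum_mkcond [RHS]esum_mkcond; apply: eq_esum => i _.
case: ifPn => [|/negP] Ii; case: ifPn => [|/negP] si //.
  apply/eqP; rewrite eqe; apply/negPn/negP => ai; apply: si.
  by rewrite inE /=; apply: hs => //; rewrite inE in Ii.
by rewrite inE /= in si; case: Ii; rewrite inE; exact: sI.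
Qed.

(* Carries the sigma-finiteness needed by Fubini-Tonelli. *)
Definition sigma_finite_copy d (T : measurableType d) (R : realType)
  (m : {measure set T -> \bar R}) (_ : sigma_finite setT m) : set T -> \bar R := m.

Section SigmaFiniteCopy.
Context d (T : measurableType d) (R : realType) (m : {measure set T -> \bar R}).
Context (sf : sigma_finite setT m).

HB.instance Definition _ := Measure.copy (sigma_finite_copy sf) m.
HB.instance Definition _ :=
  Measure_isSigmaFinite.Build _ _ _ (sigma_finite_copy sf) sf.

End SigmaFiniteCopy.

Section HaarProduct.
Context (R : realType).

Lemma haar_sigma_finite (G : topologicalZmodType)
    (mu : {measure set (borel G) -> \bar R}) : lcag G -> haar mu ->
  exists nu : {sigma_finite_measure set (borel G) -> \bar R},
    (nu : set (borel G) -> \bar R) = mu.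
Proof.
move=> [hG _ [K cK KT]] hmu.
have sf : sigma_finite setT mu.
  exists K => [//|n]; split; first exact: borel_compact.
  exact: haar_fin.
exists (sigma_finite_copy sf : {sigma_finite_measure set (borel G) -> \bar R}).
by [].
Qed.

Context (G H : topologicalZmodType) (lcG : lcag G) (lcH : lcag H).
Context (mu : {measure set (borel G) -> \bar R}).
Context (theta : {measure set (borel H) -> \bar R}).
Context (haar_mu : haar mu) (haar_theta : haar theta).

Let hG : hausdorff_space G. Proof. by case: lcG. Qed.
Let hH : hausdorff_space H. Proof. by case: lcH. Qed.

Definition shift2 (l : G * H) (z : borel G * borel H) : borel G * borel H :=
  (shiftb l.1 z.1, shiftb l.2 z.2).

Lemma measurable_shift2 l : measurable_fun setT (shift2 l).
Proof.
apply: measurable_fun_pair.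
  by apply: (measurableT_comp (measurable_shift l.1)); exact: measurable_fst.
by apply: (measurableT_comp (measurable_shift l.2)); exact: measurable_snd.
Qed.

(* [mu \x theta] has a measure structure only for sigma-finite [mu] and [theta],
   hence the witness [P]. *)
Lemma haar_prod : exists P : {measure set (borel G * borel H) -> \bar R},
  [/\ forall A, P A = (mu \x theta)%E A,
    forall (f : borel G * borel H -> \bar R) l, measurable_fun setT f ->
      (forall z, (0 <= f z)%E) -> (\int[P]_z f (shift2 l z) = \int[P]_z f z)%E
  & forall (phi : G -> R) (g : H -> R), cc phi -> cc g ->
      (forall x, 0 <= phi x) -> (forall y, 0 <= g y) ->
      (\int[P]_z (phi z.1 * g z.2)%:E =
        (\int[mu]_x phi x * \int[theta]_y g y)%:E)%E].
Proof.
have [mu' mu'E] := haar_sigma_finite lcG haar_mu.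
have [theta' theta'E] := haar_sigma_finite lcH haar_theta.
pose P : {measure set (borel G * borel H) -> \bar R} := (mu' \x theta')%E.
have fubini (f : borel G * borel H -> \bar R) : measurable_fun setT f ->
    (forall z, (0 <= f z)%E) -> (\int[P]_z f z = \int[mu]_x \int[theta]_y f (x, y))%E.
  by move=> mf f0; rewrite -mu'E -theta'E; exact: fubini_tonelli1.
exists P; split => [|f l mf f0|phi g cphi cg phi0 g0].
- by move=> A; rewrite -mu'E -theta'E.
- have mfl : measurable_fun setT (f \o shift2 l).
    by apply: measurableT_comp => //; exact: measurable_shift2.
  transitivity (\int[mu]_x \int[theta]_y f (shiftb l.1 x, shiftb l.2 y))%E.
    by apply: (fubini (f \o shift2 l)) => // z; exact: f0.
  transitivity (\int[mu]_x \int[theta]_y f (x, y))%E; last by apply/esym; exact: fubini.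
  rewrite -(@integral_shift _ _ _ haar_mu (fun x => \int[theta]_y f (x, y))%E l.1).
  + apply: eq_integral => x _.
    rewrite -(@integral_shift _ _ _ haar_theta (fun y => f (shiftb l.1 x, y)) l.2)//.
    exact: measurable_fun_pair2.
  + by rewrite -theta'E; exact: measurable_fun_fubini_tonelli_F.
  + by move=> x; apply: integral_ge0.
- have mphi : measurable_fun setT (phi : borel G -> R) by apply: continuous_borel; exact: cphi.1.
  have mg : measurable_fun setT (g : borel H -> R) by apply: continuous_borel; exact: cg.1.
  rewrite (fubini (fun z => (phi z.1 * g z.2)%:E)); last 2 first.
  + apply/measurable_EFinP; apply: measurable_funM.
      by apply: (measurableT_comp mphi); exact: measurable_fst.
    by apply: (measurableT_comp mg); exact: measurable_snd.
  + by move=> z; rewrite lee_fin mulr_ge0.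
  rewrite (eq_integral (fun x : borel G => (phi x)%:E * (\int[theta]_y g y)%:E)%E); last first.
    move=> x _ /=; under eq_integral do rewrite EFinM.
    have mg' : measurable_fun setT (EFin \o (g : borel H -> R)) by exact/measurable_EFinP.
    have g0' (y : borel H) : setT y -> (0 <= (EFin \o (g : borel H -> R)) y)%E by rewrite lee_fin.
    rewrite (ge0_integralZl theta measurableT mg' g0') ?lee_fin//.
    by rewrite (ge0_cc_intE hH (haar_fin haar_theta) cg g0).
  have mphi' : measurable_fun setT (EFin \o (phi : borel G -> R)) by exact/measurable_EFinP.
  have phi0' (x : borel G) : setT x -> (0 <= (EFin \o (phi : borel G -> R)) x)%E by rewrite lee_fin.
  rewrite (ge0_integralZr mu measurableT mphi' phi0').
    by rewrite (ge0_cc_intE hG (haar_fin haar_mu) cphi phi0).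
  by rewrite lee_fin; apply: fine_ge0; apply: integral_ge0 => y _; rewrite lee_fin.
Qed.

End HaarProduct.

(** * Unfolding an integral over a fundamental domain *)

Section Unfolding.
Context (R : realType) (G H : topologicalZmodType).
Context (lcG : lcag G) (lcH : lcag H) (L : set (G * H)) (latL : lattice L).

Lemma lattice_countable : countable L.
Proof.
have [_ _ [K cK KT]] := lcG; have [_ _ [K' cK' K'T]] := lcH.
have -> : L = \bigcup_n \bigcup_m (L `&` (K n `*` K' m)).
  apply/seteqP; split => [l Ll|l [n _ [m _ []]]//].
  have [n _ Kn] : (\bigcup_n K n) l.1 by rewrite KT.
  have [m _ Km] : (\bigcup_n K' n) l.2 by rewrite K'T.
  by exists n => //; exists m.
apply: bigcup_countable => // n _; apply: bigcup_countable => // m _.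
by apply: finite_set_countable; exact: (lattice_finite latL).
Qed.

(** Turns sums over [L] into series indexed by [nat], as needed to exchange sum and integral; [dec]
    is [None] at the indices that code no lattice point. *)
Lemma lattice_enum : exists (idx : G * H -> nat) (dec : nat -> option (G * H)),
  {in L &, injective idx} /\
  forall k, if dec k is Some l then L l /\ idx l = k else forall l, L l -> idx l <> k.
Proof.
have /countable_injP[idx injidx] := lattice_countable.
have /choice[dec hdec] : forall k, exists c : option (G * H),
    if c is Some l then L l /\ idx l = k else forall l, L l -> idx l <> k.
  move=> k; have [[l [Ll lk]]|n] := pselect (exists l, L l /\ idx l = k).
    by exists (Some l).
  by exists None => l Ll lk; apply: n; exists l.
by exists idx, dec.
Qed.

Lemma esum_lattice_enum (h : G * H -> \bar R) (idx : G * H -> nat)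
    (dec : nat -> option (G * H)) : (forall z, (0 <= h z)%E) ->
  {in L &, injective idx} ->
  (forall k, if dec k is Some l then L l /\ idx l = k else forall l, L l -> idx l <> k) ->
  (\esum_(l in L) h l = \sum_(k <oo) if dec k is Some l then h l else 0)%E.
Proof.
move=> h0 injidx hdec; pose T k := if dec k is Some l then h l else 0%E.
rewrite nneseries_esumT => [|k]; last by case: (dec k).
transitivity (\esum_(l in L) T (idx l))%E.
  apply: eq_esum => l Ll; rewrite /T; have := hdec (idx l).
  case: (dec (idx l)) => [l' [Ll' ll']|]; last by move=> /(_ _ Ll).
  by congr (h _); apply/esym; apply: injidx => //; rewrite inE.
rewrite -(@esum_image _ _ _ _ _ T injidx) esum_mkcond; apply: eq_esum => k _.
case: ifPn => // /negP; rewrite inE => nk; have := hdec k.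
by case: (dec k) => // l [Ll lk]; case: nk; exists l.
Qed.

Lemma measurable_lattice_sum (h : borel G * borel H -> \bar R) :
  measurable_fun setT h -> (forall z, (0 <= h z)%E) ->
  measurable_fun setT (fun z => \esum_(l in L) h (shift2 l z))%E.
Proof.
move=> mh h0; have [idx [dec [injidx hdec]]] := lattice_enum.
have E (z : borel G * borel H) : (\esum_(l in L) h (shift2 l z) =
    \sum_(k <oo | k \in xpredT) if dec k is Some l then h (shift2 l z) else 0)%E.
  exact: (esum_lattice_enum (h := fun l => h (shift2 l z)) (fun l => h0 _) injidx hdec).
under eq_fun do rewrite E.
apply: ge0_emeasurable_sum => [k z _ _|k _]; first by case: (dec k).
case: (dec k) => [l|]; last exact: measurable_cst.
by apply: (measurableT_comp mh); exact: measurable_shift2.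
Qed.

Context (P : {measure set (borel G * borel H) -> \bar R}).
Context (invP : forall (f : borel G * borel H -> \bar R) l, measurable_fun setT f ->
      (forall z, (0 <= f z)%E) -> (\int[P]_z f (shift2 l z) = \int[P]_z f z)%E).
Context (F : set (borel G * borel H)) (fundF : fundamental_domain L F).

(** The translates [F + l] tile the product; invariance brings the integral over each tile back to
    [F]. *)
Lemma unfolding (h : borel G * borel H -> \bar R) : measurable_fun setT h ->
  (forall z, (0 <= h z)%E) ->
  (\int[P]_z h z = \int[P]_(z in F) \esum_(l in L) h (shift2 l z))%E.
Proof.
move=> mh h0; have [mF hF] := fundF.
have [idx [dec [injidx hdec]]] := lattice_enum.
pose T k z := if dec k is Some l then h (shift2 l z) else 0%E.
pose A k := if dec k is Some l then shift2 (- l) @^-1` F else set0.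
have mhl (l : G * H) : measurable_fun setT (fun z => h (shift2 l z)).
  by apply: (measurableT_comp mh); exact: measurable_shift2.
have mT k : measurable_fun setT (T k) by rewrite /T; case: (dec k).
have T0 k z : (0 <= T k z)%E by rewrite /T; case: (dec k).
have mA k : measurable (A k).
  rewrite /A; case: (dec k) => [l|]; last exact: measurable0.
  by rewrite -[X in measurable X]setTI; exact: measurable_shift2.
have UA : \bigcup_k A k = setT.
  apply/seteqP; split => // z _; have [f [[Ff Lzf] _]] := hF z.
  exists (idx ((z : G * H) - f)) => //; rewrite /A.
  have := hdec (idx ((z : G * H) - f)); case: (dec _) => [l [Ll ll]|]; last by move=> /(_ _ Lzf).
  have -> : l = (z : G * H) - f by apply: injidx => //; rewrite inE.
  rewrite /preimage /=; suff -> : shift2 (- ((z : G * H) - f)) z = f by [].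
  by case: (z) (f) => z1 z2 [f1 f2]; rewrite /shift2 /shiftb /=; congr pair; rewrite opprB addrC subrK.
have tA : trivIset setT A.
  move=> j k _ _ [z []]; rewrite /A.
  have := hdec j; have := hdec k; case: (dec j) => [l|//]; case: (dec k) => [l'|//].
  move=> [Ll' <-] [Ll <-]; rewrite /preimage /= => Fl Fl'.
  have sub m : (z : G * H) - (shift2 (- m) z : G * H) = m.
    case: (z) (m) => z1 z2 [m1 m2]; rewrite /shift2 /shiftb /=.
    by congr pair => /=; rewrite opprD opprK addrA subrr add0r.
  have [f [_ uf]] := hF z.
  have e : shift2 (- l) z = shift2 (- l') z.
    by rewrite -(uf (shift2 (- l) z))// ?sub// -(uf (shift2 (- l') z))// ?sub.
  by rewrite -(sub l) -(sub l') e.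
transitivity (\sum_(k <oo) \int[P]_(z in F) T k z)%E.
  rewrite -UA ge0_integral_bigcup//; last exact: measurable_funTS.
  apply: eq_eseriesr => k _; rewrite /A /T; have := hdec k.
  case: (dec k) => [l [Ll lk]|_]; last by rewrite integral_set0 integral0.
  rewrite integral_mkcond [RHS]integral_mkcond -(invP l); last 2 first.
  - have mS : measurable (shift2 (- l) @^-1` F).
      by rewrite -[X in measurable X]setTI; exact: measurable_shift2.
    by apply/(measurable_restrictT _ mS); exact: measurable_funTS.
  - by move=> z; rewrite patchE; case: ifP.
  apply: eq_integral => z _; rewrite !patchE.
  suff -> : (shift2 l z \in shift2 (- l) @^-1` F) = (z \in F) by [].
  apply/idP/idP; rewrite !inE /preimage /=.
    by rewrite /shift2 /shiftb /= !addrK; case: z.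
  by rewrite /shift2 /shiftb /= !addrK; case: z.
rewrite -integral_nneseries//; last by move=> k; exact: measurable_funTS.
apply: eq_integral => z _; apply/esym.
exact: (esum_lattice_enum (h := fun l => h (shift2 l z)) (fun l => h0 _) injidx hdec).
Qed.

End Unfolding.

(** * The mean of a periodic sum *)

Section MeanFormula.
Context (R : realType) (G H : topologicalZmodType).
Local Notation C := R[i].
Context (lcG : lcag G) (lcH : lcag H) (L : set (G * H)) (latL : lattice L).

Let hG : hausdorff_space G. Proof. by case: lcG. Qed.
Let hH : hausdorff_space H. Proof. by case: lcH. Qed.

Section Bilinear.
Implicit Types (phi psi : G -> C) (g k : H -> C).

Lemma psum_support phi g z : ccC phi -> ccC g -> exists s : seq (G * H),
  [/\ uniq s, forall l, l \in s -> L l &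
   forall l, L l -> phi (z.1 + l.1) * g (z.2 + l.2) != 0 -> l \in s].
Proof.
move=> cphi cg.
have [s [us sL hs]] := psum_box latL cphi cg (@compact_set1 _ z.1) (@compact_set1 _ z.2).
by exists s; split => //; exact: hs.
Qed.

Lemma psumDl phi psi g z : ccC phi -> ccC psi -> ccC g ->
  psum L (fun x => phi x + psi x) g z = psum L phi g z + psum L psi g z.
Proof.
move=> cphi cpsi cg; have [s [us sL hs]] := psum_support z cphi cg.
have [t [ut tL ht]] := psum_support z cpsi cg; pose r := undup (s ++ t).
have ur : uniq r by exact: undup_uniq.
have rL l : l \in r -> L l by rewrite mem_undup mem_cat => /orP[/sL|/tL].
have hsr l : L l -> phi (z.1 + l.1) * g (z.2 + l.2) != 0 -> l \in r.
  by move=> Ll /(hs _ Ll) ls; rewrite mem_undup mem_cat ls.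
have htr l : L l -> psi (z.1 + l.1) * g (z.2 + l.2) != 0 -> l \in r.
  by move=> Ll /(ht _ Ll) ls; rewrite mem_undup mem_cat ls orbT.
rewrite (psumE ur rL hsr) (psumE ur rL htr) (psumE ur rL) -?big_split /=.
  by apply: eq_bigr => l _; rewrite mulrDl.
move=> l Ll; rewrite mulrDl.
have [e|/(hsr _ Ll)//] := eqVneq (phi (z.1 + l.1) * g (z.2 + l.2)) 0.
by rewrite e add0r; exact: htr.
Qed.

Lemma psumDr phi g k z : ccC phi -> ccC g -> ccC k ->
  psum L phi (fun y => g y + k y) z = psum L phi g z + psum L phi k z.
Proof.
move=> cphi cg ck; have [s [us sL hs]] := psum_support z cphi cg.
have [t [ut tL ht]] := psum_support z cphi ck; pose r := undup (s ++ t).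
have ur : uniq r by exact: undup_uniq.
have rL l : l \in r -> L l by rewrite mem_undup mem_cat => /orP[/sL|/tL].
have hsr l : L l -> phi (z.1 + l.1) * g (z.2 + l.2) != 0 -> l \in r.
  by move=> Ll /(hs _ Ll) ls; rewrite mem_undup mem_cat ls.
have htr l : L l -> phi (z.1 + l.1) * k (z.2 + l.2) != 0 -> l \in r.
  by move=> Ll /(ht _ Ll) ls; rewrite mem_undup mem_cat ls orbT.
rewrite (psumE ur rL hsr) (psumE ur rL htr) (psumE ur rL) -?big_split /=.
  by apply: eq_bigr => l _; rewrite mulrDr.
move=> l Ll; rewrite mulrDr.
have [e|/(hsr _ Ll)//] := eqVneq (phi (z.1 + l.1) * g (z.2 + l.2)) 0.
by rewrite e add0r; exact: htr.
Qed.

Lemma psumZl c phi g z : psum L (fun x => c * phi x) g z = c * psum L phi g z.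
Proof.
by rewrite /psum mulr_fsumr; apply: eq_fsbigr => l _; rewrite mulrA.
Qed.

Lemma psumZr c phi g z : psum L phi (fun y => c * g y) z = c * psum L phi g z.
Proof.
by rewrite /psum mulr_fsumr; apply: eq_fsbigr => l _; rewrite mulrCA.
Qed.

End Bilinear.

Section Real.
Context (phi : G -> R) (g : H -> R) (cphi : cc phi) (cg : cc g).
Context (phi0 : forall x, 0 <= phi x) (g0 : forall y, 0 <= g y).

Definition rpsum (z : G * H) : R :=
  complex.Re (psum L (fun x => (phi x)%:C%C) (fun y => (g y)%:C%C) z).

Lemma rpsumE z :
  psum L (fun x => (phi x)%:C%C) (fun y => (g y)%:C%C) z = (rpsum z)%:C%C /\
  (\esum_(l in L) (phi (z.1 + l.1) * g (z.2 + l.2))%:E = (rpsum z)%:E)%E.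
Proof.
have [s [us sL hs]] := psum_support z (ccC_real cphi) (ccC_real cg).
have hs' l : L l -> phi (z.1 + l.1) * g (z.2 + l.2) != 0 -> l \in s.
  move=> Ll h; apply: hs => //; rewrite -rcM; apply: contra_neq h.
  by move=> /(congr1 (@complex.Re R)).
have E : psum L (fun x => (phi x)%:C%C) (fun y => (g y)%:C%C) z =
    (\sum_(l <- s) phi (z.1 + l.1) * g (z.2 + l.2))%:C%C.
  by rewrite (psumE us sL hs) rc_sum; apply: eq_bigr => l _; rewrite rcM.
rewrite /rpsum E; split => //=; apply: esum_finite_support => //.
by move=> l _; rewrite mulr_ge0.
Qed.

Lemma rpsum_ge0 z : 0 <= rpsum z.
Proof.
rewrite -lee_fin -(rpsumE z).2; apply: esum_ge0 => l _.
by rewrite lee_fin mulr_ge0.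
Qed.

Lemma rpsum_ge z l : L l -> phi (z.1 + l.1) * g (z.2 + l.2) <= rpsum z.
Proof.
move=> Ll; rewrite -lee_fin -(rpsumE z).2; apply: esum_ge; exists [set l].
  by split; [exact: finite_set1|move=> _ ->].
by rewrite fsbig_set1.
Qed.

End Real.

Context (mu : {measure set (borel G) -> \bar R}).
Context (theta : {measure set (borel H) -> \bar R}).
Context (haar_mu : haar mu) (haar_theta : haar theta).
Context (F : set (borel G * borel H)) (fundF : fundamental_domain L F).
Local Notation covol := (fine ((mu \x theta)%E F)).

(** The translation [w] is there because finite averages of translates will be integrated: each of
    them has the same integral over [F]. *)
Lemma int_rpsum : exists P : {measure set (borel G * borel H) -> \bar R},
  P F = (mu \x theta)%E F /\
  forall (phi : G -> R) (g : H -> R), cc phi -> cc g ->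
  (forall x, 0 <= phi x) -> (forall y, 0 <= g y) ->
  measurable_fun setT (rpsum phi g : borel G * borel H -> R) /\
  forall w : G * H, (\int[P]_(z in F) (rpsum phi g ((z : G * H) + w))%:E =
    (\int[mu]_x phi x * \int[theta]_y g y)%:E)%E.
Proof.
have [P [PE invP intP]] := haar_prod lcG lcH haar_mu haar_theta.
exists P; split => [|phi g cphi cg phi0 g0]; first exact: PE.
pose h (z : borel G * borel H) := (phi z.1 * g z.2)%:E.
have mh : measurable_fun setT h.
  apply/measurable_EFinP; apply: measurable_funM.
    by apply: (measurableT_comp (continuous_borel cphi.1)); exact: measurable_fst.
  by apply: (measurableT_comp (continuous_borel cg.1)); exact: measurable_snd.
have h0 z : (0 <= h z)%E by rewrite lee_fin mulr_ge0.
have E (z : borel G * borel H) :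
    (\esum_(l in L) h (shift2 l z) = (rpsum phi g z)%:E)%E.
  exact: (rpsumE cphi cg phi0 g0 z).2.
split.
  apply/measurable_EFinP.
  have := measurable_lattice_sum lcG lcH latL mh h0.
  by apply: eq_measurable_fun => z _; rewrite E.
move=> w.
have cphi' := cc_shift w.1 cphi; have cg' := cc_shift w.2 cg.
have <- : (\int[P]_z h (shift2 w z) = (\int[mu]_x phi x * \int[theta]_y g y)%:E)%E.
  by rewrite invP//; exact: intP.
rewrite (unfolding lcG lcH latL invP fundF (h := h \o shift2 w))//; last 2 first.
- by apply: (measurableT_comp mh); exact: measurable_shift2.
- by move=> z; exact: h0.
apply: eq_integral => z _; rewrite -E; apply: eq_esum => l _.
rewrite /h /shift2 /shiftb /=; congr (phi _ * g _)%:E.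
  by rewrite addrAC.
by rewrite addrAC.
Qed.

(** Finite: bumps equal to 1 on a box that meets all cosets have a periodic sum at least 1 on [F].
    Positive: otherwise the integral over [F], a product of positive integrals, would vanish. *)
Lemma covol_fin_gt0 : ((mu \x theta)%E F < +oo)%E /\ 0 < covol.
Proof.
have [P [PE hP]] := int_rpsum.
have [mF _] := fundF.
have [_ lG _] := lcG; have [_ lH _] := lcH.
have fin : (P F < +oo)%E.
  have [K1 [K2 [cK1 cK2 hK]]] := lattice_cocompact_box lcG lcH latL.
  have [phi [cphi p01 p1 _]] := @urysohn_cc R _ K1 setT hG lG cK1 openT (@subsetT _ _).
  have [g [cg g01 g1 _]] := @urysohn_cc R _ K2 setT hH lH cK2 openT (@subsetT _ _).
  have phi0 x : 0 <= phi x by case/andP: (p01 x).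
  have g0 x : 0 <= g x by case/andP: (g01 x).
  have [mr /(_ 0) I] := hP _ _ cphi cg phi0 g0.
  apply: (@le_lt_trans _ _ (\int[mu]_x phi x * \int[theta]_y g y)%:E); last by rewrite ltey.
  rewrite -I -[leLHS]mul1e -(integral_cst P mF); apply: ge0_le_integral => //.
  - apply/measurable_EFinP; apply: measurable_funTS.
    by under eq_fun do rewrite addr0.
  - move=> z _; rewrite lee_fin addr0; have [l Ll [h1 h2]] := hK z.
    by have := rpsum_ge cphi cg phi0 g0 z Ll; rewrite p1// g1// mulr1.
rewrite -PE; split => //; rewrite fine_gt0// fin andbT lt0e measure_ge0 andbT.
apply/eqP => PF0.
have [phi [cphi p01 p1 _]] := @urysohn_cc R _ [set 0] setT hG lG (@compact_set1 _ _) openT (@subsetT _ _).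
have [g [cg g01 g1 _]] := @urysohn_cc R _ [set 0] setT hH lH (@compact_set1 _ _) openT (@subsetT _ _).
have phi0 x : 0 <= phi x by case/andP: (p01 x).
have g0 x : 0 <= g x by case/andP: (g01 x).
have [mr /(_ 0) I] := hP _ _ cphi cg phi0 g0.
have : 0 < \int[mu]_x phi x * \int[theta]_y g y.
  by apply: mulr_gt0; apply: (@cc_int_gt0 _ _ _ _ _ _ 0) => //; rewrite ?p1 ?g1.
rewrite -lte_fin -I null_set_integral ?ltxx//.
apply/measurable_EFinP; apply: measurable_funTS.
by under eq_fun do rewrite addr0.
Qed.

(** A finite average of translates is within [e] of the mean everywhere, yet its integral over [F]
    is exactly the product of the two integrals. *)
Lemma mean_rpsum (phi : G -> R) (g : H -> R) : cc phi -> cc g ->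
  (forall x, 0 <= phi x) -> (forall y, 0 <= g y) ->
  mean (psum L (fun x => (phi x)%:C%C) (fun y => (g y)%:C%C)) =
  ((\int[mu]_x phi x * \int[theta]_y g y) / covol)%:C%C.
Proof.
move=> cphi cg phi0 g0; have [P [PE hP]] := int_rpsum.
have [mF _] := fundF; have [fin V0] := covol_fin_gt0.
have apu := ap_psum lcG lcH latL (ccC_real cphi) (ccC_real cg).
have [mr I] := hP _ _ cphi cg phi0 g0.
set u := psum L _ _; set V := covol in V0 *.
have PV : P F = V%:E by rewrite PE /V fineK// ge0_fin_numE// -PE measure_ge0.
set J := _ * _ in I *.
have m0 : 0 <= mean u.
  apply: mean_ge0 => // z; rewrite /u (rpsumE cphi cg phi0 g0 z).1 lecR.
  exact: rpsum_ge0.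
have [a a0 ma] : exists2 a : R, 0 <= a & mean u = a%:C%C.
  by move: m0; case: (mean u) => a b; rewrite lecE /= => /andP[/eqP -> a0]; exists a.
rewrite ma; congr (_%:C)%C; apply/(canRL (mulfK _)); first by rewrite gt_eqF.
suff key e : 0 < e -> `|a * V - J| <= e * V.
  apply/eqP; rewrite -subr_eq0 -normr_eq0 eq_le normr_ge0 andbT.
  apply/ler_addgt0Pl => e e0; rewrite addr0.
  by have := key (e / V) ltac:(by rewrite divr_gt0); rewrite divfK// gt_eqF.
move=> e0; have [s s0 hs] := meanP apu e0.
pose A (z : borel G * borel H) := avg s (rpsum phi g) (z : G * H).
have Ae z : `|A z - a| <= e.
  apply: le_trans (hs z); rewrite -/u ma.
  apply: le_trans (ler_Re _); rewrite raddfB /= avg_Re; exact: lexx.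
have mA w : measurable_fun setT (fun z : borel G * borel H => rpsum phi g ((z : G * H) + w)).
  by apply: (measurableT_comp mr (measurable_shift2 w)).
have mAE w : measurable_fun F
    (EFin \o (fun z : borel G * borel H => rpsum phi g ((z : G * H) + w))).
  by apply/measurable_EFinP; apply: measurable_funTS; exact: mA.
have mAF : measurable_fun F (EFin \o A).
  apply/measurable_EFinP; apply: measurable_funTS.
  by apply: measurable_funM => //; apply: measurable_sum => w; exact: mA.
have A0 z : 0 <= A z.
  by rewrite /A /avg mulr_ge0 ?invr_ge0// sumr_ge0// => w _; exact: rpsum_ge0.
have IA : (\int[P]_(z in F) (A z)%:E = J%:E)%E.
  rewrite /A /avg; under eq_integral do rewrite EFinM -sumEFin.
  rewrite ge0_integralZl//; last 2 first.
  - by apply: emeasurable_sum => w _; exact: mAE.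
  - by move=> z _; apply: sume_ge0 => w _; rewrite lee_fin; exact: rpsum_ge0.
  rewrite ge0_integral_sum//; last first.
    by move=> w z _; rewrite lee_fin; exact: rpsum_ge0.
  under eq_bigr do rewrite I.
  rewrite sumEFin -EFinM; congr EFin; rewrite sum_seq_cst mulrA mulVf ?mul1r//.
  by rewrite pnatr_eq0 size_eq0.
rewrite ler_distl lerBlDr; apply/andP; split.
  rewrite -mulrDl -lee_fin -IA EFinM -PV -(integral_cst P mF).
  apply: ge0_le_integral => //.
  - by move=> z _; rewrite lee_fin.
  - by move=> z _; rewrite lee_fin; have := Ae z; rewrite ler_distl => /andP[].
rewrite -lee_fin EFinD -IA !EFinM -PV -!(integral_cst P mF) -ge0_integralD//; last 2 first.
- by move=> z _; rewrite lee_fin.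
- by move=> z _; rewrite lee_fin ltW.
apply: ge0_le_integral => //.
- by apply: emeasurable_funD.
- move=> z _; rewrite -EFinD lee_fin; have := Ae z; rewrite ler_distl => /andP[].
  by rewrite lerBlDr.
Qed.

Lemma mean_psum (phi : G -> C) (g : H -> C) : ccC phi -> ccC g ->
  mean (psum L phi g) =
  cintegral mu setT phi * cintegral theta setT g / covol%:C%C.
Proof.
have finG := haar_fin haar_mu; have finH := haar_fin haar_theta.
move=> cphi; move: phi cphi g.
apply: (ccC_ind (Q := fun phi => forall g, ccC g -> mean (psum L phi g) =
  cintegral mu setT phi * cintegral theta setT g / covol%:C%C)).
- move=> phi cphi phi0 g; have ccphi := ccC_real cphi; move: g.
  apply: ccC_ind => [g cg g0|g k cg ck Ig Ik|c g cg Ig].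
  + by rewrite mean_rpsum// !cint_real rcM rcV rcM.
  + have -> : psum L (fun x => (phi x)%:C%C) (fun y => g y + k y) =
        (fun z => psum L (fun x => (phi x)%:C%C) g z + psum L (fun x => (phi x)%:C%C) k z).
      by apply/funext => z; exact: psumDr.
    rewrite meanD; [|exact: ap_psum..].
    by rewrite Ig Ik (cintD hH finH)// mulrDr mulrDl.
  + have -> : psum L (fun x => (phi x)%:C%C) (fun y => c * g y) =
        (fun z => c * psum L (fun x => (phi x)%:C%C) g z).
      by apply/funext => z; exact: psumZr.
    rewrite meanZ; last exact: ap_psum.
    by rewrite Ig (cintZ hH finH)// [in RHS]mulrCA !mulrA.
- move=> phi psi cphi cpsi Iphi Ipsi g cg.
  have -> : psum L (fun x => phi x + psi x) g = (fun z => psum L phi g z + psum L psi g z).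
    by apply/funext => z; exact: psumDl.
  rewrite meanD; [|exact: ap_psum..].
  by rewrite Iphi// Ipsi// (cintD hG finG)// !mulrDl.
- move=> c phi cphi Iphi g cg.
  have -> : psum L (fun x => c * phi x) g = (fun z => c * psum L phi g z).
    by apply/funext => z; exact: psumZl.
  rewrite meanZ; last exact: ap_psum.
  by rewrite Iphi// (cintZ hG finG)// !mulrA.
Qed.

End MeanFormula.

(** * Densities of model sets along van Hove sequences *)

Section BoundedMeasurable.
Context (R : realType) (G : topologicalZmodType).
Context (mu : {measure set (borel G) -> \bar R}).
Context (lcG : lcag G) (haar_mu : haar mu).

Let hG : hausdorff_space G. Proof. by case: lcG. Qed.

(** Cutting off by the indicator of a set leaves the continuous functions; this class keeps
    integrability without continuity. *)
Definition bmc (f : borel G -> R) : Prop :=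
  measurable_fun setT f /\ exists K B, [/\ compact (K : set G),
    forall x, f x != 0 -> K x & forall x, `|f x| <= B].

Implicit Types f g : borel G -> R.

Lemma bmc_integrable f : bmc f -> mu.-integrable setT (EFin \o f).
Proof.
move=> [mf [K [B [cK hK hB]]]].
exact: (integrable_compact_support hG (haar_fin haar_mu) mf cK hK hB).
Qed.

Lemma bmcD f g : bmc f -> bmc g -> bmc (fun x => f x + g x).
Proof.
move=> [mf [K [B [cK hK hB]]]] [mg [K' [B' [cK' hK' hB']]]]; split.
  exact: measurable_funD.
exists (K `|` K'), (B + B'); split; first exact: compactU.
  by move=> x; have [->|/hK ? _] := eqVneq (f x) 0; [rewrite add0r => /hK'; right|left].
by move=> x; apply: le_trans (ler_normD _ _) _; exact: lerD.
Qed.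

Lemma bmc_mul f g c : measurable_fun setT f -> (forall x, `|f x| <= c) -> bmc g ->
  bmc (fun x => f x * g x).
Proof.
move=> mf fc [mg [K [B [cK hK hB]]]]; split; first exact: measurable_funM.
exists K, (c * B); split => //.
  by move=> x; rewrite mulf_eq0 negb_or => /andP[_ /hK].
by move=> x; rewrite normrM; apply: ler_pM.
Qed.

Lemma bmcZ c g : bmc g -> bmc (fun x => c * g x).
Proof. by apply: (bmc_mul (c := `|c|)) => // x. Qed.

Lemma bmc_sum (I : Type) (s : seq I) (F : I -> borel G -> R) :
  (forall i, bmc (F i)) -> bmc (fun x => \sum_(i <- s) F i x).
Proof.
move=> hF; elim: s => [|i s IH].
  under eq_fun do rewrite big_nil; split => //.
  by exists set0, 0; split => [|x|x]; [exact: compact0|rewrite eqxx|rewrite normr0].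
by under eq_fun do rewrite big_cons; exact: bmcD.
Qed.

Lemma bmc_cc (f : G -> R) : cc f -> bmc f.
Proof.
move=> cf; have [B _ hB] := cc_bounded cf; split.
  by apply: continuous_borel; exact: cf.1.
by have [_ [K cK hK]] := cf; exists K, B.
Qed.

Lemma bmc_indic (A K : set G) : measurable (A : set (borel G)) -> compact K ->
  A `<=` K -> bmc (\1_(A : set (borel G))).
Proof.
move=> mA cK AK; split; first exact: measurable_indic.
exists K, 1; split => // x; rewrite indicE.
  by rewrite pnatr_eq0 eqb0 negbK inE; exact: AK.
by case: (x \in A); rewrite ?normr1 ?normr0.
Qed.

Lemma bmc_shift f a : bmc f -> bmc (fun x => f (shiftb a x)).
Proof.
move=> [mf [K [B [cK hK hB]]]]; split.
  by apply: (measurableT_comp mf); exact: measurable_shift.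
exists ((fun x => x - a) @` K), B; split => //.
  apply: continuous_compact => //; apply: continuous_subspaceT.
  exact: add_continuousr.
by move=> x /hK Kx; exists (x + a) => //; rewrite addrK.
Qed.

Lemma bmc_intD f g : bmc f -> bmc g ->
  \int[mu]_x (f x + g x) = \int[mu]_x f x + \int[mu]_x g x.
Proof. by move=> bf bg; apply: RintegralD => //; exact: bmc_integrable. Qed.

Lemma bmc_intZ c f : bmc f -> \int[mu]_x (c * f x) = c * \int[mu]_x f x.
Proof. by move=> bf; apply: RintegralZl => //; exact: bmc_integrable. Qed.

Lemma bmc_int_sum (I : Type) (s : seq I) (F : I -> borel G -> R) :
  (forall i, bmc (F i)) ->
  \int[mu]_x (\sum_(i <- s) F i x) = \sum_(i <- s) \int[mu]_x F i x.
Proof.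
move=> hF; elim: s => [|i s IH].
  by under eq_Rintegral do rewrite big_nil; rewrite big_nil Rintegral_cst// mul0r.
under eq_Rintegral do rewrite big_cons.
by rewrite bmc_intD ?IH ?big_cons//; exact: bmc_sum.
Qed.

Lemma bmc_int_indic (A K : set G) : measurable (A : set (borel G)) -> compact K ->
  A `<=` K -> \int[mu]_x (\1_(A : set (borel G)) x) = fine (mu A).
Proof.
by move=> mA cK AK; rewrite /Rintegral integral_indic// setIT.
Qed.

Lemma bmc_int_shift f a : bmc f -> \int[mu]_x f (shiftb a x) = \int[mu]_x f x.
Proof.
move=> [mf _]; have mEf : measurable_fun setT (EFin \o f) by exact/measurable_EFinP.
congr fine; rewrite integralE [RHS]integralE; congr (_ - _)%E.
  rewrite -(@integral_shift _ _ _ haar_mu ((EFin \o f)^\+)%E a)//; last exact: measurable_funepos.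
  by apply: eq_integral => x _; rewrite ?funeposE ?funenegE.
rewrite -(@integral_shift _ _ _ haar_mu ((EFin \o f)^\-)%E a)//; last exact: measurable_funeneg.
by apply: eq_integral => x _; rewrite ?funeposE ?funenegE.
Qed.

Lemma bmc_close f g (A K : set G) B : bmc f -> bmc g ->
  measurable (A : set (borel G)) -> compact K -> A `<=` K ->
  (forall x, A x -> `|f x - g x| <= B) -> (forall x, ~ A x -> f x = g x) ->
  `|\int[mu]_x f x - \int[mu]_x g x| <= B * fine (mu A).
Proof.
move=> bf bg mA cK AK fgB fgE.
have bA := bmc_indic mA cK AK.
rewrite -(bmc_int_indic mA cK AK) -bmc_intZ//.
rewrite -RintegralB//; [|exact: bmc_integrable..].
have bB : bmc (fun x => f x - g x).
  have := bmcD bf (bmcZ (-1) bg); congr bmc.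
  by apply/funext => x; rewrite mulN1r.
apply: le_trans (le_normr_Rintegral _ _) _ => //; first exact: bmc_integrable.
apply: le_Rintegral => //.
- have : bmc (fun x => `|f x - g x|).
    have [mb [K' [B' [cK' hK' hB']]]] := bB; split; first exact: measurableT_comp.
    by exists K', B'; split => // x; [rewrite normr_eq0 => /hK'|rewrite normr_id].
  exact: bmc_integrable.
- by apply: bmc_integrable; exact: bmcZ.
- move=> x _; rewrite indicE; case: (boolP (x \in (A : set (borel G)))) => [|/negP]; rewrite inE => Ax.
    by rewrite mulr1; exact: fgB.
  by rewrite mulr0 fgE// subrr normr0.
Qed.

End BoundedMeasurable.

Section VanHoveBoundary.
Context (G : topologicalZmodType) (hG : hausdorff_space G).

(** Needed for the measurability of the second half of the van Hove boundary. *)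
Lemma closed_mdiff (A K : set G) : closed A -> compact K -> closed (mdiff A K).
Proof.
move=> clA cK; rewrite -[mdiff A K]setCK; apply: open_closedC.
rewrite openE => x nx; rewrite /interior.
have : \forall y \near x, K `<=` (fun k => ~ A (y + k)).
  move/compact_near_coveringP: cK => cK; apply: cK => k Kk.
  have nA : nbhs (x + k) (~` A).
    apply: open_nbhs_nbhs; split; first by rewrite openC.
    by move=> Axk; apply: nx; exists (x + k) => //; exists k => //; rewrite addrK.
  have [[V1 V2] /= [V1x V2k] hV] := @add_continuous G (x, k) _ nA.
  exists (V2, V1) => //= -[k' y] /= [V2k' V1y].
  exact: (hV (y, k')).
apply: filterS => y hy [a Aa [k Kk yE]]; apply: (hy k) => //.
by rewrite -yE subrK.
Qed.

Lemma boundary_sub (K A : set G) : van_hove_boundary K A `<=` Defs.msum A K `|` A.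
Proof. by move=> x [[? _]|[_ ?]]; [left|right]. Qed.

Lemma measurable_boundary (K A : set G) : compact K -> compact A ->
  measurable (van_hove_boundary K A : set (borel G)).
Proof.
move=> cK cA; apply: measurableU.
  apply: measurableD; first by apply: borel_compact => //; exact: compactD.
  by apply: borel_open; exact: open_interior.
apply: measurableI; last exact: borel_compact.
by apply: borel_closed; apply: closed_mdiff => //; exact: closed_closure.
Qed.

(** With [boundary_in], the only way the boundary is used: a displacement in [K] that crosses the
    border of [A] puts the point in the boundary. *)
Lemma boundary_out (K A : set G) x y : A y -> ~ A x -> K (x - y) ->
  van_hove_boundary K A x.
Proof.
move=> Ay nAx Kxy; left; split; last by move=> /interior_subset.
by exists y => //; exists (x - y) => //; rewrite addrC subrK.
Qed.

Lemma boundary_in (K A : set G) x y : A x -> ~ A y -> K (y - x) ->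
  van_hove_boundary K A x.
Proof.
move=> Ax nAy Kyx; right; split => //; exists y; first exact: subset_closure.
by exists (y - x) => //; rewrite subKr.
Qed.

End VanHoveBoundary.

Section Density.
Context (R : realType) (G H : topologicalZmodType).
Local Notation C := R[i].
Context (lcG : lcag G) (lcH : lcag H) (L : set (G * H)) (latL : lattice L).
Context (denseL : dense (snd @` L)).

Let hG : hausdorff_space G. Proof. by case: lcG. Qed.
Let hH : hausdorff_space H. Proof. by case: lcH. Qed.

(* As [snd @` L] is dense, the averaging translations may be taken in G x 0. *)
Lemma mean_translates (phi : G -> C) (g : H -> C) (e : R) : ccC phi -> ccC g ->
  0 < e -> exists2 a : seq G, a != [::] &
  forall z, nm ((size a)%:R^-1 * \sum_(x <- a) psum L phi g (z + (x, 0)) -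
                mean (psum L phi g)) <= e.
Proof.
move=> cphi cg e0; have e2 : 0 < e / 2 by rewrite divr_gt0.
have apu := ap_psum lcG lcH latL cphi cg.
have [s s0 hs] := meanP apu e2.
have [U1 [U2 [U10 U20 hU]]] := psum_unif lcG lcH latL cphi cg e2.
have /choice[x hx] : forall w : G * H, exists x : G, forall z,
    nm (psum L phi g (z + w) - psum L phi g (z + (x, 0))) <= e / 2.
  move=> w.
  have V0 : nbhs w.2 [set y | U2 (- (y - w.2))] by apply: (@nbhs_sub _ w.2 [set u | U2 (- u)]); exact: nbhs_opp.
  have [y [Vl [l Ll lE]]] : interior [set y | U2 (- (y - w.2))] `&` (snd @` L) !=set0.
    apply: denseL; last exact: open_interior.
    by exists w.2; exact: nbhs_singleton (nbhs_interior V0).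
  (* Subtracting [l], whose second coordinate is close to that of [w], leaves a translation along G
     up to a small error in H. *)
  rewrite -{}lE in Vl; exists (w.1 - l.1) => z.
  rewrite (_ : psum L phi g (z + w) = psum L phi g ((z + (w.1 - l.1, 0)) + (0, w.2 - l.2))).
    apply: (hU (z + (w.1 - l.1, 0)) (0, w.2 - l.2)) => /=; first exact: nbhs_singleton.
    by have := interior_subset Vl; rewrite /= opprB.
  rewrite -(psum_periodic latL phi g (z + w) (latticeN latL Ll)); congr psum.
  by clear; case: z w l => z1 z2 [w1 w2] [l1 l2] /=; congr pair; rewrite /= ?addr0 -?addrA ?add0r.
exists [seq x w | w <- s]; first by case: (s) s0.
move=> z; rewrite size_map big_map.
apply: le_trans (nm_triangle (avg s (psum L phi g) z) _ _) _.
rewrite [e]splitr; apply: lerD; last exact: hs.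
rewrite /avg -mulrBr -sumrB.
have n0 : 0 < (size s)%:R :> R by rewrite ltr0n lt0n size_eq0.
have -> : (size s)%:R^-1 = ((size s)%:R^-1)%:C%C :> C by rewrite rcV rmorph_nat.
rewrite nmM nm_real ger0_norm ?invr_ge0//.
rewrite ler_pdivrMl//; apply: le_trans (nm_sum _ _ _) _.
rewrite -sum_seq_cst; apply: ler_sum => w _; rewrite nmBC; exact: hx.
Qed.

(** The condition on [l.1 - t] selects the points of [A] that have a partner at distance [t] in [A],
    as in the autocorrelation. *)
Definition dsum (A : set G) (t : G) (g : H -> C) : C :=
  \sum_(l \in [set l | L l /\ A l.1 /\ A (l.1 - t)]) g l.2.

Lemma dsumE A t g (s : seq (G * H)) : uniq s -> (forall l, l \in s -> L l) ->
  (forall l, L l -> A l.1 -> A (l.1 - t) -> g l.2 != 0 -> l \in s) ->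
  dsum A t g = \sum_(l <- s) if `[< A l.1 /\ A (l.1 - t) >] then g l.2 else 0.
Proof.
move=> us sL hs; rewrite -big_mkcond -big_filter /=.
rewrite /dsum (fsbigE [seq l <- s | `[< A l.1 /\ A (l.1 - t) >]]).
- rewrite big_seq_cond [RHS]big_seq_cond; apply: eq_bigl => l.
  case: (boolP (l \in _)) => //=; rewrite mem_filter => /andP[/asboolP[h1 h2] /sL Ll].
  by rewrite mem_set.
- exact: filter_uniq.
- by move=> l /=; rewrite mem_filter => /andP[/asboolP[h1 h2] /sL Ll].
- move=> l [Ll [h1 h2]]; rewrite mem_filter negb_and => /orP[/asboolPn|/negP nls]; first by case.
  by apply/eqP; apply: contra_notT nls; exact: hs.
Qed.

Context (mu : {measure set (borel G) -> \bar R}).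
Context (theta : {measure set (borel H) -> \bar R}).
Context (haar_mu : haar mu) (haar_theta : haar theta).
Context (F : set (borel G * borel H)) (fundF : fundamental_domain L F).
Local Notation covol := (fine ((mu \x theta)%E F)).

Section Estimate.
Context (phi : G -> R) (g : H -> R) (cphi : cc phi) (cg : cc g).
Context (phi0 : forall x, 0 <= phi x) (g0 : forall y, 0 <= g y).
Context (symphi : forall x, phi (- x) = phi x) (phi_neq0 : phi 0 != 0).

(* Integrating the periodic sum over [- x], for [x] in [A], counts each lattice
   point with weight [\int phi], up to points near the boundary of [A]. *)
Lemma density_estimate (t : G) (e : R) : 0 < e -> exists2 B : R, 0 <= B &
  exists2 K : set G, compact K & forall A : set G, compact A ->
  nm ((\int[mu]_x phi x)%:C%C * dsum A t (fun y => (g y)%:C%C) -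
      mean (psum L (fun x => (phi x)%:C%C) (fun y => (g y)%:C%C)) * (fine (mu A))%:C%C) <=
  B * fine (mu (van_hove_boundary K A)) + e * fine (mu A).
Proof.
move=> e0; pose P := psum L (fun x => (phi x)%:C%C) (fun y => (g y)%:C%C).
have rphi := ccC_real cphi; have rg := ccC_real cg.
have apP : ap P := ap_psum lcG lcH latL rphi rg.
have [B [B0 hB]] : exists B : R, 0 <= B /\ forall z, rpsum L phi g z <= B.
  have [B B0 hB] := ap_bounded apP; exists B; split => [|z]; first exact: ltW.
  apply: le_trans (hB z); apply: le_trans (ler_norm _) _.
  by apply: le_trans (ler_Re _).
have [a a0 ha] := mean_translates rphi rg e0.
have [_ [Cs cCs hCs]] := cphi.
have fa : compact [set` a] by apply: finite_compact; exact: finite_seq.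
(* All displacements that occur: the support of [phi] and its opposite, the support shifted by [t],
   the averaging translations and their opposites. *)
pose K := Cs `|` (-%R @` Cs) `|` mdiff Cs [set t] `|` [set` a] `|` (-%R @` [set` a]).
have cK : compact K.
  by do ! [apply: compactU => //]; [exact: compactN|apply: compactB => //; exact: compact_set1|exact: compactN].
(* One [B] for replacing the count by an integral, one for moving the cutoff by the averaging
   translations. *)
exists (B + B); first exact: addr_ge0.
exists K => // A cA.
pose A' := Defs.msum A ([set 0] `|` (-%R @` [set` a])).
have cA' : compact A' by apply: compactD => //; apply: compactU; [exact: compact_set1|exact: compactN].
have AA' x : A x -> A' x by move=> Ax; exists x => //; exists 0; [left|rewrite addr0].
have [s [us sL hs]] := psum_box latL rphi rg (compactN cA') (@compact_set1 _ (0 : H)).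
(* The periodic sum at [(- x, 0)] restricted to a finite list: exact on [A'], at most the full sum
   elsewhere, and compactly supported. *)
pose q (x : borel G) := \sum_(l <- s) phi (l.1 - x) * g l.2.
have hs' l x : A' x -> L l -> phi (l.1 - x) * g l.2 != 0 -> l \in s.
  move=> A'x Ll h; apply: (hs (- x, 0)) => //=; first by exists x.
  by rewrite add0r [- x + _]addrC -rcM; apply: contra_neq h => /(congr1 (@complex.Re R)).
have qE x : A' x -> q x = rpsum L phi g (- x, 0).
  move=> A'x; apply/eqP; rewrite -eqe -(rpsumE latL cphi cg phi0 g0 (- x, 0)).2; apply/eqP.
  rewrite (esum_finite_support (s := s))//=.
  - by congr EFin; apply: eq_bigr => l _; rewrite add0r [- x + _]addrC.
  - by move=> l _; rewrite mulr_ge0.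
  - by move=> l Ll; rewrite add0r [- x + _]addrC; exact: hs'.
have qB x : q x <= B.
  apply: le_trans (hB (- x, 0)).
  rewrite -lee_fin -(rpsumE latL cphi cg phi0 g0 (- x, 0)).2; apply: esum_ge.
  exists [set` s]; first by split; [exact: finite_seq|move=> l /sL].
  rewrite -fsbig_seq// sumEFin lee_fin; apply: ler_sum => l _.
  by rewrite /= add0r [- x + _]addrC.
have q0 x : 0 <= q x by apply: sumr_ge0 => l _; rewrite mulr_ge0.
have bterm l : bmc (fun x : borel G => phi (l.1 - x) * g l.2).
  have := bmcZ (g l.2) (bmc_cc (cc_opp (cc_shift l.1 cphi))).
  congr bmc; apply/funext => x; by rewrite /= mulrC [- x + _]addrC.
have bq : bmc q by exact: bmc_sum.
have mA : measurable (A : set (borel G)) by exact: borel_compact.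
have bA : bmc (\1_(A : set (borel G)) : borel G -> R) by exact: (bmc_indic R mA cA (fun _ h => h)).
have iB x : `|\1_(A : set (borel G)) x| <= 1 :> R.
  by rewrite indicE; case: (x \in _); rewrite ?normr1 ?normr0.
have bAf (f : borel G -> R) : bmc f -> bmc (fun x => \1_(A : set (borel G)) x * f x).
  by apply: bmc_mul iB; exact: measurable_indic.
have mdA := measurable_boundary hG cK cA.
have cdA : compact (Defs.msum A K `|` A) by apply: compactU => //; exact: compactD.
have dAs := @boundary_sub G K A.
have indicT x : A x -> \1_(A : set (borel G)) x = 1 :> R by move=> Ax; rewrite indicE mem_set.
have indicF x : ~ A x -> \1_(A : set (borel G)) x = 0 :> R by move=> Ax; rewrite indicE memNset.
pose E (l : G * H) : R := if `[< A l.1 /\ A (l.1 - t) >] then 1 else 0.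
pose I := \int[mu]_x (\1_(A : set (borel G)) x * q x).
pose cphi' := \int[mu]_x phi x.
pose S := \sum_(l <- s) E l * g l.2.
have SE : dsum A t (fun y => (g y)%:C%C) = S%:C%C.
  rewrite (dsumE us sL) => [|l Ll Al Alt gl].
    rewrite rc_sum; apply: eq_bigr => l _; rewrite /E.
    by case: asboolP => _; rewrite ?mul1r ?mul0r.
  apply: (@hs' _ l.1) => //; first exact: AA'.
  rewrite subrr mulf_neq0//; apply: contra_neq gl => ->; by [].
(* Off the boundary, [phi (l.1 - x) != 0] implies that [x] is in [A] exactly when [l.1] and
   [l.1 - t] are, so cutting off [x] amounts to cutting off [l]. *)
have step1 : `|I - cphi' * S| <= B * fine (mu (van_hove_boundary K A)).
  have -> : cphi' * S = \int[mu]_x (\sum_(l <- s) E l * (phi (l.1 - x) * g l.2)).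
    rewrite bmc_int_sum//; last by move=> l; exact: bmcZ.
    rewrite mulr_sumr; apply: eq_bigr => l _; rewrite bmc_intZ//.
    rewrite mulrCA; congr (_ * _).
    (* Symmetry of [phi] replaces [l.1 - x] by [x - l.1], and translation invariance concludes. *)
    transitivity (\int[mu]_x (g l.2 * phi (x - l.1))).
      have bs := bmc_cc (cc_shift (- l.1) cphi).
      by rewrite (bmc_intZ lcG haar_mu _ bs) (cc_int_shift haar_mu (- l.1) cphi) mulrC.
    by apply: eq_Rintegral => x _; rewrite -symphi opprB mulrC.
  apply: (bmc_close lcG haar_mu _ _ mdA cdA dAs).
  - exact: bAf.
  - by apply: bmc_sum => l; exact: bmcZ.
  - move=> x _; rewrite /q mulr_sumr -sumrB.
    apply: le_trans (qB x); apply: le_trans (ler_norm_sum _ _ _) _.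
    apply: ler_sum => l _; rewrite -mulrBl normrM.
    rewrite [X in _ * X]ger0_norm ?mulr_ge0// ler_piMl ?mulr_ge0// indicE /E.
    by case: (x \in _); case: asboolP => _; rewrite ?subrr ?subr0 ?sub0r ?normrN ?normr1 ?normr0.
  - move=> x nx; rewrite /q mulr_sumr; apply: eq_bigr => l _.
    have [->|/hCs Cl] := eqVneq (phi (l.1 - x)) 0; first by rewrite mul0r !mulr0.
    congr (_ * _); rewrite /E; have [Ax|Ax] := pselect (A x).
      rewrite indicT//; case: asboolP => // /not_andP nA; exfalso; apply: nx.
      case: nA => nA; apply: (boundary_in Ax nA).
        by left; left; left; left.
      by left; left; right; exists (l.1 - x) => //; exists t => //; rewrite addrAC.
    rewrite indicF//; case: asboolP => // -[Al _]; exfalso; apply: nx.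
    apply: (boundary_out Al Ax); left; left; left; right.
    by exists (l.1 - x) => //; rewrite opprB.
(* Invariance moves the translation from [q] to the indicator of [A], which then changes only on the
   boundary. *)
have step2 c : c \in a -> `|\int[mu]_x (\1_(A : set (borel G)) x * q (shiftb (- c) x)) - I| <=
    B * fine (mu (van_hove_boundary K A)).
  move=> ca.
  have mAc : measurable_fun setT (fun x => \1_(A : set (borel G)) (shiftb c x) : R).
    by apply: (measurableT_comp _ (measurable_shift c)); exact: measurable_indic.
  have iBc x : `|\1_(A : set (borel G)) (shiftb c x) : R| <= 1 by exact: iB.
  have -> : \int[mu]_x (\1_(A : set (borel G)) x * q (shiftb (- c) x)) =
      \int[mu]_x (\1_(A : set (borel G)) (shiftb c x) * q x).
    rewrite -(bmc_int_shift haar_mu c); last by apply: bAf; exact: bmc_shift.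
    by apply: eq_Rintegral => x _; rewrite /shiftb addrK.
  apply: (bmc_close lcG haar_mu _ _ mdA cdA dAs).
  - exact: (bmc_mul mAc iBc bq).
  - exact: bAf.
  - move=> x _; rewrite -mulrBl normrM; apply: le_trans (qB x).
    rewrite (ger0_norm (q0 x)) ler_piMl// !indicE.
    by case: (_ \in _); case: (_ \in _); rewrite ?subrr ?subr0 ?sub0r ?normrN ?normr1 ?normr0.
  - move=> x nx; congr (_ * _); rewrite !indicE; congr ((nat_of_bool _)%:R).
    apply/idP/idP; rewrite !inE => h; apply: contrapT => nh; apply: nx.
      apply: (boundary_out h nh); right; exists c => //.
      by rewrite /shiftb opprD addrA subrr add0r.
    apply: (boundary_in h nh); left; right.
    by rewrite /shiftb addrAC subrr add0r.
pose M := (\int[mu]_x phi x * \int[theta]_y g y) / covol.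
have PM : mean P = M%:C%C := mean_rpsum lcG lcH latL haar_mu haar_theta fundF cphi cg phi0 g0.
pose n : R := (size a)%:R; have n0 : 0 < n by rewrite ltr0n lt0n size_eq0.
have bqc c : bmc (fun x => \1_(A : set (borel G)) x * q (shiftb (- c) x)).
  by apply: bAf; exact: bmc_shift.
pose T := n^-1 * \sum_(c <- a) \int[mu]_x (\1_(A : set (borel G)) x * q (shiftb (- c) x)).
have step3 : `|T - M * fine (mu A)| <= e * fine (mu A).
  rewrite /T -(bmc_int_indic mu mA cA (fun _ h => h)).
  rewrite -bmc_int_sum// -!bmc_intZ//; last exact: bmc_sum.
  rewrite [leRHS]bmc_intZ// (bmc_int_indic mu mA cA (fun _ h => h)).
  apply: (bmc_close lcG haar_mu _ _ mA cA (fun _ h => h)).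
  - by apply: bmcZ; exact: bmc_sum.
  - exact: bmcZ.
  - move=> x Ax; rewrite indicT// mulr1.
    have hax := ha (- x, 0); rewrite -/P PM in hax; apply: le_trans hax; apply: le_trans (ler_Re _).
    rewrite le_eqVlt; apply/orP; left; apply/eqP; congr `|_|.
    rewrite raddfB /=; congr (_ - _).
    have -> : (size a)%:R^-1 = n^-1%:C%C :> C by rewrite rcV rmorph_nat.
    have ReZ (c : R) (z : C) : complex.Re (c%:C%C * z) = c * complex.Re z.
      by case: z => ? ? /=; rewrite mul0r subr0.
    rewrite [RHS](_ : _ = n^-1 * complex.Re (\sum_(c <- a) P ((- x, 0) + (c, 0)))); last exact: ReZ.
    congr (_ * _).
    rewrite raddf_sum; apply: eq_big_seq => c ca.
    rewrite mul1r qE; last by exists x => //; exists (- c) => //; right; exists c.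
    rewrite /rpsum /P; congr (complex.Re (psum _ _ _ _)).
    by congr pair; rewrite /= ?addr0 // /shiftb opprB addrC.
  - by move=> x Ax; rewrite indicF// mulr0 big1 ?mulr0// => c _; rewrite mul0r.
have step2' : `|T - I| <= B * fine (mu (van_hove_boundary K A)).
  have -> : T - I = n^-1 * \sum_(c <- a) (\int[mu]_x (\1_(A : set (borel G)) x * q (shiftb (- c) x)) - I).
    by rewrite sumrB sum_seq_cst mulrBr mulKf// gt_eqF.
  have n'0 : 0 <= n^-1 by rewrite invr_ge0 ltW.
  rewrite normrM (ger0_norm n'0) ler_pdivrMl//.
  apply: le_trans (ler_norm_sum _ _ _) _; rewrite -sum_seq_cst.
  by rewrite big_seq [leRHS]big_seq; apply: ler_sum.
rewrite -/P PM SE -!rcM -rcB nm_real.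
have -> : \int[mu]_x phi x * S - M * fine (mu A) =
  - (I - cphi' * S) - (T - I) + (T - M * fine (mu A)) by rewrite /cphi'; ring.
apply: le_trans (ler_normD _ _) _; apply: lerD => //.
apply: le_trans (ler_normB _ _) _; rewrite normrN mulrDl; exact: lerD.
Qed.

End Estimate.
End Density.

Section DensityLimit.
Context (R : realType) (G H : topologicalZmodType).
Local Notation C := R[i].

Lemma cvgC_near (f : nat -> C) (l : C) :
  (forall e : R, 0 < e -> \forall n \near \oo, nm (f n - l) <= e) <-> f @ \oo --> l.
Proof.
split=> [h|/cvgrPdist_le h e e0].
  apply/cvgrPdist_le => e e0.
  have [r r0 ->] : exists2 r : R, 0 < r & e = r%:C%C.
    by move: e0; case: e => r s; rewrite ltcE /= => /andP[/eqP -> r0]; exists r.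
  by apply: filterS (h r r0) => n; rewrite nmE lecR nmBC.
have e0' : 0 < e%:C%C :> C by rewrite ltcR.
by apply: filterS (h _ e0') => n; rewrite nmE lecR nmBC.
Qed.

Lemma cvgCD (f g : nat -> C) (k l : C) : f @ \oo --> k -> g @ \oo --> l ->
  (fun n => f n + g n) @ \oo --> k + l.
Proof.
move=> /cvgC_near hf /cvgC_near hg; apply/cvgC_near => e e0.
have e2 : 0 < e / 2 by rewrite divr_gt0.
apply: filterS2 (hf _ e2) (hg _ e2) => n h1 h2.
have -> : f n + g n - (k + l) = (f n - k) + (g n - l) by ring.
by apply: le_trans (nmD _ _) _; rewrite [e]splitr; exact: lerD.
Qed.

Lemma cvgCZ (c : C) (f : nat -> C) (k : C) : f @ \oo --> k ->
  (fun n => c * f n) @ \oo --> c * k.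
Proof.
move=> /cvgC_near hf; apply/cvgC_near => e e0.
have c0 : 0 < nm c + 1 by rewrite ltr_wpDl ?nm_ge0.
have e' : 0 < e / (nm c + 1) by rewrite divr_gt0.
apply: filterS (hf _ e') => n h.
rewrite -mulrBr nmM; apply: le_trans (_ : (nm c + 1) * (e / (nm c + 1)) <= _).
  by apply: ler_pM; rewrite ?nm_ge0// lerDl.
by rewrite mulrC divfK// gt_eqF.
Qed.

Context (lcG : lcag G) (lcH : lcag H) (L : set (G * H)) (latL : lattice L).
Context (denseL : dense (snd @` L)).

Let hG : hausdorff_space G. Proof. by case: lcG. Qed.
Let hH : hausdorff_space H. Proof. by case: lcH. Qed.

Lemma dsumD (A : set G) t (g k : H -> C) : compact A -> ccC g -> ccC k ->
  dsum L A t (fun y => g y + k y) = dsum L A t g + dsum L A t k.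
Proof.
move=> cA /ccC_supp[K cK hK] /ccC_supp[K' cK' hK'].
have [s [us sL hs]] := lattice_box_seq latL cA (compactU cK cK').
have h (f : H -> C) : (forall y, f y != 0 -> (K `|` K') y) ->
    forall l, L l -> A l.1 -> A (l.1 - t) -> f l.2 != 0 -> l \in s.
  by move=> hf l Ll Al _ /hf; exact: hs.
have hg := h g (fun y gy => or_introl (hK y gy)).
have hk := h k (fun y ky => or_intror (hK' y ky)).
rewrite (dsumE us sL hg) (dsumE us sL hk) (dsumE us sL); last first.
  apply: (h (fun y => g y + k y)) => y.
  have [->|/hK ? _] := eqVneq (g y) 0; last by left.
  by rewrite add0r => /hK'; right.
rewrite -big_split; apply: eq_bigr => l _ /=.
by case: asboolP; rewrite ?addr0.
Qed.

Lemma dsumZ (A : set G) t c (g : H -> C) :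
  dsum L A t (fun y => c * g y) = c * dsum L A t g.
Proof. by rewrite /dsum mulr_fsumr. Qed.

Context (mu : {measure set (borel G) -> \bar R}).
Context (theta : {measure set (borel H) -> \bar R}).
Context (haar_mu : haar mu) (haar_theta : haar theta).
Context (F : set (borel G * borel H)) (fundF : fundamental_domain L F).
Context (D : nat -> set G) (vanHoveD : van_hove mu D).
Local Notation covol := (fine ((mu \x theta)%E F)).

Lemma van_hove_gt0 n : 0 < fine (mu (D n)).
Proof.
have [_ cD D0 _] := vanHoveD; apply: fine_gt0; rewrite D0 /=.
by apply: haar_fin.
Qed.

Lemma density (g : H -> C) t : ccC g ->
  (fun n => ((fine (mu (D n)))^-1)%:C%C * dsum L (D n) t g) @ \oo -->
  cintegral theta setT g / covol%:C%C.
Proof.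
have [_ cD _ vhD] := vanHoveD; have finH := haar_fin haar_theta.
move: g; apply: ccC_ind => [g cg g0|g k cg ck Ig Ik|c g cg Ig].
- have [_ lG _] := lcG.
  have [psi [cpsi psi01 psi1 _]] := @urysohn_cc R _ [set 0] setT hG lG (@compact_set1 _ _) openT (@subsetT _ _).
  have psi0 x : 0 <= psi x by case/andP: (psi01 x).
  pose phi x := psi x + psi (- x).
  have cphi : cc phi by apply: ccD => //; exact: cc_opp.
  have phi0 x : 0 <= phi x by exact: addr_ge0.
  have symphi x : phi (- x) = phi x by rewrite /phi opprK addrC.
  have phi_pos : 0 < phi 0 by rewrite /phi oppr0 psi1//; exact: addr_gt0.
  have phi_neq0 : phi 0 != 0 by rewrite gt_eqF.
  have I0 : 0 < \int[mu]_x phi x := cc_int_gt0 lcG haar_mu cphi phi0 phi_pos.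
  rewrite cint_real; apply/cvgC_near => e e0.
  set cp := \int[mu]_x phi x in I0.
  (* Two errors of at most [e' * m], divided by [cp * m], add up to [e]. *)
  pose e' := e * cp / 2.
  have e'0 : 0 < e' by rewrite divr_gt0// mulr_gt0.
  have [B B0 [K cK hB]] := density_estimate lcG lcH latL denseL haar_mu haar_theta
    fundF cphi cg phi0 g0 symphi phi_neq0 t e'0.
  have B1 : 0 < B + 1 by rewrite ltr_wpDl.
  have /cvgrPdist_le/(_ (e' / (B + 1)) ltac:(by rewrite divr_gt0)) := vhD K cK.
  apply: filterS => n; rewrite sub0r normrN => h.
  have m0 := van_hove_gt0 n; set m := fine (mu (D n)) in h m0 *.
  have {}h : fine (mu (van_hove_boundary K (D n))) <= e' / (B + 1) * m.
    by rewrite -ler_pdivrMr//; apply: le_trans h; exact: ler_norm.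
  have [_ V0] := covol_fin_gt0 lcG lcH latL haar_mu haar_theta fundF.
  have := hB (D n) (cD n); rewrite -/m (mean_rpsum lcG lcH latL haar_mu haar_theta fundF)//.
  set S := dsum _ _ _ _; rewrite -/cp.
  set Ig := \int[theta]_y g y; set V := covol.
  have -> : cp%:C%C * S - (cp * Ig / V)%:C%C * m%:C%C =
      (cp * m)%:C%C * ((m^-1)%:C%C * S - Ig%:C%C / V%:C%C).
    rewrite !rcM !rcV mulrBr; congr (_ - _).
      rewrite -mulrA; congr (_ * _); rewrite mulVKf// .
      by apply/eqP => /(congr1 (@complex.Re R)) /= m1; rewrite m1 ltxx in m0.
    by rewrite -!mulrA; congr (_ * _); rewrite [RHS]mulrC mulrA.
  have cpm : 0 < cp * m by exact: mulr_gt0.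
  rewrite nmM nm_real (ger0_norm (ltW cpm)) => h1.
  have h2 : B * fine (mu (van_hove_boundary K (D n))) <= e' * m.
    apply: le_trans (_ : B * (e' / (B + 1) * m) <= _); first exact: ler_wpM2l.
    have -> : B * (e' / (B + 1) * m) = B / (B + 1) * (e' * m).
      by move: (e') => x; field; rewrite gt_eqF.
    have em : 0 <= e' * m by rewrite mulr_ge0 ?ltW.
    by rewrite (ler_piMl em)// ler_pdivrMr// mul1r lerDl.
  have h3 := le_trans h1 (lerD h2 (lexx _)).
  rewrite -(ler_pM2l cpm); apply: le_trans h3 _.
  rewrite le_eqVlt; apply/orP; left; apply/eqP; rewrite /e'; by field.
- have -> : cintegral theta setT (fun y => g y + k y) / covol%:C%C =
      cintegral theta setT g / covol%:C%C + cintegral theta setT k / covol%:C%C.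
    by rewrite (cintD hH finH cg ck) mulrDl.
  have -> : (fun n => ((fine (mu (D n)))^-1)%:C%C * dsum L (D n) t (fun y => g y + k y)) =
     (fun n => ((fine (mu (D n)))^-1)%:C%C * dsum L (D n) t g +
               ((fine (mu (D n)))^-1)%:C%C * dsum L (D n) t k).
    by apply/funext => n; rewrite (dsumD t (cD n) cg ck) mulrDr.
  exact: (cvgCD Ig Ik).
- have -> : cintegral theta setT (fun y => c * g y) / covol%:C%C =
      c * (cintegral theta setT g / covol%:C%C).
    by rewrite (cintZ hH finH c cg) mulrA.
  have -> : (fun n => ((fine (mu (D n)))^-1)%:C%C * dsum L (D n) t (fun y => c * g y)) =
     (fun n => c * (((fine (mu (D n)))^-1)%:C%C * dsum L (D n) t g)).
    by apply/funext => n; rewrite dsumZ mulrCA.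
  exact: (@cvgCZ (c : C) _ _ Ig).
Qed.

End DensityLimit.

(** * The autocorrelation *)

Section DiscreteMeasure.
Context (R : realType) (X : ptopologicalType) (hX : hausdorff_space X).
Context (c : X -> R) (c0 : forall x, 0 <= c x).

(** The nonnegativity proof is an argument so that the measure structure can be attached to the term
    [dmeas c0]. *)
Definition dmeas (_ : forall x, 0 <= c x) (A : set (borel X)) : \bar R :=
  (\esum_(x in (A : set X)) (c x)%:E)%E.

Let dmeas0 : dmeas c0 set0 = 0%E.
Proof. exact: esum_set0. Qed.

Let dmeas_ge0 A : (0 <= dmeas c0 A)%E.
Proof. by apply: esum_ge0 => x _; rewrite lee_fin. Qed.

Let dmeas_sigma_additive : semi_sigma_additive (dmeas c0).
Proof.
move=> F mF tF mUF.
rewrite [X in _ --> X](_ : _ = \sum_(n <oo) dmeas c0 (F n))%E.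
  by apply/cvg_closeP; split; [exact: is_cvg_nneseries|rewrite closeE].
by rewrite /dmeas nneseries_sum_bigcup// => x; rewrite lee_fin.
Qed.

HB.instance Definition _ := isMeasure.Build _ _ _ (dmeas c0)
  dmeas0 dmeas_ge0 dmeas_sigma_additive.

Definition discrete_measure : {measure set (borel X) -> \bar R} := dmeas c0.

Local Notation m := discrete_measure.

Lemma discrete_measure1 x : m [set x] = (c x)%:E.
Proof. by rewrite /m /= /dmeas esum_set1// lee_fin. Qed.

Lemma measurable_point (x : X) : measurable ([set x] : set (borel X)).
Proof. by apply: borel_compact => //; exact: compact_set1. Qed.

(** [esum] is a supremum over finite sets, and finite sets are compact: inner regularity comes from
    the definition. *)
Lemma discrete_radon : (forall K : set X, compact K -> (m K < +oo)%E) -> radon m.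
Proof.
move=> fin; split => // A mA; apply/eqP; rewrite eq_le; apply/andP; split.
  apply: ge_ereal_sup => _ [Y [fY YA] <-].
  apply: (@le_trans _ _ (m Y)); last first.
    by apply: ereal_sup_ubound; exists Y => //; split => //; exact: finite_compact.
  by rewrite /m /= /dmeas esum_fset// => x _; rewrite lee_fin.
apply: ge_ereal_sup => _ [K [cK KA] <-].
by apply: le_measure; rewrite ?inE//; exact: borel_compact.
Qed.

Import HBNNSimple.

(** The atoms may be uncountably many, so the measure is not treated as a countable sum of Dirac
    masses; the bound is proved for each simple function below [r]. *)
Lemma discrete_integral_le (r : X -> R) : (forall x, 0 <= r x) ->
  (\int[m]_x (r x)%:E <= \esum_(x in [set: X]) (r x * c x)%:E)%E.
Proof.
move=> r0; rewrite ge0_integralTE => [|x]; last by rewrite lee_fin.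
apply: ge_ereal_sup => _ [h /= hr <-].
have fr : finite_set (range h) by exact: fimfunP.
rewrite sintegralE fsbig_finite//=.
set s := finmap.enum_fset _.
apply: (@le_trans _ _ (\sum_(y <- s) \esum_(x in [set: X])
    (if h x == y then h x * c x else 0)%:E)%E).
  apply: lee_sum => y _; rewrite /m /= /dmeas.
  have [y0|y0] := leP y 0.
    apply: (@le_trans _ _ 0%E).
      by apply: mule_le0_ge0; [rewrite lee_fin|apply: esum_ge0 => x _; rewrite lee_fin].
    apply: esum_ge0 => x _; case: ifP => _; rewrite lee_fin// mulr_ge0//.
  rewrite -lee_pdivlMl//; apply: ge_ereal_sup => _ [Y [fY YA] <-].
  rewrite lee_pdivlMl// ge0_mule_fsumr => [|x]; last by rewrite lee_fin.
  apply: esum_ge; exists Y; first by split.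
  rewrite le_eqVlt; apply/orP; left; apply/eqP; apply: eq_fsbigr => x.
  by rewrite inE => /YA /= ->; rewrite eqxx EFinM.
rewrite -esum_sum => [|x y _ _]; last first.
  by case: ifP => _; rewrite lee_fin// mulr_ge0//; exact: fun_ge0.
apply: le_esum => x _; rewrite sumEFin lee_fin -big_mkcond.
apply: (@le_trans _ _ (h x * c x)).
  have hs : h x \in s by rewrite in_fset_set// inE.
  rewrite (eq_bigl (pred1 (h x))) => [|y]; last by rewrite /= eq_sym.
  by rewrite -big_filter filter_pred1_uniq ?big_seq1//; exact: finmap.fset_uniq.
by rewrite ler_wpM2r// -lee_fin; exact: hr.
Qed.

Lemma discrete_integral (r : borel X -> R) : measurable_fun setT r ->
  (forall x, 0 <= r x) ->
  (\int[m]_x (r x)%:E = \esum_(x in [set: X]) (r x * c x)%:E)%E.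
Proof.
move=> mr r0; apply/eqP; rewrite eq_le discrete_integral_le//=.
apply: ge_ereal_sup => _ [Y [fY _] <-].
rewrite fsbig_finite//=; set s := finmap.enum_fset _.
have us : uniq s by exact: finmap.fset_uniq.
have I x : (\int[m]_y (r x * \1_[set x] y)%:E = (r x * c x)%:E)%E.
  have mx := measurable_point x.
  under eq_integral do rewrite EFinM.
  rewrite ge0_integralZl ?lee_fin//; last by apply/measurable_EFinP; exact: measurable_indic.
  by rewrite integral_indic// setIT EFinM discrete_measure1.
have mI x : measurable_fun setT (fun y : borel X => (r x * \1_[set x] y)%:E).
  apply/measurable_EFinP; apply: measurable_funM => //.
  by apply: measurable_indic; exact: measurable_point.
rewrite (eq_bigr _ (fun x _ => esym (I x))) -ge0_integral_sum//; last first.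
  by move=> x y _; rewrite lee_fin mulr_ge0.
apply: ge0_le_integral => //.
- by move=> y _; apply: sume_ge0 => x _; rewrite lee_fin mulr_ge0.
- by apply: emeasurable_sum => x _; exact: mI.
- by apply/measurable_EFinP.
move=> y _; rewrite sumEFin lee_fin.
rewrite (eq_bigr (fun x => if y == x then r y else 0)) => [|x _]; last first.
  rewrite indicE; have [->|/eqP yx] := eqVneq y x; first by rewrite mem_set// mulr1.
  by rewrite memNset// mulr0.
rewrite -big_mkcond; case: (boolP (y \in s)) => ys.
  rewrite (eq_bigl (pred1 y)) => [|x]; last by rewrite /= eq_sym.
  by rewrite -big_filter filter_pred1_uniq ?big_seq1.
rewrite big_seq_cond big1// => x /andP[xs /eqP yx].
by rewrite yx xs in ys.
Qed.

Lemma discrete_Rintegral (r : borel X -> R) (s : seq X) : measurable_fun setT r ->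
  uniq s -> (forall x, r x * c x != 0 -> x \in s) ->
  \int[m]_x r x = \sum_(x <- s) r x * c x.
Proof.
move=> mr us hs.
have E (q : borel X -> R) : measurable_fun setT q -> (forall x, 0 <= q x) ->
    (forall x, q x != 0 -> r x != 0) ->
    (\int[m]_x (q x)%:E = (\sum_(x <- s) q x * c x)%:E)%E.
  move=> mq q0 qr; rewrite discrete_integral//; apply: esum_finite_support => //.
    by move=> x _; rewrite mulr_ge0.
  move=> x _; rewrite mulf_eq0 negb_or => /andP[/qr rx cx].
  by apply: hs; rewrite mulf_neq0.
pose p x := Num.max (r x) 0; pose n x := Num.max (- r x) 0.
rewrite /Rintegral integralE.
rewrite (eq_integral (fun x => (p x)%:E)); last by move=> x _; rewrite funeposE /p EFin_max.
rewrite [X in (_ - X)%E](eq_integral (fun x => (n x)%:E)); last first.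
  by move=> x _; rewrite funenegE /n EFin_max.
rewrite !E /=.
- rewrite -sumrB; apply: eq_bigr => x _; rewrite -mulrBl; congr (_ * _).
  rewrite /p /n; case: (lerP (r x) 0) => h; last by rewrite max_r ?subr0// oppr_le0 ltW.
  by rewrite max_l ?oppr_ge0// sub0r opprK.
- by apply: measurable_maxr => //; exact: measurableT_comp.
- by move=> x; rewrite le_max lexx orbT.
- by move=> x; apply: contra_neq => rx; rewrite /n rx oppr0 maxxx.
- exact: measurable_maxr.
- by move=> x; rewrite le_max lexx orbT.
- by move=> x; apply: contra_neq => rx; rewrite /p rx maxxx.
Qed.

(** Points are closed, so countable sets are Borel; this covers functions such as the phase below,
    which are constant off the projected lattice. *)
Lemma measurable_cst_off (f : borel X -> R) (k : R) :
  countable [set x | f x != k] -> measurable_fun setT f.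
Proof.
move=> cf _ Y mY; rewrite setTI.
have mcount (A : set (borel X)) : A `<=` [set x | f x != k] -> measurable A.
  move=> Af; apply: countable_measurable; first exact: measurable_point.
  by apply: sub_countable cf; exact: subset_card_le.
have -> : f @^-1` Y = ([set x | f x != k] `&` f @^-1` Y) `|`
    (if k \in Y then ~` [set x | f x != k] else set0).
  apply/seteqP; split => [x Yx|x [[_ //]|]].
    have [fx|fx] := eqVneq (f x) k; last by left.
    by right; rewrite mem_set -?fx//= fx => /eqP.
  by case: ifPn => // /set_mem Yk /negP; rewrite negbK => /eqP; rewrite /preimage /= => ->.
apply: measurableU; first by apply: mcount => x [].
by case: ifP => _ //; apply: measurableC; exact: mcount.
Qed.

End DiscreteMeasure.

Lemma fsum_seqE (T : choiceType) (V : nmodType) (A : set T) (f : T -> V) (s : seq T) :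
  uniq s -> (forall i, i \in s -> A i) -> (forall i, A i -> f i != 0 -> i \in s) ->
  \sum_(i \in A) f i = \sum_(i <- s) f i.
Proof.
move=> us sA hs; rewrite (fsbigE s _ us) => [|i /sA//|i Ai ni].
  by rewrite big_seq_cond [RHS]big_seq_cond; apply: eq_bigl => i; case: (boolP (i \in s)) => //= /sA Ai; rewrite mem_set.
by apply/eqP; apply: contraNT ni; exact: hs.
Qed.

Lemma cint_discrete (R : realType) (X : ptopologicalType) (hX : hausdorff_space X)
    (c : X -> R) (c0 : forall x, 0 <= c x) (k : borel X -> R[i]) (s : seq X) :
  measurable_fun setT (fun x => complex.Re (k x)) ->
  measurable_fun setT (fun x => complex.Im (k x)) ->
  uniq s -> (forall x, k x * (c x)%:C%C != 0 -> x \in s) ->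
  cintegral (discrete_measure c0) setT k = \sum_(x <- s) k x * (c x)%:C%C.
Proof.
move=> mr mi us hs; rewrite /cintegral.
have h x : complex.Re (k x) * c x != 0 \/ complex.Im (k x) * c x != 0 -> x \in s.
  move=> kc; apply: hs; apply/eqP => e; move: kc; move: e.
  case: (k x) => p q [] /=; rewrite !mulr0 subr0 add0r => -> ->.
  by rewrite eqxx => -[].
rewrite (discrete_Rintegral hX c0 mr us); last by move=> x ?; apply: h; left.
rewrite (discrete_Rintegral hX c0 mi us); last by move=> x ?; apply: h; right.
elim: s {us hs h} => [|x s IH]; first by rewrite !big_nil.
rewrite !big_cons -IH; case: (k x) => p q.
by apply/eqP; rewrite eq_complex /= !mulr0 subr0 add0r !eqxx.
Qed.

Lemma measurable_mulC (R : realType) d (X : measurableType d) (f k : X -> R[i]) :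
  measurable_fun setT (fun x => complex.Re (f x)) ->
  measurable_fun setT (fun x => complex.Im (f x)) ->
  measurable_fun setT (fun x => complex.Re (k x)) ->
  measurable_fun setT (fun x => complex.Im (k x)) ->
  measurable_fun setT (fun x => complex.Re (f x * k x)) /\
  measurable_fun setT (fun x => complex.Im (f x * k x)).
Proof.
move=> fr fi kr ki; split.
  under eq_fun do rewrite cReM; apply: measurable_funD; first exact: measurable_funM.
  by apply: measurable_funM => //; exact: measurable_funM.
by under eq_fun do rewrite cImM; apply: measurable_funD; exact: measurable_funM.
Qed.

Section Autocorrelation.
Context (R : realType) (G H : topologicalZmodType).
Local Notation C := R[i].
Context (lcG : lcag G) (lcH : lcag H) (L : set (G * H)).
Context (cpL : cut_and_project L).

Let hG : hausdorff_space G. Proof. by case: lcG. Qed.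
Let hH : hausdorff_space H. Proof. by case: lcH. Qed.
Let latL : lattice L. Proof. by case: cpL. Qed.
Let injL : set_inj L fst. Proof. by case: cpL. Qed.
Let denseL : dense (snd @` L). Proof. by case: cpL. Qed.

Lemma starE l : L l -> star L l.1 = l.2.
Proof.
move=> Ll; rewrite /star; case: xgetP => [y _ Ly|/(_ l.2)]; last first.
  by case; rewrite /=; case: l Ll.
have := injL (mem_set Ly) (mem_set Ll) erefl.
by case: l Ll Ly => l1 l2 _ _ [].
Qed.

Context (mu : {measure set (borel G) -> \bar R}).
Context (theta : {measure set (borel H) -> \bar R}).
Context (haar_mu : haar mu) (haar_theta : haar theta).
Context (F : set (borel G * borel H)) (fundF : fundamental_domain L F).
Context (D : nat -> set G) (vanHoveD : van_hove mu D).
Local Notation covol := (fine ((mu \x theta)%E F)).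
Context (W : set H) (b : H -> C) (cb : ccC b) (bW : forall y, b y != 0 -> W y).

Local Notation S := (model_set L W).
Local Notation w := (fun s => b (star L s)).

Definition bprod (v y : H) : C := b y * (b (y - v))^*.

Lemma ccC_bprod v : ccC (bprod v).
Proof.
have -> : bprod v = (fun y => (b (y - v))^* * b y) by apply/funext => y; rewrite mulrC.
by apply: ccC_mul => //; apply: ccC_cont; apply: ccC_conj; exact: ccC_shift.
Qed.

Definition acor (v : H) : C := cintegral theta setT (bprod v).

Definition acor_coef (x : G) : C :=
  if `[< (fst @` L) x >] then acor (star L x) / covol%:C%C else 0.

Lemma acor_coefE t : L t -> acor_coef t.1 = acor t.2 / covol%:C%C.
Proof.
move=> Lt; by rewrite /acor_coef starE// asboolT//; exists t.
Qed.

Context (Kb : set H) (cKb : compact Kb) (hKb : forall y, b y != 0 -> Kb y).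

Lemma acor_supp v : acor v != 0 -> mdiff Kb Kb v.
Proof.
move=> av; apply: contrapT => nv; move/eqP: av; apply.
have b0 : bprod v = (fun _ => 0%:C%C).
  apply/funext => y; apply/eqP; apply/negPn/negP; rewrite /bprod mulf_eq0 negb_or.
  rewrite conjC_eq0 => /andP[/hKb by1 /hKb by2]; apply: nv.
  by exists y => //; exists (y - v) => //; rewrite subKr.
by rewrite /acor b0 cint_real Rintegral_cst// mul0r.
Qed.

Lemma comb_sum (A : set G) (f : G -> C) (s : seq (G * H)) : uniq s ->
  (forall l, l \in s -> L l) -> (forall l, L l -> A l.1 -> Kb l.2 -> l \in s) ->
  restricted_comb S w A f = \sum_(l <- s) if `[< A l.1 >] then b l.2 * f l.1 else 0.
Proof.
move=> us sL hs; rewrite /restricted_comb.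
rewrite (fsum_seqE (s := [seq l.1 | l <- s & `[< A l.1 >] && (b l.2 != 0)])).
- rewrite big_map big_filter big_mkcond; rewrite big_seq [RHS]big_seq.
  apply: eq_bigr => l /sL Ll; rewrite starE//.
  case: ifPn => [/andP[-> //]|]; rewrite negb_and negbK.
  by case: (`[< A l.1 >]) => //= /eqP ->; rewrite mul0r.
- rewrite map_inj_in_uniq ?filter_uniq// => x y; rewrite !mem_filter.
  by move=> /andP[_ /sL Lx] /andP[_ /sL Ly]; apply: injL; exact: mem_set.
- move=> x /mapP[l]; rewrite mem_filter => /andP[/andP[/asboolP Al bl] /sL Ll] ->.
  by split => //; split; [exists l|rewrite starE//; exact: bW].
- move=> x [[[l Ll <-] _] Al]; rewrite starE// mulf_eq0 negb_or => /andP[bl _].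
  apply/mapP; exists l => //; rewrite mem_filter bl andbT; apply/andP; split.
    exact/asboolP.
  by apply: hs => //; exact: hKb.
Qed.

(** The sum over pairs [l], [l'] is regrouped by the difference [t = l - l']; for fixed [t] the
    admissible [l] are those counted by [dsum]. *)
Lemma autocorrelation_sum (A : set G) (f : G -> C) (T : seq (G * H)) : compact A ->
  uniq T -> (forall t, t \in T -> L t) ->
  (forall t, L t -> f t.1 != 0 -> mdiff Kb Kb t.2 -> t \in T) ->
  measure_convolution (restricted_comb S w A) (measure_tilde (restricted_comb S w A)) f =
  \sum_(t <- T) f t.1 * dsum L A t.1 (bprod t.2).
Proof.
move=> cA uT TL hT.
have [s [us sL hs]] := lattice_box_seq latL cA cKb.
rewrite /measure_convolution (comb_sum _ us sL hs).
under [RHS]eq_bigr => t _.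
  rewrite (dsumE (g := bprod t.2) us sL); last first.
    by move=> l Ll Al _; rewrite /bprod mulf_eq0 negb_or => /andP[/hKb bl _]; exact: hs.
  rewrite mulr_sumr; over.
rewrite exchange_big /= big_seq [RHS]big_seq; apply: eq_bigr => l /sL Ll.
have [Al|nAl] := pselect (A l.1); last first.
  rewrite (asboolF nAl) big1// => t _.
  by rewrite asboolF ?mulr0// => -[].
rewrite (asboolT Al).
have [bl|bl] := eqVneq (b l.2) 0.
  rewrite bl mul0r big1// => t _; case: asboolP; rewrite /bprod ?bl ?mul0r mulr0//.
pose E l' : C := if `[< A l'.1 >] then (b l'.2)^* * f (l.1 - l'.1) else 0.
have -> : measure_tilde (restricted_comb S w A) (fun y => f (l.1 + y)) =
    \sum_(l' \in L) E l'.
  rewrite (fsum_seqE (s := s))//; last first.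
    move=> l' Ll'; rewrite /E; case: asboolP => [Al'|]; last by rewrite eqxx.
    by rewrite mulf_eq0 negb_or conjC_eq0 => /andP[/hKb bl' _]; exact: hs.
  rewrite /measure_tilde (comb_sum _ us sL hs) rmorph_sum; apply: eq_bigr => l' _.
  by rewrite /E; case: asboolP => _ /=; rewrite ?conjC0// -[RHS]cjK [in RHS]cjM cjK.
rewrite (reindex_fsbig (fun t => l - t) L); last first.
  split; first by move=> t Lt; exact: latticeB.
    by move=> x y _ _ /addrI /oppr_inj.
  by move=> t Lt; exists (l - t); [exact: latticeB|rewrite subKr].
rewrite (fsum_seqE (s := T))//; last first.
  move=> t Lt; rewrite /E; case: asboolP => [At|]; last by rewrite eqxx.
  rewrite mulf_eq0 negb_or conjC_eq0 /= subKr => /andP[/hKb bt ft].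
  by apply: hT => //; exists l.2; [exact: hKb|exists (l.2 - t.2) => //; rewrite subKr].
rewrite mulr_sumr; apply: eq_bigr => t _; rewrite /E /=.
have [At|nAt] := pselect (A (l.1 - t.1)).
  by rewrite !asboolT//= subKr /bprod; ring.
by rewrite !asboolF ?mulr0//; case.
Qed.

Lemma autocorrelation_seq (K : set G) : compact K -> exists T : seq (G * H),
  [/\ uniq T, forall t, t \in T -> L t &
      forall t, L t -> K t.1 -> mdiff Kb Kb t.2 -> t \in T].
Proof. by move=> cK; apply: lattice_box_seq => //; exact: compactB. Qed.

Lemma autocorrelation_cvg (f : G -> C) (T : seq (G * H)) : 
  uniq T -> (forall t, t \in T -> L t) ->
  (forall t, L t -> f t.1 != 0 -> mdiff Kb Kb t.2 -> t \in T) ->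
  (fun n => ((fine (mu (D n)))^-1)%:C%C *
       measure_convolution (restricted_comb S w (D n))
         (measure_tilde (restricted_comb S w (D n))) f)
      @ \oo --> \sum_(t <- T) f t.1 * acor_coef t.1.
Proof.
move=> uT TL hT; have [_ cD _ _] := vanHoveD.
have -> : (fun n => ((fine (mu (D n)))^-1)%:C%C *
       measure_convolution (restricted_comb S w (D n))
         (measure_tilde (restricted_comb S w (D n))) f) =
   (fun n => \sum_(t <- T) f t.1 * (((fine (mu (D n)))^-1)%:C%C * dsum L (D n) t.1 (bprod t.2))).
  apply/funext => n; rewrite (autocorrelation_sum (cD n) uT TL hT) mulr_sumr.
  by apply: eq_bigr => t _; rewrite mulrCA.
elim: T TL {uT hT} => [|t T IH] TL.
  by rewrite big_nil; under eq_fun do rewrite big_nil; exact: cvg_cst.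
rewrite big_cons; under eq_fun do rewrite big_cons.
apply: cvgCD; last by apply: IH => t' t'T; apply: TL; rewrite inE t'T orbT.
rewrite acor_coefE; last by apply: TL; rewrite inE eqxx.
apply: (@cvgCZ _ (f t.1 : C)).
exact: (density lcG lcH latL denseL haar_mu haar_theta fundF vanHoveD t.1 (ccC_bprod t.2)).
Qed.

(** The unimodular factor of the polar decomposition; the value 1 at a zero coefficient keeps it
    unimodular everywhere. *)
Definition acor_coef_phase (x : G) : C :=
  if acor_coef x == 0 then 1 else acor_coef x / (nm (acor_coef x))%:C%C.

Lemma acor_coef_phaseE x : acor_coef_phase x * (nm (acor_coef x))%:C%C = acor_coef x.
Proof.
rewrite /acor_coef_phase; case: eqVneq => [->|e0]; first by rewrite nm0 mulr0.
rewrite divfK//; apply/eqP => /(congr1 (@complex.Re R)) /= /eqP.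
by rewrite nm_eq0; apply/negP.
Qed.

Lemma countable_acor_coef : countable [set x | acor_coef x != 0].
Proof.
apply: (@sub_countable _ _ _ (fst @` L)); last first.
  by apply: sub_countable (lattice_countable lcG lcH latL); exact: card_image_le.
apply: subset_card_le => x /=; rewrite /acor_coef; case: asboolP => //.
by rewrite eqxx.
Qed.

Lemma measurable_acor_coef_phase :
  measurable_fun setT (fun x : borel G => complex.Re (acor_coef_phase x)) /\
  measurable_fun setT (fun x : borel G => complex.Im (acor_coef_phase x)).
Proof.
split; [apply: (@measurable_cst_off _ _ hG _ 1)|apply: (@measurable_cst_off _ _ hG _ 0)];
  apply: sub_countable countable_acor_coef; apply: subset_card_le => x /=;
  by apply: contra_neq => ex; rewrite /acor_coef_phase ex eqxx.
Qed.

Lemma norm_acor_coef_phase x : `|acor_coef_phase x| = 1.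
Proof.
rewrite nmE /acor_coef_phase; case: eqVneq => [_|e0]; first by rewrite nm1.
by rewrite nmM nmV nm_real (ger0_norm (nm_ge0 _)) divff// nm_eq0.
Qed.

Let nm_acor_coef_ge0 x : 0 <= nm (acor_coef x). Proof. exact: nm_ge0. Qed.

(** A coefficient is nonzero only when the second coordinate lies in the compact set [mdiff Kb Kb],
    so a compact set contains finitely many atoms. *)
Lemma acor_coef_radon : radon (discrete_measure nm_acor_coef_ge0).
Proof.
apply: discrete_radon => // K cK.
have [T [uT TL hT]] := autocorrelation_seq cK.
pose s := [seq t.1 | t <- T & `[< K t.1 >]].
rewrite /discrete_measure /= /dmeas (esum_finite_support (s := s)) ?ltey//.
- rewrite map_inj_in_uniq ?filter_uniq// => x y; rewrite !mem_filter.
  by move=> /andP[_ /TL Lx] /andP[_ /TL Ly]; apply: injL; exact: mem_set.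
- by move=> x /mapP[t]; rewrite mem_filter => /andP[/asboolP Kt _] ->.
- move=> x Kx; rewrite nm_eq0 => ex.
  have [t Lt tx] : (fst @` L) x by move: ex; rewrite /acor_coef; case: asboolP => //; rewrite eqxx.
  rewrite -tx in Kx ex *; apply/mapP; exists t => //; rewrite mem_filter; apply/andP; split.
    exact/asboolP.
  apply: hT => //; apply: acor_supp; move: ex; rewrite acor_coefE//.
  by apply: contra_neq => ->; rewrite mul0r.
Qed.

Definition gamma : cmeasure R G := CMeasure acor_coef_radon measurable_acor_coef_phase norm_acor_coef_phase.

Lemma cmintegral_gamma (f : G -> C) (T : seq (G * H)) : contC f ->
  uniq T -> (forall t, t \in T -> L t) ->
  (forall t, L t -> f t.1 != 0 -> mdiff Kb Kb t.2 -> t \in T) ->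
  cmintegral gamma f = \sum_(t <- T) f t.1 * acor_coef t.1.
Proof.
move=> [cr ci] uT TL hT; rewrite /cmintegral /=.
have [mr mi] := measurable_acor_coef_phase.
have mfr : measurable_fun setT (fun x : borel G => complex.Re (f x)) by exact: continuous_borel.
have mfi : measurable_fun setT (fun x : borel G => complex.Im (f x)) by exact: continuous_borel.
rewrite (cint_discrete hG nm_acor_coef_ge0 (s := [seq t.1 | t <- T])).
- rewrite big_map; apply: eq_bigr => t _; rewrite -mulrA; congr (_ * _).
  exact: acor_coef_phaseE.
- exact: (measurable_mulC mfr mfi mr mi).1.
- exact: (measurable_mulC mfr mfi mr mi).2.
- rewrite map_inj_in_uniq// => x y /TL Lx /TL Ly.
  by apply: injL; exact: mem_set.
- move=> x; rewrite -mulrA acor_coef_phaseE mulf_eq0 negb_or => /andP[fx ex].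
  have [t Lt tx] : (fst @` L) x by move: ex; rewrite /acor_coef; case: asboolP => //; rewrite eqxx.
  rewrite -tx in fx ex *; apply/mapP; exists t => //.
  apply: hT => //; apply: acor_supp; move: ex; rewrite acor_coefE//.
  by apply: contra_neq => ->; rewrite mul0r.
Qed.

Lemma gamma_autocorrelation : is_autocorrelation mu D S w gamma.
Proof.
move=> f /(ccCP f hG) cf; have [K cK hK] := ccC_supp cf.
have [T [uT TL hT]] := autocorrelation_seq cK.
have hT' t : L t -> f t.1 != 0 -> mdiff Kb Kb t.2 -> t \in T.
  by move=> Lt /hK Kt; exact: hT.
rewrite (cmintegral_gamma (ccC_cont cf) uT TL hT').
exact: autocorrelation_cvg uT TL hT'.
Qed.

End Autocorrelation.

Lemma nm_dist (R : realType) (a b : R[i]) : `|nm a - nm b| <= nm (a - b).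
Proof.
have h (x y : R[i]) : nm x - nm y <= nm (x - y).
  by have := nm_triangle y x 0; rewrite !subr0 lerBlDr.
by rewrite ler_norml h andbT lerNl opprB nmBC h.
Qed.

(** * Fourier transforms and the diffraction measure *)

Section DualGroup.
Context (R : realType) (G : topologicalZmodType) (lcG : lcag G).
Local Notation C := R[i].
Local Notation dual := (character R G).
Implicit Types chi : dual.

Let hG : hausdorff_space G. Proof. by case: lcG. Qed.
Let lG : locally_compact [set: G]. Proof. by case: lcG. Qed.

(** A superlevel set of a Urysohn function: closed inside a compact set, and still a
    neighbourhood. *)
Lemma compact_nbhs_in (x : G) (U : set G) : nbhs x U ->
  exists2 N, nbhs x N & compact N /\ N `<=` U.
Proof.
move=> xU; have [|f [[cf [K cK hK]] f01 f1 fU]] :=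
    @urysohn_cc R _ [set x] (interior U) hG lG (@compact_set1 _ x) (@open_interior _ U).
  by move=> _ ->; exact: nbhs_singleton (nbhs_interior xU).
pose N := f @^-1` `[2^-1, +oo[%classic.
have N0 y : N y -> f y != 0.
  by rewrite /N /= in_itv /= andbT => h; rewrite gt_eqF// (lt_le_trans _ h).
exists N; last split.
- apply: (@filterS _ _ _ (f @^-1` `]2^-1, +oo[%classic)).
    by move=> y; rewrite /N /preimage /= !in_itv /= !andbT => /ltW.
  apply: open_nbhs_nbhs; split.
    by move/continuousP: cf; apply; exact: interval_open.
  by rewrite /preimage /= in_itv /= andbT f1// invf_lt1// ltr1n.
- apply: (subclosed_compact _ cK) => [|y /N0/hK//].
  by move/continuous_closedP: cf; apply; exact: interval_closed.
- by move=> y /N0/fU /interior_subset.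
Qed.

Lemma dual_open (K : set G) (O : set C) : compact K -> open O ->
  open [set chi : dual | forall x, K x -> O (chi x)].
Proof.
move=> cK oO.
have -> : [set chi : dual | forall x, K x -> O (chi x)] =
    (@char_fun R G) @^-1` [set g : {compact-open, G -> C} | g @` K `<=` O].
  apply/seteqP; split => [chi h _ [x Kx <-]|chi h x Kx]; first exact: h.
  by apply: h; exists x.
have /continuousP := @initial_continuous dual {compact-open, G -> C} (@char_fun R G).
by apply; exact: compact_open_open.
Qed.

Lemma nbhs_nm_ball (a : C) (e : R) : 0 < e -> nbhs a [set z | nm (z - a) <= e].
Proof.
move=> e0; have [cid _] := (contCP (fun z : C => z)).1 (fun x => @cvg_id _ _).
have /cvgrPdist_le : (fun z : C => z) @ a --> a by exact: cvg_id.
move=> /(_ e%:C%C); rewrite ltcR => /(_ e0); apply: filterS => z.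
by rewrite nmE lecR nmBC.
Qed.

(** Passage from the compact-open topology to uniform closeness on compact sets: near [x], [chi0]
    maps a compact neighbourhood into a small ball, an open condition on characters. *)
Lemma dual_nbhs (K : set G) chi0 (e : R) : compact K -> 0 < e ->
  nbhs chi0 [set chi | forall x, K x -> nm (chi x - chi0 x) <= e].
Proof.
move=> cK e0.
apply: (@compact_ind _ (fun A => nbhs chi0 [set chi : dual |
  forall x, A x -> nm (chi x - chi0 x) <= e]) K) => //.
- by apply: filterE => chi x.
- move=> A B hA hB; apply: filterS2 hA hB => chi hA hB x [/hA|/hB] //.
- by move=> A B AB; apply: filterS => chi h x /AB; exact: h.
move=> x _; have e2 : 0 < e / 2 by rewrite divr_gt0.
pose O := interior [set z : C | nm (z - chi0 x) <= e / 2].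
have Ox : O (chi0 x) by exact: nbhs_singleton (nbhs_interior (nbhs_nm_ball _ e2)).
have [|N xN [cN NO]] := @compact_nbhs_in x (chi0 @^-1` O).
  apply: open_nbhs_nbhs; split => //.
  by have /continuousP := @char_continuous _ _ chi0; apply; exact: open_interior.
exists N => //; apply: (@filterS _ _ _ [set chi : dual | forall y, N y -> O (chi y)]).
  move=> chi h y Ny; have /= h1 := interior_subset (h y Ny).
  have /= h2 := interior_subset (NO y Ny).
  apply: le_trans (nm_triangle (chi0 x) _ _) _; rewrite [e]splitr; apply: lerD => //.
  by rewrite nmBC.
by apply: open_nbhs_nbhs; split; [exact: dual_open (open_interior _)|exact: NO].
Qed.

Lemma dual_hausdorff : hausdorff_space dual.
Proof.
move=> chi chi' cl; apply: characterP => x; apply: nm_le0_eq => e e0.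
have e2 : 0 < e / 2 by rewrite divr_gt0.
have cx := @compact_set1 _ x.
have [xi [/(_ x erefl) h1 /(_ x erefl) h2]] := cl _ _ (dual_nbhs chi cx e2) (dual_nbhs chi' cx e2).
apply: le_trans (nm_triangle (xi x) _ _) _; rewrite [e]splitr.
by apply: lerD => //; rewrite nmBC.
Qed.

Lemma nm_character chi x : nm (chi x) = 1.
Proof. by have := norm_char chi x; rewrite nmE => /(congr1 (@complex.Re R)). Qed.

Lemma char_at0 chi : chi 0 = 1.
Proof.
have := charD chi 0 0; rewrite addr0 => /esym/eqP.
rewrite -[X in _ == X]mulr1 => /eqP/mulfI; apply.
by rewrite -nm_gt0 nm_character.
Qed.

Lemma contC_char chi : contC chi.
Proof. by apply/contCP; exact: char_continuous. Qed.

(** Near [chi0], characters are uniformly close to it on a compact neighbourhood of 0, where [chi0]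
    is itself close to 1. *)
Lemma dual_equicontinuous (K : set dual) (e : R) : compact K -> 0 < e ->
  exists2 V, nbhs (0 : G) V & forall chi x, K chi -> V x -> nm (chi x - 1) <= e.
Proof.
move=> cK e0.
apply: (@compact_ind _ (fun A => exists2 V, nbhs (0 : G) V &
  forall chi x, A chi -> V x -> nm (chi x - 1) <= e) K) => //.
- by exists setT; [exact: filterT|].
- move=> A B [V V0 hV] [V' V'0 hV']; exists (V `&` V'); first exact: filterI.
  by move=> chi x [Ac|Bc] [Vx V'x]; [exact: hV|exact: hV'].
- by move=> A B AB [V V0 hV]; exists V => // chi x /AB; exact: hV.
move=> chi0 _; have e2 : 0 < e / 2 by rewrite divr_gt0.
have [N N0 [cN hN]] : exists2 N, nbhs (0 : G) N & compact N /\
    N `<=` [set x | nm (chi0 x - 1) <= e / 2].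
  apply: compact_nbhs_in.
  have c0 : chi0 @ (0 : G) --> chi0 0 by exact: char_continuous.
  have h := c0 _ (nbhs_nm_ball (chi0 0) e2); rewrite char_at0 in h; exact: h.
exists [set chi : dual | forall x, N x -> nm (chi x - chi0 x) <= e / 2].
  exact: dual_nbhs.
exists N => // chi x h Nx; apply: le_trans (nm_triangle (chi0 x) _ _) _.
by rewrite [e]splitr; apply: lerD; [exact: h|exact: hN].
Qed.

Context (mu : {measure set (borel G) -> \bar R}) (haar_mu : haar mu).

Let finG := haar_fin haar_mu.

(** The transform without conjugation, that is [fourier] at [- chi], the form in which it enters
    [transforms_to]. *)
Definition ft (phi : G -> C) chi : C := cintegral mu setT (fun x => phi x * chi x).

Lemma fourierN phi chi : fourier mu phi (- chi) = ft phi chi.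
Proof.
rewrite /fourier /ft; congr (cintegral mu setT _); apply/funext => x /=.
by rewrite conjCK.
Qed.

Lemma ccC_char phi chi : ccC phi -> ccC (fun x => phi x * chi x).
Proof.
move=> cphi; under eq_fun do rewrite mulrC.
by apply: ccC_mul => //; exact: contC_char.
Qed.

Definition absC (phi : G -> C) (x : G) : R :=
  `|complex.Re (phi x)| + `|complex.Im (phi x)|.

Lemma cc_absC phi : ccC phi -> cc (absC phi).
Proof. by move=> [cr ci]; apply: ccD; exact: cc_abs. Qed.

Lemma cintB (f g : G -> C) : ccC f -> ccC g ->
  cintegral mu setT (fun x => f x - g x) = cintegral mu setT f - cintegral mu setT g.
Proof.
move=> cf cg; have := cintD hG finG cf (ccCZ (-1) cg).
rewrite (cintZ hG finG (-1) cg) mulN1r => <-; congr (cintegral mu setT _).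
by apply/funext => x; rewrite mulN1r.
Qed.

Lemma ft_lip phi chi chi' (K : set G) (e : R) : ccC phi ->
  (forall x, phi x != 0 -> K x) -> (forall x, K x -> nm (chi x - chi' x) <= e) ->
  nm (ft phi chi - ft phi chi') <= 2 * e * \int[mu]_x absC phi x.
Proof.
move=> cphi hK he; have ca := cc_absC cphi.
rewrite /ft -cintB; [|exact: ccC_char..].
rewrite -mulrA -(cc_intZ hG finG e ca); apply: nm_cint_le => //.
- have := ccCD (ccC_char chi cphi) (ccCZ (-1) (ccC_char chi' cphi)); congr ccC.
  by apply/funext => x; rewrite mulN1r.
- exact: ccZ.
- move=> x; rewrite -mulrBr nmM; have [px|px] := eqVneq (phi x) 0.
    by rewrite px nm0 mul0r /absC px /= normr0 addr0 mulr0.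
  rewrite mulrC; apply: ler_pM; rewrite ?nm_ge0//; last exact: nm_ReIm.
  exact: he (hK _ px).
Qed.

Lemma ft_continuous phi : ccC phi -> continuous (fun chi : dual => nm (ft phi chi) ^+ 2 : R).
Proof.
move=> cphi; have cont : continuous (fun chi : dual => nm (ft phi chi) : R).
  move=> chi0; apply/(@cvgrPdist_le _ _ _ (nbhs chi0) (@nbhs_filter dual chi0)) => e e0.
  have [K cK hK] := ccC_supp cphi.
  pose I := \int[mu]_x absC phi x.
  have I0 : 0 <= I.
    by apply: Rintegral_ge0 => x _; rewrite addr_ge0.
  have I1 : 0 < 2 * (I + 1) by rewrite mulr_gt0// ltr_wpDl.
  have d0 : 0 < e / (2 * (I + 1)) by rewrite divr_gt0.
  apply: filterS (dual_nbhs chi0 cK d0) => chi h.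
  have := ft_lip cphi hK h.
  have le1 : 2 * (e / (2 * (I + 1))) * I <= e.
    rewrite [leLHS](_ : _ = e * (I / (I + 1))); last by field; rewrite gt_eqF// ltr_wpDl.
    by rewrite ler_piMr ?(ltW e0)// ler_pdivrMr ?ltr_wpDl// mul1r lerDl.
  move=> /le_trans/(_ le1); apply: le_trans.
  by rewrite distrC; exact: nm_dist.
move=> chi0; under eq_fun do rewrite expr2.
exact: (@cvgM _ _ (nbhs chi0) (@nbhs_filter dual chi0) _ _ _ _ (cont chi0) (cont chi0)).
Qed.

(** A bump of integral 1 supported where all characters of [K] are within [e / 2] of 1; the other
    half is lost in [nm_cint_le]. *)
Lemma approximate_identity (K : set dual) (e : R) : compact K -> 0 < e ->
  exists2 phi, ccC phi & forall chi, K chi -> nm (ft phi chi - 1) <= e.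
Proof.
move=> cK e0; have e2 : 0 < e / 2 by rewrite divr_gt0.
have [V V0 hV] := dual_equicontinuous cK e2.
have [|f [cf f01 f1 fV]] :=
    @urysohn_cc R _ [set 0] (interior V) hG lG (@compact_set1 _ _) (@open_interior _ V).
  by move=> _ ->; exact: nbhs_singleton (nbhs_interior V0).
have f0 x : 0 <= f x by case/andP: (f01 x).
have I0 : 0 < \int[mu]_x f x by apply: (@cc_int_gt0 _ _ _ lcG haar_mu f 0); rewrite ?f1.
set I := \int[mu]_x f x in I0.
pose g x := I^-1 * f x.
have cg : cc g by exact: ccZ.
have g0 x : 0 <= g x by rewrite mulr_ge0// invr_ge0 ltW.
have Ig : \int[mu]_x g x = 1 by rewrite (cc_intZ hG finG)// mulVf// gt_eqF.
have ccg := ccC_real cg.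
exists (fun x => (g x)%:C%C) => // chi Kchi.
have -> : 1 = cintegral mu setT (fun x => (g x)%:C%C) :> C by rewrite cint_real Ig.
rewrite /ft -cintB//; last exact: ccC_char.
have ceg : cc (fun x => e / 2 * g x) by exact: ccZ.
have -> : e = 2 * \int[mu]_x (e / 2 * g x).
  by rewrite (cc_intZ hG finG)// Ig; field.
apply: nm_cint_le => //.
  have := ccCD (ccC_char chi ccg) (ccCZ (-1) ccg); congr ccC.
  by apply/funext => x; rewrite mulN1r.
move=> x; have -> : (g x)%:C%C * chi x - (g x)%:C%C = (chi x - 1) * (g x)%:C%C by ring.
rewrite nmM nm_real ger0_norm//; have [fx|/fV Vx] := eqVneq (f x) 0.
  by rewrite /g fx !mulr0.
by apply: ler_wpM2r => //; apply: hV => //; exact: interior_subset.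
Qed.

End DualGroup.

Lemma continuous_unif (R : realType) (G : topologicalZmodType) (f : G -> R[i]) :
  (forall e : R, 0 < e -> exists2 U, nbhs (0 : G) U &
     forall x a, U a -> nm (f (x + a) - f x) <= e) -> continuous f.
Proof.
move=> h x; apply/cvgrPdist_le => e e0.
have [r r0 ->] : exists2 r : R, 0 < r & e = r%:C%C.
  by move: e0; case: e => r s; rewrite ltcE /= => /andP[/eqP -> r0]; exists r.
have [U U0 hU] := h r r0; apply: filterS (nbhs_sub x U0) => y /= Uy.
rewrite nmE lecR nmBC; have -> : y = x + (y - x) by rewrite addrC subrK.
exact: hU.
Qed.

Arguments ft : simpl never.

(** * Fourier coefficients of periodic sums *)

Section Diffraction.
Context (R : realType) (G H : topologicalZmodType).
Local Notation C := R[i].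
Context (lcG : lcag G) (lcH : lcag H) (L : set (G * H)).
Context (cpL : cut_and_project L).
Local Notation Ldual := (annihilator R L).

Let hG : hausdorff_space G. Proof. by case: lcG. Qed.
Let hH : hausdorff_space H. Proof. by case: lcH. Qed.
Let latL : lattice L. Proof. by case: cpL. Qed.
Let denseL : dense (snd @` L). Proof. by case: cpL. Qed.

Definition pchar (p : character R G * character R H) (z : G * H) : C :=
  p.1 z.1 * p.2 z.2.

Lemma pchar_ischar p : ischar (pchar p).
Proof.
split=> [x y|x]; first by rewrite /pchar /= !charD mulrACA.
by rewrite /pchar nmM !nm_character mulr1.
Qed.

Lemma pchar_inj p q : pchar p = pchar q -> p.1 = q.1.
Proof.
move=> pq; apply: characterP => x.
by have := congr1 (fun f => f (x, 0)) pq; rewrite /pchar /= !char_at0 !mulr1.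
Qed.

Lemma annihilatorN chi eta' : Ldual (chi, eta') -> Ldual (- chi, - eta').
Proof. by move=> h z /h /= e; rewrite -rmorphM e rmorph1. Qed.

(** Both characters agree on the projection of [L] to H, which is dense. *)
Lemma annihilator_unique chi eta1 eta2 :
  Ldual (chi, eta1) -> Ldual (chi, eta2) -> eta1 = eta2.
Proof.
move=> h1 h2; apply: characterP => y; apply: nm_le0_eq => e e0.
have e2 : 0 < e / 2 by rewrite divr_gt0.
have near (xi : character R H) : nbhs y [set y' | nm (xi y' - xi y) <= e / 2].
  have cx : xi @ y --> xi y by exact: char_continuous.
  have h := cx _ (nbhs_nm_ball (xi y) e2); exact: h.
have V : nbhs y ([set y' | nm (eta1 y' - eta1 y) <= e / 2] `&`
                 [set y' | nm (eta2 y' - eta2 y) <= e / 2]).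
  by apply: filterI; exact: near.
have [y' [/interior_subset Vy' [l Ll lE]]] :
    interior ([set y' | nm (eta1 y' - eta1 y) <= e / 2] `&`
              [set y' | nm (eta2 y' - eta2 y) <= e / 2]) `&` (snd @` L) !=set0.
  apply: denseL; last exact: open_interior.
  by exists y; exact: nbhs_singleton (nbhs_interior V).
have eql : eta1 l.2 = eta2 l.2.
  have := h1 l Ll; rewrite -(h2 l Ll) /= => /mulfI; apply.
  by rewrite -nm_gt0 nm_character.
have /= [a1 a2] := Vy'; rewrite -lE in a1 a2.
apply: le_trans (nm_triangle (eta1 l.2) _ _) _; rewrite [e]splitr.
by apply: lerD; [rewrite nmBC|rewrite eql].
Qed.

Lemma star_annihilator chi eta' : Ldual (chi, eta') -> star Ldual chi = eta'.
Proof.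
move=> h; rewrite /star; case: xgetP => [eta2 _ h2|/(_ eta')//].
exact: annihilator_unique h2 h.
Qed.

Lemma annihilator_star chi : (fst @` Ldual) chi -> Ldual (chi, star Ldual chi).
Proof. by move=> [[chi' eta'] h /= <-]; rewrite (star_annihilator h). Qed.

Context (mu : {measure set (borel G) -> \bar R}).
Context (theta : {measure set (borel H) -> \bar R}).
Context (haar_mu : haar mu) (haar_theta : haar theta).
Context (F : set (borel G * borel H)) (fundF : fundamental_domain L F).
Local Notation covol := (fine ((mu \x theta)%E F)).
Context (b : H -> C) (cb : ccC b).

Let finG := haar_fin haar_mu.
Let finH := haar_fin haar_theta.
Let covol_gt0 : 0 < covol :=
  (covol_fin_gt0 lcG lcH latL haar_mu haar_theta fundF).2.

Section TestFunction.
Context (phi : G -> C) (cphi : ccC phi).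
Local Notation u := (psum L phi b).

Let apu : ap u. Proof. exact: ap_psum. Qed.

(** [pchar p] is invariant under [L], so its conjugate can be distributed inside the sum, giving the
    periodic sum of two twisted functions. *)
Lemma ip_psum_pchar p : Ldual p ->
  ip u (pchar p) = fourier mu phi p.1 * fourier theta b p.2 / covol%:C%C.
Proof.
move=> hp; rewrite -(mean_psum lcG lcH latL haar_mu haar_theta fundF); last 2 first.
- under eq_fun do rewrite mulrC.
  by apply: ccC_mul => //; apply: contC_conj; exact: contC_char.
- under eq_fun do rewrite mulrC.
  by apply: ccC_mul => //; apply: contC_conj; exact: contC_char.
congr mean; apply/funext => z; rewrite /psum mulr_fsuml; apply: eq_fsbigr => l.
rewrite inE => /hp hl.
have -> : pchar p z = p.1 (z.1 + l.1) * p.2 (z.2 + l.2).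
  by rewrite !charD mulrACA hl mulr1.
by rewrite rmorphM mulrACA.
Qed.

(** The coefficient transfers the properties of [u] to [xi]: periodicity makes [xi] trivial on [L],
    and uniform continuity makes it continuous. *)
Lemma coef_char_pchar xi : ischar xi -> ip u xi != 0 ->
  exists2 p, Ldual p & xi = pchar p.
Proof.
move=> cxi c0; have [xiD xi1] := cxi; set c := ip u xi in c0.
have apxi : ap xi by exact: ap_char.
have xiper l : L l -> xi l = 1.
  move=> Ll; have : (xi l)^* * c = c.
    rewrite -[RHS](mean_shift l) /c /ip; last by apply: apM => //; exact: ap_conj.
    rewrite -meanZ; last by apply: apM => //; exact: ap_conj.
    congr mean; apply/funext => z; rewrite (psum_periodic latL)// xiD rmorphM /=.
    by ring.
  rewrite -[RHS]mul1r => /(mulIf c0) h.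
  by rewrite -[xi l]cjK h rmorph1.
have xiunif (e : R) : 0 < e -> exists U1 U2, [/\ nbhs (0 : G) U1, nbhs (0 : H) U2 &
    forall z a, U1 a.1 -> U2 a.2 -> nm (xi (z + a) - xi z) <= e].
  move=> e0; have e'0 : 0 < e * nm c by rewrite mulr_gt0// nm_gt0.
  have [U1 [U2 [U10 U20 hU]]] := psum_unif lcG lcH latL cphi cb e'0.
  exists U1, U2; split => // z a a1 a2.
  have -> : xi (z + a) - xi z = xi z * (xi a - 1) by rewrite xiD; ring.
  rewrite nmM xi1 mul1r -(ler_pM2r (_ : 0 < nm c)) ?nm_gt0// -nmM.
  (* Translating by [a] multiplies the coefficient by [xi a], so [xi a - 1] is controlled by the
     oscillation of [u]. *)
  have -> : (xi a - 1) * c = mean (fun z => (u (z + a) - u z) * (xi z)^*).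
    have apua := ap_shift a apu.
    under [in RHS]eq_fun do rewrite mulrBl.
    rewrite meanB; [|by apply: apM => //; exact: ap_conj..].
    rewrite mulrBl mul1r; congr (_ - _).
    rewrite /c /ip -[in LHS](mean_shift a); last by apply: apM => //; exact: ap_conj.
    rewrite -meanZ; last by apply: (@ap_shift _ _ (fun z => u z * (xi z)^*)); apply: apM => //; exact: ap_conj.
    congr mean; apply/funext => z'; rewrite xiD rmorphM /=.
    have xx : xi a * (xi a)^* = 1 by rewrite nm_sqr xi1 expr1n.
    by rewrite -[RHS]mul1r -xx; ring.
  apply: nm_mean_le.
    by apply: apM; [apply: apB => //; exact: ap_shift|exact: ap_conj].
  by move=> z'; rewrite nmM nm_conj xi1 mulr1; exact: hU.
have cont1 : continuous (fun x : G => xi (x, 0)).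
  apply: continuous_unif => e /xiunif[U1 [U2 [U10 U20 hU]]]; exists U1 => // x a Ua.
  have -> : xi (x + a, 0) = xi ((x, 0) + (a, 0)).
    by congr xi; congr pair; rewrite /= addr0.
  by apply: hU => //; exact: nbhs_singleton.
have cont2 : continuous (fun y : H => xi (0, y)).
  apply: continuous_unif => e /xiunif[U1 [U2 [U10 U20 hU]]]; exists U2 => // x a Ua.
  have -> : xi (0, x + a) = xi ((0, x) + (0, a)).
    by congr xi; congr pair; rewrite /= addr0.
  by apply: hU => //; exact: nbhs_singleton.
have n1 x : `|xi (x, 0)| = 1 by rewrite nmE xi1.
have n2 y : `|xi (0, y)| = 1 by rewrite nmE xi1.
have D1 x y : xi (x + y, 0) = xi (x, 0) * xi (y, 0).
  by rewrite -xiD; congr xi; congr pair; rewrite /= addr0.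
have D2 x y : xi (0, x + y) = xi (0, x) * xi (0, y).
  by rewrite -xiD; congr xi; congr pair; rewrite /= addr0.
have xiE z : xi z = xi (z.1, 0) * xi (0, z.2).
  by rewrite -xiD; congr xi; case: z => x y; congr pair; rewrite /= ?addr0 ?add0r.
exists (Character cont1 n1 D1, Character cont2 n2 D2).
  by move=> z Lz /=; rewrite -xiE; exact: xiper.
by apply/funext => z; rewrite xiE.
Qed.

Definition dual_weight (chi : character R G) : R :=
  if `[< (fst @` Ldual) chi >] then
    nm (fourier theta b (- star Ldual chi)) ^+ 2 / covol ^+ 2 else 0.

Lemma dual_weight_ge0 chi : 0 <= dual_weight chi.
Proof.
by rewrite /dual_weight; case: asboolP => // _; rewrite divr_ge0// ?sqr_ge0.
Qed.

(** The annihilator is stable under negation, which changes the sign of both coordinates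
    together. *)
Lemma dual_weightE chi : (fst @` Ldual) chi ->
  nm (ip u (pchar (- chi, - star Ldual chi))) ^+ 2 =
  nm (ft mu phi chi) ^+ 2 * dual_weight chi.
Proof.
move=> hchi; have hp := annihilatorN (annihilator_star hchi).
have -> : ip u (pchar (- chi, - star Ldual chi)) =
    ft mu phi chi * fourier theta b (- star Ldual chi) / covol%:C%C.
  by rewrite -fourierN; exact: ip_psum_pchar hp.
rewrite /dual_weight asboolT//.
rewrite nmM nmM nmV nm_real (ger0_norm (ltW covol_gt0)) !exprMn exprVn.
by rewrite mulrA.
Qed.

(** One inequality is Bessel, the other Parseval; [coef_char_pchar] places every character with
    nonzero coefficient in the annihilator. *)
Lemma dual_parseval : (\esum_(chi in [set: character R G])
  (nm (ft mu phi chi) ^+ 2 * dual_weight chi)%:E = (sqn u)%:E)%E.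
Proof.
have weight_fst chi : nm (ft mu phi chi) ^+ 2 * dual_weight chi != 0 -> (fst @` Ldual) chi.
  by rewrite /dual_weight; case: asboolP => // _; rewrite mulr0 eqxx.
pose xi chi := pchar (- chi, - star Ldual chi).
apply/eqP; rewrite eq_le; apply/andP; split.
  apply: ge_ereal_sup => _ [Y [fY _] <-].
  rewrite fsbig_finite//; set s := finmap.enum_fset _; rewrite sumEFin lee_fin.
  have us : uniq s by exact: finmap.fset_uniq.
  (* Characters with zero contribution are dropped, leaving points of the dual lattice. *)
  pose X := [seq xi chi | chi <- s & nm (ft mu phi chi) ^+ 2 * dual_weight chi != 0].
  have bX : char_sum u X <= sqn u.
    apply: bessel_char => //; split.
      rewrite map_inj_in_uniq ?filter_uniq// => chi chi' _ _ /pchar_inj /=.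
      exact: oppr_inj.
    by move=> _ /mapP[chi _ ->]; exact: pchar_ischar.
  apply: le_trans bX.
  rewrite /char_sum big_map big_filter.
  rewrite [leLHS](bigID (fun chi => nm (ft mu phi chi) ^+ 2 * dual_weight chi != 0)) /=.
  rewrite [X in _ + X <= _]big1 ?addr0 => [|chi]; last by rewrite negbK => /eqP.
  by apply: ler_sum => chi /weight_fst h; rewrite dual_weightE.
apply/lee_addgt0Pr => e e0; have [X [uX cX] hX] := parseval apu e0.
have /choice[pf hpf] : forall xi : G * H -> C, exists p,
    ischar xi -> ip u xi != 0 -> Ldual p /\ xi = pchar p.
  move=> x; have [[cx nx]|n] := pselect (ischar x /\ ip u x != 0).
    by have [p Lp xp] := coef_char_pchar cx nx; exists p.
  by exists 0 => cx nx; case: n.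
pose X' := [seq x <- X | ip u x != 0].
have hX' x : x \in X' -> Ldual (pf x) /\ x = pchar (pf x).
  by rewrite mem_filter => /andP[nx /cX cx]; exact: hpf.
have xiK x : x \in X' -> (fst @` Ldual) (- (pf x).1) /\ xi (- (pf x).1) = x.
  move=> /hX'[Lp xp]; have Lp' : Ldual (- (pf x).1, - (pf x).2).
    by apply: annihilatorN; case: (pf x) Lp.
  split; first by exists (- (pf x).1, - (pf x).2).
  by rewrite /xi (star_annihilator Lp') !opprK [RHS]xp; case: (pf x).
pose s := [seq - (pf x).1 | x <- X'].
have us : uniq s.
  rewrite map_inj_in_uniq ?filter_uniq// => x y /xiK[_ xx] /xiK[_ yy] xy.
  by rewrite -xx -yy xy.
apply: (@le_trans _ _ (char_sum u X + e)%:E); first by rewrite lee_fin.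
rewrite EFinD leeD2r//; apply: esum_ge; exists [set` s].
  by split => //; exact: finite_seq.
rewrite -fsbig_seq//= sumEFin lee_fin /s big_map.
have -> : char_sum u X = \sum_(x <- X') nm (ip u x) ^+ 2.
  rewrite /char_sum (bigID (fun x => ip u x != 0)) big_filter /=.
  rewrite [X in _ + X]big1 ?addr0// => x.
  by rewrite negbK => /eqP ->; rewrite nm0 expr0n.
rewrite big_seq [leRHS]big_seq; apply: ler_sum => x xX'; have [h1 h2] := xiK x xX'.
by rewrite -dual_weightE// -[in leLHS]h2.
Qed.

Context (Kb : set H) (cKb : compact Kb) (hKb : forall y, b y != 0 -> Kb y).

(** Grouping the products of two terms of [u] by the difference [t] of their lattice points writes
    [|u|^2] as a finite sum of periodic sums, whose means are known. *)
Lemma ip_psum_self (Kphi : set G) (T : seq (G * H)) :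
  (forall x, phi x != 0 -> Kphi x) ->
  uniq T -> (forall t, t \in T -> L t) ->
  (forall t, L t -> mdiff Kphi Kphi t.1 -> mdiff Kb Kb t.2 -> t \in T) ->
  ip u u = \sum_(t <- T) acor mu phi t.1 * acor_coef L mu theta F b t.1.
Proof.
move=> hKphi uT TL hT.
have -> : ip u u = mean (fun z => \sum_(t <- T) psum L (bprod phi t.1) (bprod b t.2) z).
  congr mean; apply/funext => z.
  have [s [us sL hs]] := psum_support latL z cphi cb.
  pose a (l : G * H) := phi (z.1 + l.1) * b (z.2 + l.2).
  have Et t : t \in T -> psum L (bprod phi t.1) (bprod b t.2) z =
      \sum_(l <- s) a l * (a (l - t))^*.
    move=> tT; rewrite (psumE (s := s))//; last first.
      move=> l Ll; rewrite /bprod !mulf_eq0 !negb_or => /andP[/andP[h1 _] /andP[h2 _]].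
      by apply: hs => //; exact: mulf_neq0.
    apply: eq_bigr => l _; rewrite /a /bprod rmorphM /= -!addrA.
    by rewrite mulrACA.
  rewrite big_seq (eq_bigr _ Et) -big_seq exchange_big /=.
  rewrite {1}(psumE us sL hs) mulr_suml big_seq [RHS]big_seq; apply: eq_bigr => l /sL Ll.
  rewrite -mulr_sumr -/(a l); have [->|al] := eqVneq (a l) 0; first by rewrite !mul0r.
  congr (_ * _); rewrite -rmorph_sum /=; congr (_^*).
  rewrite /psum (reindex_fsbig (fun t => l - t) L); last first.
    split; first by move=> t Lt; exact: latticeB.
      by move=> x y _ _ /addrI /oppr_inj.
    by move=> t Lt; exists (l - t); [exact: latticeB|rewrite subKr].
  apply: fsum_seqE => // t Lt; rewrite mulf_eq0 negb_or /= => /andP[/hKphi h1 /hKb h2].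
  move: al; rewrite /a mulf_eq0 negb_or => /andP[/hKphi h3 /hKb h4].
  apply: hT => //.
    by exists (z.1 + l.1) => //; exists (z.1 + (l.1 - t.1)) => //; rewrite opprD addrACA subrr add0r subKr.
  by exists (z.2 + l.2) => //; exists (z.2 + (l.2 - t.2)) => //; rewrite opprD addrACA subrr add0r subKr.
rewrite mean_sum; last by move=> t _; apply: ap_psum => //; exact: ccC_bprod.
rewrite big_seq [RHS]big_seq; apply: eq_bigr => t /TL Lt.
rewrite (mean_psum lcG lcH latL haar_mu haar_theta fundF); [|exact: ccC_bprod..].
by rewrite (acor_coefE cpL)// mulrA.
Qed.

Lemma convolution_tilde x : convolution mu phi (tilde phi) x = acor mu phi x.
Proof.
rewrite /convolution /acor; congr (cintegral mu setT _); apply/funext => y.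
by rewrite /bprod /tilde opprB.
Qed.

(** Only one factor of the integrand moves with the argument, and it does so uniformly; the other
    one is integrable. *)
Lemma contC_acor : contC (acor mu phi).
Proof.
apply/contCP; apply: continuous_unif => e e0.
have [cr ci] := cphi; have ca := cc_absC cphi.
pose I := \int[mu]_x absC phi x.
have I0 : 0 <= I by apply: Rintegral_ge0 => x _; rewrite addr_ge0.
have I1 : 0 < 4 * (I + 1) by rewrite mulr_gt0// ltr_wpDl.
pose d := e / (4 * (I + 1)).
have d0 : 0 < d by rewrite divr_gt0.
have [U U0 hU] := cc_unif cr d0; have [U' U'0 hU'] := cc_unif ci d0.
exists (-%R @^-1` (U `&` U')); first by apply: nbhs_opp; exact: filterI.
move=> x a [/= Ua U'a]; 
suff : nm (acor mu phi (x + a) - acor mu phi x) <= e by exact.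
have -> : acor mu phi (x + a) - acor mu phi x =
    cintegral mu setT (fun y => bprod phi (x + a) y - bprod phi x y).
  by apply/esym; exact: (cintB lcG haar_mu (ccC_bprod cphi _) (ccC_bprod cphi _)).
have cd : cc (fun y => 2 * d * absC phi y) by exact: ccZ.
have -> : e = 2 * (2 * d * (I + 1)) by rewrite /d; field; rewrite gt_eqF// ltr_wpDl.
apply: (@le_trans _ _ (2 * \int[mu]_y (2 * d * absC phi y))); last first.
  have d2 : 0 < 2 * d by rewrite mulr_gt0.
  by rewrite (cc_intZ hG finG)// -/I ler_pM2l// (ler_pM2l d2) lerDl.
apply: nm_cint_le => //.
  have := ccCD (ccC_bprod cphi (x + a)) (ccCZ (-1) (ccC_bprod cphi x)); congr ccC.
  by apply/funext => y; rewrite mulN1r.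
move=> y; rewrite /bprod -mulrBr -cjB nmM nm_conj mulrC.
apply: ler_pM; rewrite ?nm_ge0//; last exact: nm_ReIm.
apply: le_trans (nm_ReIm _) _; rewrite !raddfB /= mulr2n mulrDl mul1r.
by apply: lerD; rewrite opprD addrA; [exact: hU|exact: hU'].
Qed.

End TestFunction.
End Diffraction.

Section DiffractionMeasure.
Context (R : realType) (G H : topologicalZmodType).
Local Notation C := R[i].
Local Notation dual := (character R G).
Context (lcG : lcag G) (lcH : lcag H) (L : set (G * H)).
Context (cpL : cut_and_project L).
Local Notation Ldual := (annihilator R L).
Context (mu : {measure set (borel G) -> \bar R}).
Context (theta : {measure set (borel H) -> \bar R}).
Context (haar_mu : haar mu) (haar_theta : haar theta).
Context (F : set (borel G * borel H)) (fundF : fundamental_domain L F).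
Local Notation covol := (fine ((mu \x theta)%E F)).
Context (b : H -> C) (cb : ccC b).

Let hG : hausdorff_space G. Proof. by case: lcG. Qed.
Let hdual : hausdorff_space dual. Proof. exact: dual_hausdorff. Qed.
Let finG := haar_fin haar_mu.

Local Notation weight := (dual_weight L mu theta F b).
Local Notation weight_ge0 := (dual_weight_ge0 L mu theta F b).
Local Notation m := (discrete_measure weight_ge0).

Lemma dual_integral (phi : G -> C) : ccC phi ->
  (\int[m]_chi (nm (ft mu phi chi) ^+ 2)%:E = (sqn (psum L phi b))%:E)%E.
Proof.
move=> cphi; rewrite discrete_integral//.
- exact: (dual_parseval lcG lcH cpL haar_mu haar_theta fundF cb cphi).
- by apply: continuous_borel; exact: ft_continuous.
- by move=> chi; exact: sqr_ge0.
Qed.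

(** A test function whose transform has modulus at least 1 on [K] bounds the mass of [K] by the norm
    of its periodic sum. *)
Lemma dual_weight_radon : radon m.
Proof.
apply: discrete_radon => // K cK.
have e0 : 0 < 2^-1 :> R by rewrite invr_gt0.
have [phi cphi hphi] := approximate_identity lcG haar_mu cK e0.
(* The transform of [phi] has modulus at least 1/2 on [K]; doubling brings it to 1. *)
pose psi x := 2 * phi x; have cpsi : ccC psi by exact: ccCZ.
have psi1 chi : K chi -> 1 <= nm (ft mu psi chi) ^+ 2.
  move=> Kchi; have -> : ft mu psi chi = 2 * ft mu phi chi.
    rewrite /ft -(cintZ hG finG)//; last exact: ccC_char.
    by congr (cintegral mu setT _); apply/funext => x; rewrite /psi mulrA.
  have n2 : nm 2 = 2 :> R by rewrite -[2 in LHS](rmorph_nat (real_complex R)) nm_real ger0_norm.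
  rewrite nmM n2 -[leLHS](expr1n _ 2) lerXn2r ?nnegrE ?mulr_ge0 ?nm_ge0//.
  have := nm_triangle (ft mu phi chi) 1 0; rewrite !subr0 nm1 nmBC => h.
  by have := hphi chi Kchi; move: h; lra.
apply: (@le_lt_trans _ _ (sqn (psum L psi b))%:E); last by rewrite ltey.
rewrite -(dual_parseval lcG lcH cpL haar_mu haar_theta fundF cb cpsi).
have -> : m K = (\esum_(chi in K) (weight chi)%:E)%E by [].
rewrite esum_mkcond; apply: le_esum => chi _.
have w0 := weight_ge0 chi; case: ifPn => [|_]; last by rewrite lee_fin mulr_ge0 ?sqr_ge0.
by rewrite inE => /psi1 h; rewrite lee_fin ler_peMl.
Qed.

Lemma phase1 : measurable_fun setT (fun _ : borel dual => complex.Re (1 : C)) /\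
  measurable_fun setT (fun _ : borel dual => complex.Im (1 : C)).
Proof. by split; exact: measurable_cst. Qed.

Lemma norm_phase1 (chi : dual) : `|1 : C| = 1.
Proof. exact: normr1. Qed.

Definition diffraction_measure : cmeasure R dual :=
  @CMeasure _ _ m (fun=> 1) dual_weight_radon phase1 norm_phase1.

Lemma diffraction_comb : is_weighted_comb diffraction_measure (fst @` Ldual)
  (fun chi => nm (fourier theta b (- star Ldual chi)) ^+ 2 / covol ^+ 2).
Proof.
move=> A [mA pA].
have mE : (m A = \esum_(chi in fst @` Ldual `&` A)
   (nm (fourier theta b (- star Ldual chi)) ^+ 2 / covol ^+ 2)%:E)%E.
  rewrite /discrete_measure /= /dmeas setIC esum_mkcondr; apply: eq_esum => chi _.
  rewrite /dual_weight; case: asboolP => h; first by rewrite mem_set.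
  by rewrite memNset.
rewrite -mE; split.
  have clA : compact (closure A) by rewrite -precompactE.
  apply: (@le_lt_trans _ _ (m (closure A))); last exact: dual_weight_radon.1.
  apply: le_measure; rewrite ?inE//; last exact: subset_closure.
  by apply: borel_closed; exact: closed_closure.
rewrite /cmeasure_of /cintegral /= Rintegral_cst// mul1r Rintegral_cst// mul0r.
by [].
Qed.

Context (Kb : set H) (cKb : compact Kb) (hKb : forall y, b y != 0 -> Kb y).

(** Both sides equal [sqn (psum L phi b)]: on the group by [ip_psum_self], on the dual by
    [dual_parseval]. *)
Lemma diffraction_transform :
  transforms_to mu (gamma lcG lcH cpL mu theta F cKb hKb) diffraction_measure.
Proof.
move=> phi /(ccCP phi hG) cphi; pose h chi : C := `|fourier mu phi (- chi)| ^+ 2.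
have hE chi : h chi = (nm (ft mu phi chi) ^+ 2)%:C%C.
  by rewrite /h fourierN nmE rmorphXn.
have h2 : measurable_fun setT (fun chi : borel dual => nm (ft mu phi chi) ^+ 2).
  by apply: continuous_borel; exact: ft_continuous.
have I1 : m.-integrable setT (EFin \o (fun chi : borel dual => complex.Re (h chi))).
  have -> : EFin \o (fun chi : borel dual => complex.Re (h chi)) =
      EFin \o (fun chi : borel dual => nm (ft mu phi chi) ^+ 2).
    by apply/funext => chi; congr EFin; rewrite hE.
  apply/integrableP; split; first exact/measurable_EFinP.
  rewrite (eq_integral (fun chi : borel dual => (nm (ft mu phi chi) ^+ 2)%:E)); last first.
    by move=> chi _; rewrite /comp abse_EFin ger0_norm ?sqr_ge0.
  by rewrite dual_integral// ltey.
have I2 : m.-integrable setT (EFin \o (fun chi : borel dual => complex.Im (h chi))).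
  have -> : EFin \o (fun chi : borel dual => complex.Im (h chi)) = cst 0%E.
    by apply/funext => chi; congr EFin; rewrite hE.
  exact: integrable0.
split; first by split.
rewrite -/h; transitivity (sqn (psum L phi b))%:C%C.
  have [K cK hK] := ccC_supp cphi.
  have [T [uT TL hT]] := autocorrelation_seq cpL cKb (compactB cK cK).
  have hT' t : L t -> convolution mu phi (tilde phi) t.1 != 0 -> mdiff Kb Kb t.2 -> t \in T.
    rewrite convolution_tilde => Lt /(acor_supp hK) h1 h3; exact: hT.
  have cc : contC (convolution mu phi (tilde phi)).
    have -> : convolution mu phi (tilde phi) = acor mu phi by apply/funext => x; exact: convolution_tilde.
    exact: (contC_acor lcG haar_mu cphi).
  rewrite (cmintegral_gamma lcG lcH cpL mu theta F cKb hKb cc uT TL hT').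
  rewrite -ipE; last by case: cpL => lat _ _; exact: ap_psum.
  rewrite (ip_psum_self lcG lcH cpL haar_mu haar_theta fundF cb cphi hKb hK uT TL hT).
  by apply: eq_bigr => t _; rewrite convolution_tilde.
have -> : cmintegral diffraction_measure h =
    (\int[m]_chi (nm (ft mu phi chi) ^+ 2) +i* \int[m]_chi (0 : R))%C.
  rewrite /cmintegral /cintegral; congr (_ +i* _)%C;
    by apply: eq_Rintegral => chi _; rewrite mulr1 hE.
by rewrite /Rintegral dual_integral// integral0.
Qed.

End DiffractionMeasure.

(** * Uniqueness of the Fourier transform *)

Section Amplification.
Context (R : realType).
Implicit Types s t e : R.

Lemma bernoulli s n : 0 <= s -> 1 + s *+ n <= (1 + s) ^+ n.
Proof.
move=> s0; elim: n => [|n IH]; first by rewrite mulr0n addr0 expr0.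
rewrite exprS mulrSr; apply: (@le_trans _ _ ((1 + s) * (1 + s *+ n))); last first.
  by apply: ler_wpM2l => //; rewrite addr_ge0.
have : 0 <= s * (s *+ n) by rewrite mulr_ge0// mulrn_wge0.
by move: (s *+ n) => x; nra.
Qed.

Lemma bernoulliN s n : 0 <= s <= 1 -> 1 - s *+ n <= (1 - s) ^+ n.
Proof.
move=> /andP[s0 s1]; elim: n => [|n IH]; first by rewrite mulr0n subr0 expr0.
rewrite exprS mulrSr; apply: (@le_trans _ _ ((1 - s) * (1 - s *+ n))); last first.
  by apply: ler_wpM2l => //; rewrite subr_ge0.
have : 0 <= s * (s *+ n) by rewrite mulr_ge0// mulrn_wge0.
by move: (s *+ n) => x; nra.
Qed.

(* The Brosowski-Deutsch polynomial of the Stone-Weierstrass theorem: as [n]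
   grows, it tends to 1 above 1/2 and to 0 below 1/4. *)
Definition amplify n t : R := 1 - (1 - t ^+ n) ^+ (3 ^ n).

Lemma amplify01 n t : 0 <= t <= 1 -> 0 <= amplify n t <= 1.
Proof.
move=> /andP[t0 t1]; have tn : 0 <= 1 - t ^+ n <= 1.
  by rewrite subr_ge0 exprn_ile1//= gerBl exprn_ge0.
case/andP: tn => tn0 tn1.
by rewrite /amplify subr_ge0 exprn_ile1//= gerBl exprn_ge0.
Qed.

(** From [(1 - s) * (1 + s) <= 1] and Bernoulli, [(1 - s) ^+ (3 ^ n)] is at most the inverse of
    [3 ^ n * s], itself at least [(3 / 2) ^+ n]. *)
Lemma amplify_ge n t : 2^-1 <= t <= 1 -> 1 - (2 / 3) ^+ n <= amplify n t.
Proof.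
move=> /andP[t2 t1]; have t0 : 0 <= t by apply: le_trans t2.
rewrite lerD2l lerN2; set s := t ^+ n.
have s0 : 0 <= s by exact: exprn_ge0.
have s1 : s <= 1 by exact: exprn_ile1.
have sn : (2^-1) ^+ n <= s by apply: lerXn2r; rewrite ?nnegrE.
have p : 0 < (3 / 2) ^+ n :> R by apply: exprn_gt0; rewrite divr_gt0.
have h1 : (3 / 2) ^+ n <= (1 + s) ^+ (3 ^ n).
  apply: le_trans (bernoulli _ s0); apply: (@le_trans _ _ (s *+ 3 ^ n)); last by rewrite lerDr.
  by rewrite -[s *+ _]mulr_natl natrX exprMn ler_wpM2l// exprn_ge0.
have h2 : (1 - s) ^+ (3 ^ n) * (1 + s) ^+ (3 ^ n) <= 1.
  rewrite -exprMn exprn_ile1//; first by rewrite mulr_ge0 ?subr_ge0 ?addr_ge0.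
  have := sqr_ge0 s; rewrite expr2; nra.
have -> : (2 / 3) ^+ n = ((3 / 2) ^+ n)^-1 :> R by rewrite -exprVn invf_div.
rewrite -[X in _ <= X]mul1r ler_pdivlMr//; apply: le_trans h2.
by apply: ler_wpM2l => //; rewrite exprn_ge0// subr_ge0.
Qed.

(** Bernoulli bounds the value by [3 ^ n * s], at most [(3 / 4) ^+ n]; the base 3 is chosen strictly
    between 2 and 4. *)
Lemma amplify_le n t : 0 <= t <= 4^-1 -> amplify n t <= (3 / 4) ^+ n.
Proof.
move=> /andP[t0 t4]; set s := t ^+ n.
have s0 : 0 <= s by exact: exprn_ge0.
have s1 : s <= 1 by apply: exprn_ile1 => //; apply: le_trans t4 _; rewrite invf_le1// ler1n.
have sn : s <= (4^-1) ^+ n by apply: lerXn2r; rewrite ?nnegrE// invr_ge0.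
have := @bernoulliN s (3 ^ n) ltac:(by rewrite s0).
have : s *+ 3 ^ n <= (3 / 4) ^+ n.
  by rewrite -mulr_natl natrX exprMn ler_wpM2l// exprn_ge0.
by rewrite /amplify -/s; lra.
Qed.

Lemma amplify_limit e : 0 < e -> exists n, (2 / 3) ^+ n <= e /\ (3 / 4) ^+ n <= e.
Proof.
move=> e0.
have c1 : `|2 / 3 : R| < 1 by rewrite ger0_norm ?divr_ge0// ltr_pdivrMr// mul1r ltr_nat.
have c2 : `|3 / 4 : R| < 1 by rewrite ger0_norm ?divr_ge0// ltr_pdivrMr// mul1r ltr_nat.
have /cvgrPdist_le/(_ e e0)[N1 _ h1] := cvg_expr c1.
have /cvgrPdist_le/(_ e e0)[N2 _ h2] := cvg_expr c2.
exists (maxn N1 N2); split.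
  have := h1 (maxn N1 N2) (leq_maxl _ _).
  by rewrite sub0r normrN ger0_norm// exprn_ge0// divr_ge0.
have := h2 (maxn N1 N2) (leq_maxr _ _).
by rewrite sub0r normrN ger0_norm// exprn_ge0// divr_ge0.
Qed.

End Amplification.

(** * Multipliers of transforms and separation of compact sets of characters *)

Section Multipliers.
Context (R : realType) (G : topologicalZmodType) (lcG : lcag G).
Local Notation C := R[i].
Local Notation dual := (character R G).
Context (mu : {measure set (borel G) -> \bar R}) (haar_mu : haar mu).

Let hG : hausdorff_space G. Proof. by case: lcG. Qed.
Let finG := haar_fin haar_mu.

(** Multiplying transforms by [t] must stay within transforms of test functions, so that the
    hypothesis on two measures can be applied again. Trigonometric polynomials qualify. *)
Definition multiplier (t : dual -> C) : Prop :=
  forall phi : G -> C, ccC phi -> exists2 psi : G -> C, ccC psi &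
    forall chi, ft mu psi chi = t chi * ft mu phi chi.

Lemma multiplier_cst (c : C) : multiplier (fun=> c).
Proof.
move=> phi cphi; exists (fun x => c * phi x); first exact: ccCZ.
move=> chi; rewrite /ft -(cintZ hG finG)//; last exact: ccC_char.
by congr (cintegral mu setT _); apply/funext => x; rewrite mulrA.
Qed.

Lemma multiplierD t t' : multiplier t -> multiplier t' ->
  multiplier (fun chi => t chi + t' chi).
Proof.
move=> ht ht' phi cphi; have [psi cpsi hpsi] := ht phi cphi.
have [psi' cpsi' hpsi'] := ht' phi cphi.
exists (fun x => psi x + psi' x); first exact: ccCD.
move=> chi; rewrite mulrDl -hpsi -hpsi' /ft -(cintD hG finG); [|exact: ccC_char..].
by congr (cintegral mu setT _); apply/funext => x; rewrite mulrDl.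
Qed.

Lemma multiplierM t t' : multiplier t -> multiplier t' ->
  multiplier (fun chi => t chi * t' chi).
Proof.
move=> ht ht' phi cphi; have [psi' cpsi' hpsi'] := ht' phi cphi.
have [psi cpsi hpsi] := ht psi' cpsi'; exists psi => // chi.
by rewrite hpsi hpsi' mulrA.
Qed.

(** Translating a test function multiplies its transform by evaluation at a point. *)
Lemma multiplier_eval x : multiplier (fun chi => chi x).
Proof.
move=> phi cphi; exists (fun y => phi (y - x)); first exact: ccC_shift.
move=> chi; have cpc := ccC_char chi cphi.
rewrite /ft -(cint_shift (- x) haar_mu cpc) -(cintZ hG finG)//; last first.
  exact: (ccC_shift (- x) cpc).
congr (cintegral mu setT _); apply/funext => y.
by rewrite mulrCA -charD [x + _]addrC subrK.
Qed.

Definition rmultiplier (t : dual -> R) : Prop :=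
  multiplier (fun chi => (t chi)%:C%C).

Lemma rmultiplier_cst c : rmultiplier (fun=> c).
Proof. exact: multiplier_cst. Qed.

Lemma rmultiplierM t t' : rmultiplier t -> rmultiplier t' ->
  rmultiplier (fun chi => t chi * t' chi).
Proof.
move=> ht ht'; rewrite /rmultiplier; under eq_fun do rewrite rcM.
exact: multiplierM.
Qed.

Lemma rmultiplier_compl t : rmultiplier t -> rmultiplier (fun chi => 1 - t chi).
Proof.
move=> ht; rewrite /rmultiplier.
have -> : (fun chi => (1 - t chi)%:C%C) = (fun chi => 1 + (-1) * (t chi)%:C%C : C).
  by apply/funext => chi; rewrite mulN1r rcB.
apply: multiplierD; first exact: multiplier_cst.
by apply: multiplierM => //; exact: multiplier_cst.
Qed.

Lemma rmultiplierX t n : rmultiplier t -> rmultiplier (fun chi => t chi ^+ n).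
Proof.
move=> ht; elim: n => [|n IH]; first exact: rmultiplier_cst.
by under eq_fun do rewrite exprS; exact: rmultiplierM.
Qed.

(** Separation holds at every precision, so each union below can be treated with [e / 2]. *)
Definition separated (A B : set dual) : Prop := forall e : R, 0 < e ->
  exists t : dual -> R, [/\ rmultiplier t, forall chi, 0 <= t chi <= 1,
    forall chi, A chi -> 1 - e <= t chi & forall chi, B chi -> t chi <= e].

Lemma separated_sub A A' B B' : A `<=` A' -> B `<=` B' -> separated A' B' -> separated A B.
Proof.
move=> AA' BB' h e /h[t [mt t01 tA tB]]; exists t; split => // chi.
  by move=> /AA'; exact: tA.
by move=> /BB'; exact: tB.
Qed.

Lemma separatedUl A A' B : separated A B -> separated A' B -> separated (A `|` A') B.
Proof.
move=> h h' e e0; have e2 : 0 < e / 2 by rewrite divr_gt0.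
have [t [mt t01 tA tB]] := h _ e2; have [t' [mt' t'01 tA' tB']] := h' _ e2.
exists (fun chi => 1 - (1 - t chi) * (1 - t' chi)); split.
- by apply: rmultiplier_compl; apply: rmultiplierM; exact: rmultiplier_compl.
- by move=> chi; have /andP[? ?] := t01 chi; have /andP[? ?] := t'01 chi; apply/andP; split; nra.
- move=> chi; have /andP[? ?] := t01 chi; have /andP[? ?] := t'01 chi.
  by move=> [/tA|/tA'] ?; nra.
- move=> chi Bc; have /andP[? ?] := t01 chi; have /andP[? ?] := t'01 chi.
  by have := tB _ Bc; have := tB' _ Bc; nra.
Qed.

Lemma separatedUr A B B' : separated A B -> separated A B' -> separated A (B `|` B').
Proof.
move=> h h' e e0; have e2 : 0 < e / 2 by rewrite divr_gt0.
have [t [mt t01 tA tB]] := h _ e2; have [t' [mt' t'01 tA' tB']] := h' _ e2.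
exists (fun chi => t chi * t' chi); split.
- exact: rmultiplierM.
- by move=> chi; have /andP[? ?] := t01 chi; have /andP[? ?] := t'01 chi; apply/andP; split; nra.
- move=> chi Ac; have /andP[? ?] := t01 chi; have /andP[? ?] := t'01 chi.
  by have := tA _ Ac; have := tA' _ Ac; nra.
- move=> chi; have /andP[? ?] := t01 chi; have /andP[? ?] := t'01 chi.
  by move=> [/tB|/tB'] ?; nra.
Qed.

Lemma separated0l B : separated set0 B.
Proof.
move=> e e0; exists (fun=> 0); split => //; first exact: rmultiplier_cst.
  by move=> chi; rewrite lexx ler01.
by move=> chi _; exact: ltW.
Qed.

Lemma separated0r A : separated A set0.
Proof.
move=> e e0; exists (fun=> 1); split => //; first exact: rmultiplier_cst.
  by move=> chi; rewrite lexx ler01.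
by move=> chi _; rewrite gerBl ltW.
Qed.

Lemma separated_amplify t (A B : set dual) : rmultiplier t ->
  (forall chi, 0 <= t chi <= 1) -> (forall chi, A chi -> 2^-1 <= t chi) ->
  (forall chi, B chi -> t chi <= 4^-1) -> separated A B.
Proof.
move=> mt t01 tA tB e /amplify_limit[n [n1 n2]]; exists (fun chi => amplify n (t chi)); split.
- apply: rmultiplier_compl; apply: rmultiplierX.
  by apply: rmultiplier_compl; exact: rmultiplierX.
- by move=> chi; exact: amplify01.
- move=> chi /tA h; have /andP[_ t1] := t01 chi.
  by have := @amplify_ge _ n (t chi) ltac:(by rewrite h); lra.
- move=> chi /tB h; have /andP[t0 _] := t01 chi.
  by apply: le_trans n2; apply: amplify_le; rewrite t0.
Qed.

(** For unimodular [a], this lies in [0, 1] and equals 1 exactly where [chi x = a]. *)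
Definition bump (a : C) (x : G) (chi : dual) : R :=
  (1 + complex.Re (chi x * a^*)) / 2.

Lemma rmultiplier_bump a x : rmultiplier (bump a x).
Proof.
rewrite /rmultiplier.
have -> : (fun chi => (bump a x chi)%:C%C) =
    (fun chi : dual => 2^-1 + 4^-1 * (a^* * chi x + a * chi (- x)) : C).
  apply/funext => chi; have -> : chi (- x) = (chi x)^*.
    have cx : chi x * chi (- x) = 1 by rewrite -charD subrr char_at0.
    have : chi x * (chi x)^* = 1 by rewrite nm_sqr nm_character expr1n.
    by rewrite -cx => /mulfI ->//; rewrite -nm_gt0 nm_character.
  have -> : a^* * chi x + a * (chi x)^* = (2 * complex.Re (chi x * a^*))%:C%C.
    have -> : a * (chi x)^* = (chi x * a^*)^* by rewrite cjM cjK mulrC.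
    rewrite [a^* * _]mulrC; case: (chi x * a^*) => p q.
    by apply/eqP; rewrite eq_complex /= subrr eqxx andbT mulr2n mulrDl mul1r.
  rewrite /bump; move: (complex.Re _) => r.
  have -> : 2^-1 = (2^-1)%:C%C :> C by rewrite rcV rmorph_nat.
  have -> : 4^-1 = (4^-1)%:C%C :> C by rewrite rcV rmorph_nat.
  by rewrite -rcM -rmorphD; congr (_%:C)%C; field.
apply: multiplierD; first exact: multiplier_cst.
apply: multiplierM; first exact: multiplier_cst.
by apply: multiplierD; (apply: multiplierM; [exact: multiplier_cst|exact: multiplier_eval]).
Qed.

Lemma bump01 a x chi : nm a = 1 -> 0 <= bump a x chi <= 1.
Proof.
move=> a1; have := ler_Re (chi x * a^*); rewrite nmM nm_conj a1 nm_character mulr1.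
by rewrite ler_norml /bump => /andP[? ?]; apply/andP; split; lra.
Qed.

Lemma bump_continuous a x : nm a = 1 -> continuous (bump a x).
Proof.
move=> a1 chi0; apply/(@cvgrPdist_le _ _ _ (nbhs chi0) (@nbhs_filter dual chi0)) => e e0.
apply: filterS (dual_nbhs lcG chi0 (@compact_set1 _ x) e0) => chi /(_ x erefl) h.
rewrite /bump -mulrBl opprD addrACA subrr add0r -raddfB -mulrBl normrM.
rewrite [X in _ * X]ger0_norm// ler_pdivrMr//.
apply: le_trans (ler_Re _) _; rewrite nmM nm_conj a1 mulr1 nmBC.
by apply: le_trans h _; rewrite ler_peMr ?(ltW e0)// ler1n.
Qed.

(** A bump centred at a value where the characters differ is 1 at [chi0] and less than 1 at [chi1];
    a power brings the latter under 1/4, the range of [amplify]. *)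
Lemma separated_points (chi0 chi1 : dual) : chi0 != chi1 ->
  exists U V, [/\ nbhs chi0 U, nbhs chi1 V & separated U V].
Proof.
move=> ne; have [x nx] : exists x, chi0 x <> chi1 x.
  apply: contrapT => h; move/eqP: ne; apply; apply: characterP => x.
  by apply: contrapT => nx; apply: h; exists x.
pose a := chi0 x; have a1 : nm a = 1 by exact: nm_character.
pose t := bump a x.
have t0 : t chi0 = 1.
  by rewrite /t /bump -/a nm_sqr a1 expr1n /=; field.
have t1 : t chi1 < 1.
  have /andP[_] := bump01 x chi1 a1; rewrite -/t le_eqVlt => /orP[/eqP b1|//].
  have re1 : complex.Re (chi1 x * a^*) = 1 by move: b1; rewrite /t /bump; lra.
  have z1 : chi1 x * a^* = 1.
    have : (chi1 x * a^*) * (chi1 x * a^*)^* = 1.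
      by rewrite nm_sqr nmM nm_conj a1 nm_character mulr1 expr1n.
    move: re1; case: (chi1 x * a^*) => p q /= -> /(congr1 (@complex.Re R)) /=.
    move=> h; have /eqP : q * q = 0 by move: h; lra.
    by rewrite mulf_eq0 orbb => /eqP ->.
  case: nx; have := nm_sqr a; rewrite a1 expr1n => aa.
  by rewrite -[RHS]mulr1 -[1 in RHS]aa [a * _]mulrC mulrA z1 mul1r.
have t10 : 0 <= t chi1 by have /andP[] := bump01 x chi1 a1.
have ct : `|t chi1| < 1 by rewrite ger0_norm.
have /cvgrPdist_lt/(_ 4^-1 ltac:(by rewrite invr_gt0))[N _ hN] := cvg_expr ct.
have tN : t chi1 ^+ N < 4^-1.
  by have := hN N (leqnn _); rewrite sub0r normrN ger0_norm// exprn_ge0.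
have cN : continuous (fun chi => t chi ^+ N).
  move=> chi; apply: (@continuous_comp _ _ _ t (fun y : R => y ^+ N)).
    exact: bump_continuous.
  exact: exprn_continuous.
exists [set chi | 2^-1 <= t chi ^+ N], [set chi | t chi ^+ N <= 4^-1]; split.
- have /(@cvgrPdist_le _ _ _ (nbhs chi0) (@nbhs_filter dual chi0))/(_ 2^-1) := cN chi0.
  rewrite invr_gt0 => /(_ ltac:(by [])); apply: filterS => chi.
  by rewrite t0 expr1n ler_norml /= => /andP[_ h]; lra.
- have /(@cvgrPdist_le _ _ _ (nbhs chi1) (@nbhs_filter dual chi1)) := cN chi1.
  move=> /(_ (4^-1 - t chi1 ^+ N)); rewrite subr_gt0 => /(_ tN).
  by apply: filterS => chi; rewrite ler_norml /= => /andP[h _]; lra.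
apply: (separated_amplify (t := fun chi => t chi ^+ N)) => //.
  by apply: rmultiplierX; exact: rmultiplier_bump.
move=> chi; have /andP[h0 h1] := bump01 x chi a1.
by rewrite exprn_ge0//= exprn_ile1.
Qed.

(** Compactness is used twice: a neighbourhood of one point is separated from [B], then all of [A]
    is. *)
Lemma separated_compact (A B : set dual) : compact A -> compact B ->
  A `&` B = set0 -> separated A B.
Proof.
move=> cA cB AB0.
apply: (@compact_ind _ (fun A => separated A B) A) => //.
- exact: separated0l.
- by move=> A1 A2; exact: separatedUl.
- by move=> A1 A2 A12; exact: separated_sub.
move=> chi0 Achi0.
suff [U U0 sU] : exists2 U, nbhs chi0 U & separated U B by exists U.
apply: (@compact_ind _ (fun B => exists2 U, nbhs chi0 U & separated U B) B) => //.
- by exists setT; [exact: filterT|exact: separated0r].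
- move=> B1 B2 [U U0 sU] [V V0 sV]; exists (U `&` V); first exact: filterI.
  by apply: separatedUr; [apply: separated_sub sU|apply: separated_sub sV] => // ? [].
- by move=> B1 B2 B12 [U U0 sU]; exists U => //; exact: separated_sub sU.
move=> chi1 Bchi1; have ne : chi0 != chi1.
  apply/eqP => e; suff : (A `&` B) chi0 by rewrite AB0.
  by split => //; rewrite e.
by have [U [V [U0 V1 sUV]]] := separated_points ne; exists V => //; exists U.
Qed.

End Multipliers.

(** * Inner regularity for integrals *)

Section RadonRegularity.
Context (R : realType) (X : ptopologicalType) (hX : hausdorff_space X).
Implicit Types m : {measure set (borel X) -> \bar R}.
Local Notation intg m f := (m.-integrable setT (EFin \o f)).

Lemma intg_dom m (f g : borel X -> R) : measurable_fun setT f -> intg m g ->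
  (forall x, `|f x| <= g x) -> intg m f.
Proof.
move=> mf ig fg; apply: (le_integrable measurableT _ _ ig) => [|x _].
  exact/measurable_EFinP.
by rewrite /comp !abse_EFin lee_fin (le_trans (fg x))// ler_norm.
Qed.

Lemma intg_indic m (A : set (borel X)) : measurable A -> (m A < +oo)%E -> intg m (\1_A).
Proof.
move=> mA fA; apply/integrableP; split; first by apply/measurable_EFinP; exact: measurable_indic.
rewrite (eq_integral (fun x => (\1_A x)%:E)) => [|x _]; last first.
  by rewrite /comp abse_EFin ger0_norm// indicE ler0n.
by rewrite integral_indic// setIT.
Qed.

Lemma intg_indicM m (A : set (borel X)) (h : borel X -> R) : measurable A ->
  (forall x, 0 <= h x) -> intg m h -> intg m (fun x => \1_A x * h x).
Proof.
move=> mA h0 ih; apply: intg_dom (ih) _.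
  apply: measurable_funM; first exact: measurable_indic.
  by have /integrableP[/measurable_EFinP mh _] := ih.
move=> x; rewrite normrM (ger0_norm (h0 x)) indicE.
by case: (x \in A); rewrite ?normr1 ?mul1r// normr0 mul0r.
Qed.

Lemma inner_compact m (A : set (borel X)) (e : R) : radon m -> measurable A ->
  (m A < +oo)%E -> 0 < e ->
  exists2 K : set X, compact K /\ K `<=` A & fine (m (A `\` K)) <= e.
Proof.
move=> [_ rm] mA fA e0.
have fmA : m A \is a fin_num by rewrite ge0_fin_numE.
have [_ [K [cK KA] <-] mK] : exists2 y, [set m K | K in [set K : set X | compact K /\ K `<=` A]] y
    & (m A - e%:E < y)%E.
  by apply: ereal_sup_gt; rewrite -rm// lteBlDr// lteDl// lte_fin.
have mK' := borel_compact hX cK.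
have fK : m K \is a fin_num.
  by rewrite ge0_fin_numE//; apply: le_lt_trans fA; apply: le_measure; rewrite ?inE.
exists K => //; rewrite -lee_fin fineK; last first.
  rewrite ge0_fin_numE//; apply: le_lt_trans fA; apply: le_measure; rewrite ?inE//.
  exact: measurableD.
rewrite measureD// (setIidr KA) leeBlDr//.
by rewrite addeC -leeBlDr// ltW.
Qed.

(** Inner regularity of the finite measure with density [h], although [m] itself may be infinite on
    [A]. *)
Lemma regular_integral m (h : borel X -> R) (A : set (borel X)) (e : R) :
  radon m -> (forall x, 0 <= h x) -> intg m h -> measurable A -> 0 < e ->
  exists2 K : set X, compact K /\ K `<=` A & \int[m]_x (\1_(A `\` K) x * h x) <= e.
Proof.
move=> rm h0 ih mA e0; have e2 : 0 < e / 2 by rewrite divr_gt0.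
have /integrableP[/measurable_EFinP mh _] := ih.
(* The lower bound on [h] makes [B n] of finite measure, the upper bound makes the integral small
   when the measure is; what is left of [h] tends to 0 by dominated convergence. *)
pose B n : set (borel X) := A `&` h @^-1` `[n.+1%:R^-1, n.+1%:R]%classic.
have mB n : measurable (B n).
  by apply: measurableI => //; rewrite -[X in measurable X]setTI; apply: mh.
have iB n : intg m (fun x => \1_(A `\` B n) x * h x).
  by apply: intg_indicM => //; exact: measurableD.
have lim : (\int[m]_x (\1_(A `\` B n) x * h x)%:E)%E @[n --> \oo] --> 0%E.
  rewrite -[X in _ --> X](@integral0 _ _ _ m setT).
  apply: (@dominated_cvg _ _ _ m setT measurableT _ _ (EFin \o h)) => //.
  - by move=> n; have /integrableP[] := iB n.
  - move=> x _; apply: cvg_near_cst.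
    have [hx|hx] := eqVneq (h x) 0; first by apply: nearW => n; rewrite hx mulr0.
    have hx0 : 0 < h x by rewrite lt_neqAle eq_sym hx h0.
    near=> n; rewrite indicE memNset ?mul0r// => -[Ax]; apply; split => //.
    have n1 : h x <= n.+1%:R.
      rewrite -natr1 (@le_trans _ _ n%:R)// ?lerDl//; near: n; exact: nbhs_infty_ger.
    have n2 : (h x)^-1 <= n.+1%:R.
      rewrite -natr1 (@le_trans _ _ n%:R)// ?lerDl//; near: n; exact: nbhs_infty_ger.
    by rewrite /= in_itv /= n1 andbT invf_ple ?posrE.
  - move=> n x _; rewrite abse_EFin lee_fin normrM (ger0_norm (h0 x)) indicE.
    by case: (x \in _); rewrite ?normr1 ?mul1r// normr0 mul0r.
have [n hn] : exists n, \int[m]_x (\1_(A `\` B n) x * h x) <= e / 2.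
  have /fine_cvgP[_ /cvgrPdist_le/(_ _ e2)[n _ /(_ n (leqnn n))]] := lim.
  rewrite sub0r normrN => hn; exists n; apply: le_trans hn; exact: ler_norm.
have n0 : 0 < n.+1%:R :> R by rewrite ltr0n.
have fB : (m (B n) < +oo)%E.
  have : intg m (\1_(B n)).
    apply: (@intg_dom _ _ (fun x => n.+1%:R * h x)).
    - exact: measurable_indic.
    - have := integrableZl measurableT n.+1%:R ih; congr integrable.
    - move=> x; rewrite indicE; case: (boolP (x \in B n)) => [|_]; last by rewrite normr0 mulr_ge0.
      rewrite inE => -[_]; rewrite /= in_itv /= => /andP[hx _].
      by rewrite normr1 -(ler_pdivrMl _ _ n0) mulr1.
  move/integrableP => [_]; rewrite (eq_integral (fun x => (\1_(B n) x)%:E)) => [|x _]; last first.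
    by rewrite /comp abse_EFin ger0_norm// indicE ler0n.
  by rewrite integral_indic// setIT.
have d0 : 0 < e / 2 / n.+1%:R by rewrite divr_gt0.
have [K [cK KB] hK] := inner_compact rm (mB n) fB d0.
have mK := borel_compact hX cK.
have fBK : (m (B n `\` K) < +oo)%E.
  apply: le_lt_trans fB; apply: le_measure; rewrite ?inE//; exact: measurableD.
exists K; first by split => // x /KB[].
have iBK : intg m (\1_(B n `\` K)) by apply: intg_indic => //; exact: measurableD.
have iBKn : intg m (fun x => n.+1%:R * \1_(B n `\` K) x).
  by have := integrableZl measurableT n.+1%:R iBK; congr integrable.
apply: (@le_trans _ _ (\int[m]_x (\1_(A `\` B n) x * h x + n.+1%:R * \1_(B n `\` K) x))).
  apply: le_Rintegral => //.
  - by apply: intg_indicM => //; exact: measurableD.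
  - by have := integrableD measurableT (iB n) iBKn; congr integrable.
  - move=> x _; rewrite !indicE.
    have [Bx|nBx] := pselect (B n x); last first.
      have -> : (x \in B n `\` K) = false by rewrite memNset// => -[].
      rewrite mulr0 addr0 ler_wpM2r// ler_nat; case: (boolP (x \in A `\` K)) => [|_]; last exact: leq0n.
      by rewrite inE => -[Ax _]; rewrite mem_set.
    have hx : h x <= n.+1%:R by case: Bx => _ /=; rewrite in_itv /= => /andP[].
    have -> : (x \in A `\` B n) = false by rewrite memNset// => -[].
    have -> : (x \in A `\` K) = (x \in B n `\` K).
      by apply/idP/idP; rewrite !inE => -[? ?]; split => //; case: Bx.
    by rewrite mul0r add0r mulrC ler_wpM2r// ler0n.
rewrite RintegralD// RintegralZl//.
rewrite [e]splitr; apply: lerD => //.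
rewrite /Rintegral integral_indic//; last exact: measurableD.
rewrite setIT; apply: le_trans (ler_wpM2l (ltW n0) hK) _.
by rewrite mulrC divfK// gt_eqF.
Unshelve. all: by end_near. Qed.

End RadonRegularity.

(** * Two measures with the same transform *)

Section Uniqueness.
Context (R : realType) (G : topologicalZmodType) (lcG : lcag G).
Local Notation C := R[i].
Local Notation dual := (character R G).
Context (mu : {measure set (borel G) -> \bar R}) (haar_mu : haar mu).
Local Notation intg m f := (m.-integrable setT (EFin \o f)).

Let hG : hausdorff_space G. Proof. by case: lcG. Qed.
Let hdual : hausdorff_space dual. Proof. exact: dual_hausdorff. Qed.

Implicit Types m : {measure set (borel dual) -> \bar R}.
Implicit Types g h r : borel dual -> R.

Definition sq_ft (phi : G -> C) : borel dual -> R := fun chi => nm (ft mu phi chi) ^+ 2.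

Lemma sq_ft_ge0 phi chi : 0 <= sq_ft phi chi. Proof. exact: sqr_ge0. Qed.

Definition close m g g' (e : R) : Prop :=
  intg m g' /\ \int[m]_x `|g x - g' x| <= e.

Lemma intg_abs m g : intg m g -> intg m (fun x => `|g x|).
Proof. by move=> /integrable_abse; congr integrable. Qed.

Lemma intgB m g g' : intg m g -> intg m g' -> intg m (fun x => g x - g' x).
Proof. by move=> ig ig'; have := integrableB measurableT ig ig'; congr integrable. Qed.

Lemma close_dom m g g' k e : intg m g -> intg m g' -> intg m k ->
  (forall x, `|g x - g' x| <= k x) -> \int[m]_x k x <= e -> close m g g' e.
Proof.
move=> ig ig' ik gk ke; split => //; apply: le_trans ke.
by apply: le_Rintegral => //; apply: intg_abs; exact: intgB.
Qed.

Lemma intg_density m g r : intg m g -> measurable_fun setT r ->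
  (forall x, `|r x| <= 1) -> intg m (fun x => g x * r x).
Proof.
move=> ig mr r1; apply: intg_dom (intg_abs ig) _.
  by have /integrableP[/measurable_EFinP mg _] := ig; exact: measurable_funM.
by move=> x; rewrite normrM ler_piMr.
Qed.

Lemma close_density m g g' r e : intg m g -> close m g g' e ->
  measurable_fun setT r -> (forall x, `|r x| <= 1) ->
  `|\int[m]_x (g x * r x) - \int[m]_x (g' x * r x)| <= e.
Proof.
move=> ig [ig' h] mr r1; apply: le_trans h.
rewrite -RintegralB//; [|exact: intg_density..].
have -> : \int[m]_x (g x * r x - g' x * r x) = \int[m]_x ((g x - g' x) * r x).
  by apply: eq_Rintegral => x _; rewrite mulrBl.
have iB := intgB ig ig'.
apply: le_trans (le_normr_Rintegral _ _) _ => //; first exact: intg_density.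
apply: le_Rintegral => //; first by apply: intg_abs; exact: intg_density.
  exact: intg_abs.
by move=> x _; rewrite normrM ler_piMr.
Qed.

Lemma close_cutoff m h g' (t : dual -> R) (K K' : set dual) (e : R) :
  compact K -> compact K' -> 0 < e -> e <= 1 ->
  (forall x, 0 <= h x) -> intg m h -> intg m g' ->
  (forall x, g' x = t x ^+ 2 * h x) -> (forall x, 0 <= t x <= 1) ->
  (forall x, K x -> 1 - e <= t x) -> (forall x, K' x -> t x <= e) ->
  \int[m]_x (\1_(~` (K : set (borel dual)) `\` K') x * h x) <= e ->
  close m (fun x => \1_(K : set (borel dual)) x * h x) g' (e * (2 * \int[m]_x h x + 1)).
Proof.
move=> cK cK' e0 e1 h0 ih ig' g'E t01 tK tK' he.
have mK := borel_compact hdual cK; have mK' := borel_compact hdual cK'.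
have mKK' : measurable (~` (K : set (borel dual)) `\` K').
  by apply: measurableD => //; exact: measurableC.
have i1 : intg m (fun x => 2 * e * h x).
  by have := integrableZl measurableT (2 * e) ih; congr integrable.
have i2 := intg_indicM mKK' h0 ih.
(* On [K], [1 - t ^ 2] is at most [2 * e]; on [K'], [t ^ 2] is at most [e ^ 2]; elsewhere the
   integral of [h] is small. *)
apply: (@close_dom _ _ _ (fun x => 2 * e * h x + \1_(~` (K : set (borel dual)) `\` K') x * h x)) => //.
- exact: intg_indicM.
- by have := integrableD measurableT i1 i2; congr integrable.
- move=> x; rewrite g'E -mulrBl normrM (ger0_norm (h0 x)) -mulrDl ler_wpM2r//.
  have /andP[t0 t1] := t01 x; rewrite !indicE.
  have [Kx|nKx] := pselect (K x).
    rewrite mem_set// memNset ?addr0; last by case.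
    have := tK x Kx; rewrite ger0_norm ?subr_ge0 ?expr_le1//= => te; nra.
  rewrite memNset// sub0r normrN ger0_norm ?sqr_ge0//.
  have [K'x|nK'x] := pselect (K' x).
    by rewrite memNset ?addr0; [have := tK' x K'x; nra|case].
  have tt : t x ^+ 2 <= 1 by rewrite exprn_ile1.
  by rewrite [x \in _]mem_set//=; move: e0 tt; lra.
- rewrite RintegralD// RintegralZl// mulrDr mulr1 lerD//.
  by rewrite mulrA [e * 2]mulrC.
Qed.

Section TwoMeasures.
Context (m m' : {measure set (borel dual) -> \bar R}).
Context (rm : radon m) (rm' : radon m').
Context (r r' : borel dual -> R).
Context (mr : measurable_fun setT r) (mr' : measurable_fun setT r').
Context (r1 : forall x, `|r x| <= 1) (r'1 : forall x, `|r' x| <= 1).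

(** [r] and [r'] stand for the real parts, or the imaginary parts, of the two phases. *)
Definition same g : Prop :=
  [/\ intg m g, intg m' g & \int[m]_x (g x * r x) = \int[m']_x (g x * r' x)].

Lemma same_close g : intg m g -> intg m' g ->
  (forall e, 0 < e -> exists g', [/\ same g', close m g g' e & close m' g g' e]) ->
  same g.
Proof.
move=> ig ig' h; split => //; apply/eqP; rewrite -subr_eq0 -normr_le0.
apply/ler_addgt0Pr => e e0; rewrite add0r; have e2 : 0 < e / 2 by rewrite divr_gt0.
have [g' [[_ _ sg] c c']] := h _ e2.
have h1 := close_density ig c mr r1; have h2 := close_density ig' c' mr' r'1.
rewrite sg in h1; rewrite distrC in h2.
by rewrite -(subrKA (\int[m']_x (g' x * r' x))) (le_trans (ler_normD _ _))// [e]splitr lerD.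
Qed.

Context (same_ft : forall phi, ccC phi -> same (sq_ft phi)).

(** Compact sets [K1] and [K2] carry almost all of the integral off [K] for the respective measures.
    A multiplier near 1 on [K] and near 0 on both turns [phi] into a [psi] whose squared transform
    approximates the cutoff. *)
Lemma same_compact_ft phi (K : set dual) : ccC phi -> compact K ->
  same (fun x => \1_(K : set (borel dual)) x * sq_ft phi x).
Proof.
move=> cphi cK; have [ih ih' _] := same_ft cphi.
have h0 := sq_ft_ge0 phi; have mK := borel_compact hdual cK.
apply: same_close => [||e e0]; [exact: intg_indicM..|].
pose I := \int[m]_x sq_ft phi x + \int[m']_x sq_ft phi x.
have I0 : 0 <= \int[m]_x sq_ft phi x by exact: Rintegral_ge0.
have I'0 : 0 <= \int[m']_x sq_ft phi x by exact: Rintegral_ge0.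
have p0 : 0 < 2 * I + 1 by rewrite ltr_wpDl// mulr_ge0// addr_ge0.
pose d := Num.min 1 (e / (2 * I + 1)).
have d0 : 0 < d by rewrite lt_min ltr01 divr_gt0.
have d1 : d <= 1 by rewrite ge_min lexx.
have de : d * (2 * I + 1) <= e by rewrite -ler_pdivlMr// /d ge_min lexx orbT.
have mC : measurable (~` (K : set (borel dual))) by exact: measurableC.
have [K1 [cK1 sK1] hK1] := regular_integral hdual rm h0 ih mC d0.
have [K2 [cK2 sK2] hK2] := regular_integral hdual rm' h0 ih' mC d0.
have cK12 : compact (K1 `|` K2) by exact: compactU.
have [|t [mt t01 tK tK']] := separated_compact lcG haar_mu cK cK12 _ d0.
  by apply/seteqP; split => // x [Kx [/sK1|/sK2]].
have [psi cpsi hpsi] := mt phi cphi.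
have sE x : sq_ft psi x = t x ^+ 2 * sq_ft phi x.
  by rewrite /sq_ft hpsi nmM nm_real ger0_norm ?exprMn//; case/andP: (t01 x).
have [j j' js] := same_ft cpsi.
have mon (n : {measure set (borel dual) -> \bar R}) (K0 : set (borel dual)) : compact K0 -> K0 `<=` K1 `|` K2 ->
    intg n (sq_ft phi) ->
    \int[n]_x (\1_(~` (K : set (borel dual)) `\` K0) x * sq_ft phi x) <= d ->
    \int[n]_x (\1_(~` (K : set (borel dual)) `\` (K1 `|` K2)) x * sq_ft phi x) <= d.
  move=> cK0 sub inn; apply: le_trans; apply: le_Rintegral => //.
  - by apply: intg_indicM => //; apply: measurableD => //; exact: borel_compact.
  - by apply: intg_indicM => //; apply: measurableD => //; exact: borel_compact.
  - move=> x _; rewrite ler_wpM2r// !indicE ler_nat.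
    case: (boolP (x \in _ `\` (_ `|` _))) => //; rewrite inE => -[a b].
    by rewrite mem_set//; split => // /sub.
have fin (n : {measure set (borel dual) -> \bar R}) (K0 : set (borel dual)) : compact K0 -> K0 `<=` K1 `|` K2 ->
    intg n (sq_ft phi) -> intg n (sq_ft psi) -> \int[n]_x sq_ft phi x <= I ->
    \int[n]_x (\1_(~` (K : set (borel dual)) `\` K0) x * sq_ft phi x) <= d ->
    close n (fun x => \1_(K : set (borel dual)) x * sq_ft phi x) (sq_ft psi) e.
  move=> cK0 sub i1 i2 leI /(mon _ _ cK0 sub i1) hd.
  have [? hc] := close_cutoff cK cK12 d0 d1 h0 i1 i2 sE t01 tK tK' hd.
  split => //; apply: le_trans hc _; apply: le_trans de.
  by rewrite ler_wpM2l ?(ltW d0)// lerD2r ler_wpM2l.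
exists (sq_ft psi); split; first exact: same_ft.
  by apply: (fin m K1) => //; rewrite lerDl.
by apply: (fin m' K2) => //; rewrite lerDr.
Qed.

(** An approximate identity makes [sq_ft phi] close to 1 on [K], which has finite measure. *)
Lemma same_compact (K : set dual) : compact K -> same (\1_(K : set (borel dual))).
Proof.
move=> cK; have mK := borel_compact hdual cK.
have iK := intg_indic mK (rm.1 _ cK); have iK' := intg_indic mK (rm'.1 _ cK).
apply: same_close => // e e0.
pose M := fine (m K) + fine (m' K).
have M0 : 0 <= M by rewrite addr_ge0// fine_ge0.
have p0 : 0 < 3 * (M + 1) by rewrite mulr_gt0// ltr_wpDl.
(* The factor 3 bounds [1 + nm (ft mu phi x)] on [K], since [d <= 1]. *)
pose d := Num.min 1 (e / (3 * (M + 1))).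
have d0 : 0 < d by rewrite lt_min ltr01 divr_gt0.
have d1 : d <= 1 by rewrite ge_min lexx.
have de : d * (3 * (M + 1)) <= e by rewrite -ler_pdivlMr// /d ge_min lexx orbT.
have [phi cphi hphi] := approximate_identity lcG haar_mu cK d0.
have fin (n : {measure set (borel dual) -> \bar R}) : intg n (\1_(K : set (borel dual))) ->
    intg n (fun x => \1_(K : set (borel dual)) x * sq_ft phi x) -> fine (n K) <= M ->
    close n (\1_(K : set (borel dual))) (fun x => \1_(K : set (borel dual)) x * sq_ft phi x) e.
  move=> i1 i2 leM; have i3 : intg n (fun x => 3 * d * \1_(K : set (borel dual)) x).
    by have := integrableZl measurableT (3 * d) i1; congr integrable.
  apply: (close_dom i1 i2 i3) => [x|].
    rewrite indicE; case: (boolP (x \in (K : set (borel dual)))) => [|_]; last first.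
      by rewrite mul0r subrr normr0 mulr0.
    rewrite inE => /hphi hx; rewrite mul1r mulr1 /sq_ft.
    have := nm_dist (ft mu phi x) 1; rewrite nm1 => hd.
    have n0 := nm_ge0 (ft mu phi x).
    have /ler_normlP[a1 a2] := le_trans hd hx.
    have -> : 1 - nm (ft mu phi x) ^+ 2 = (1 + nm (ft mu phi x)) * (1 - nm (ft mu phi x)) by ring.
    rewrite normrM; apply: ler_pM => //; last by rewrite distrC (le_trans hd).
    by rewrite ger0_norm ?addr_ge0//; move: d1 a2; lra.
  rewrite RintegralZl// /Rintegral integral_indic// setIT.
  apply: le_trans de; rewrite [3 * d]mulrC -mulrA ler_wpM2l ?(ltW d0)//.
  by rewrite ler_wpM2l// (le_trans leM)// lerDl.
have [j j' js] := same_compact_ft cphi cK.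
exists (fun x => \1_(K : set (borel dual)) x * sq_ft phi x); split => //.
  by apply: fin => //; rewrite lerDl fine_ge0.
by apply: fin => //; rewrite lerDr fine_ge0.
Qed.

Lemma same_bounded (A : set dual) : bounded_borel A ->
  \int[m]_(x in A) r x = \int[m']_(x in A) r' x.
Proof.
move=> [mA pA]; have cA : compact (closure A) by rewrite -precompactE.
have mcA := borel_compact hdual cA.
have fA (n : {measure set (borel dual) -> \bar R}) : radon n -> (n A < +oo)%E.
  move=> rn; apply: le_lt_trans (rn.1 _ cA); apply: le_measure; rewrite ?inE//.
  exact: subset_closure.
have EI (n : {measure set (borel dual) -> \bar R}) (q : borel dual -> R) :
    \int[n]_(x in (A : set (borel dual))) q x = \int[n]_x (\1_(A : set (borel dual)) x * q x).
  rewrite Rintegral_mkcond; apply: eq_Rintegral => x _; rewrite patchE indicE.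
  by case: ifPn => _; rewrite ?mul1r// mul0r.
have iA (n : {measure set (borel dual) -> \bar R}) (rn : radon n) := intg_indic mA (fA n rn).
rewrite !EI; suff [] : same (\1_(A : set (borel dual))) by [].
apply: same_close; [exact: iA|exact: iA|move=> e e0].
have [K1 [cK1 sK1] hK1] := inner_compact hdual rm mA (fA _ rm) e0.
have [K2 [cK2 sK2] hK2] := inner_compact hdual rm' mA (fA _ rm') e0.
have cK : compact (K1 `|` K2) by exact: compactU.
have mK := borel_compact hdual cK.
have sK : K1 `|` K2 `<=` A by move=> x [/sK1|/sK2].
have fin (n : {measure set (borel dual) -> \bar R}) (K0 : set (borel dual)) : radon n ->
    compact K0 -> K0 `<=` K1 `|` K2 -> fine (n ((A : set (borel dual)) `\` K0)) <= e ->
    close n (\1_(A : set (borel dual))) (\1_((K1 `|` K2) : set (borel dual))) e.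
  move=> rn cK0 sub hK0; have mK0 := borel_compact hdual cK0.
  have mD : measurable ((A : set (borel dual)) `\` K0) by exact: measurableD.
  have fD : (n ((A : set (borel dual)) `\` K0) < +oo)%E.
    by apply: le_lt_trans (fA n rn); apply: le_measure; rewrite ?inE//; exact: subDsetl.
  apply: (close_dom (iA n rn) (intg_indic mK (rn.1 _ cK)) (intg_indic mD fD)) => [x|].
    rewrite !indicE; have [Kx|nKx] := pselect ((K1 `|` K2) x).
      have Ax : A x by exact: sK.
      by rewrite [in X in X - _]mem_set// [x \in (_ `|` _)]mem_set// subrr normr0.
    rewrite [x \in (_ `|` _)]memNset// subr0 normr_nat ler_nat.
    case: (boolP (x \in (A : set (borel dual)))) => //; rewrite inE => Ax.
    by rewrite mem_set//; split => // /sub.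
  by rewrite /Rintegral integral_indic// setIT.
exists (\1_((K1 `|` K2) : set (borel dual))); split; first exact: same_compact.
  by apply: (fin m K1) => // x; left.
by apply: (fin m' K2) => // x; right.
Qed.

End TwoMeasures.
End Uniqueness.

(** The transforms of [nu] and [nu'] give equal complex integrals; real and imaginary parts of the
    phases are then treated as two instances of [same_bounded]. *)
Lemma transform_unique (R : realType) (G : topologicalZmodType)
    (mu : {measure set (borel G) -> \bar R}) (gam : cmeasure R G)
    (nu nu' : cmeasure R (character R G)) : lcag G -> haar mu ->
  transforms_to mu gam nu -> transforms_to mu gam nu' -> cmeasure_eq nu' nu.
Proof.
move=> lcG haar_mu tnu tnu'; have hG : hausdorff_space G by case: lcG.
have parts (phi : G -> R[i]) : ccC phi -> forall n, transforms_to mu gam n ->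
    (tvar n).-integrable setT (EFin \o sq_ft mu phi) /\
    cmintegral gam (convolution mu phi (tilde phi)) =
    ((\int[tvar n]_x (sq_ft mu phi x * complex.Re (phase n x))) +i*
     (\int[tvar n]_x (sq_ft mu phi x * complex.Im (phase n x))))%C.
  move=> /(ccCP phi hG) cphi n /(_ phi cphi) /=.
  have hE chi : `|fourier mu phi (- chi)| ^+ 2 = (sq_ft mu phi chi)%:C%C.
    by rewrite fourierN nmE rmorphXn.
  move=> [[a _] ->]; split.
    by move: a; congr integrable; apply/funext => chi; congr EFin; rewrite hE.
  rewrite /cmintegral /cintegral; congr (_ +i* _)%C; apply: eq_Rintegral => chi _.
    by rewrite hE; case: (phase n chi) => p q /=; rewrite mul0r subr0.
  by rewrite hE; case: (phase n chi) => p q /=; rewrite mul0r addr0.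
have phase1 (n : cmeasure R (character R G)) chi : nm (phase n chi) = 1.
  by have := norm_phase n chi; rewrite nmE => /(congr1 (@complex.Re R)).
move=> A bA; rewrite /cmeasure_of /cintegral.
have [mr mi] := measurable_phase nu; have [mr' mi'] := measurable_phase nu'.
congr (_ +i* _)%C; apply: (same_bounded lcG haar_mu (tvar_radon nu') (tvar_radon nu)) => //.
- by move=> chi; rewrite -(phase1 nu' chi); exact: ler_Re.
- by move=> chi; rewrite -(phase1 nu chi); exact: ler_Re.
- move=> phi cphi; have [i e] := parts _ cphi _ tnu; have [i' e'] := parts _ cphi _ tnu'.
  by split => //; move: e; rewrite e' => -[].
- by move=> chi; rewrite -(phase1 nu' chi); exact: ler_Im.
- by move=> chi; rewrite -(phase1 nu chi); exact: ler_Im.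
- move=> phi cphi; have [i e] := parts _ cphi _ tnu; have [i' e'] := parts _ cphi _ tnu'.
  by split => //; move: e; rewrite e' => -[].
Qed.

Theorem theorem3 (R : realType) (G H : topologicalZmodType)
    (mu : {measure set (borel G) -> \bar R})
    (theta : {measure set (borel H) -> \bar R})
    (L : set (G * H)) (F : set (borel G * borel H))
    (D : nat -> set G) (W : set H) (b : H -> R[i])
    (lcagG : lcag G) (lcagH : lcag H)
    (haar_mu : haar mu) (haar_theta : haar theta)
    (cpL : cut_and_project L) (fundF : fundamental_domain L F)
    (vanHoveD : van_hove mu D)
    (windowW : window W)
    (repetitiveW : repetitive (model_set L W))
    (generatesW : generated_subgroup (mdiff (model_set L W) (model_set L W))
                  = fst @` L)
    (regularW : W = closure (interior W))
    (aperiodicW : [set c : H | translate c W = W] = [set 0])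
    (boundaryW : theta (topological_boundary W) = 0%E)
    (contb : continuous b) (compactb : compact (tsupport b))
    (supportb : tsupport b `<=` W) :
  let Ldual := annihilator R L in
  let covolume := fine ((mu \x theta)%E F) in
  exists2 nu : cmeasure R (character R G),
    is_diffraction mu D (model_set L W) (fun s => b (star L s)) nu &
    is_weighted_comb nu (fst @` Ldual)
      (fun chi => Normc.normc (fourier theta b (- star Ldual chi)) ^+ 2
                  / covolume ^+ 2).
Proof.
move=> Ldual covolume.
have hH : hausdorff_space H by case: lcagH.
have cb : ccC b by apply/(ccCP b hH); split.
have bK y : b y != 0 -> tsupport b y by move=> by0; exact: subset_closure.
have bW y : b y != 0 -> W y by move=> /bK/supportb.
exists (diffraction_measure lcagG lcagH cpL haar_mu haar_theta fundF cb); last first.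
  exact: diffraction_comb.
(* The compact set that bounds the support is [tsupport b] itself. *)
exists (gamma lcagG lcagH cpL mu theta F compactb bK).
  exact: (gamma_autocorrelation haar_mu haar_theta fundF vanHoveD cb bW).
have tr := diffraction_transform lcagG lcagH cpL haar_mu haar_theta fundF cb compactb bK.
by split => // nu' /(transform_unique lcagG haar_mu tr).
Qed.
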